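(* Let $n\ge2$. For any bounded Lipschitz domain $\Omega\subset\mathbb{R}^n$ and any integer $m\ge1$ one has $$C_B^{(m)}(\Omega)=\sup_{f\in X_m(\Omega,\mathbb{R})\setminus\{0\}}\ \frac{\|f\|_{m,\Omega}^2}{\|\nabla((-\Delta)^mf)\|_{H^{-m-1}(\Omega)}^2}.$$
   Context: For $u,v\in H^m_0(\Omega,\mathbb{R})$, $$(u,v)_{m,\Omega}=\int_\Omega(\Delta^ku)(\Delta^kv)\,dx\ \text{ if }m=2k,\qquad(u,v)_{m,\Omega}=\int_\Omega\nabla(\Delta^ku)\cdot\nabla(\Delta^kv)\,dx\ \text{ if }m=2k+1;$$ this is a scalar product on $H^m_0(\Omega,\mathbb{R})$ whose norm, denoted $\|\cdot\|_{m,\Omega}$, is equivalent to the $H^m$-norm; the same notation is used for vector fields in $H^m_0(\Omega,\mathbb{R}^n)$ (sum over components). $L^2_0(\Omega,\mathbb{R})$ is the space of zero-mean functions in $L^2(\Omega,\mathbb{R})$ and $X_m(\Omega,\mathbb{R})=H^m_0(\Omega,\mathbb{R})\cap L^2_0(\Omega,\mathbb{R})$. The $m$-th order Bogovskii constant is $$C_B^{(m)}(\Omega)=\sup_{f\in X_m(\Omega,\mathbb{R}),\ \|f\|_{m,\Omega}=1}\ \inf\Big\{\|v\|_{m+1,\Omega}^2;\ v\in H^{m+1}_0(\Omega,\mathbb{R}^n),\ \nabla\cdot v=f\text{ in }\Omega\Big\},$$ which is finite. $H^{-m-1}(\Omega)$ is the dual of $H^{m+1}_0(\Omega,\mathbb{R}^n)$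 normed by $\|\cdot\|_{m+1,\Omega}$, and $\nabla((-\Delta)^mf)$ is the functional $v\mapsto-(f,\nabla\cdot v)_{m,\Omega}$, so that $$\|\nabla((-\Delta)^mf)\|_{H^{-m-1}(\Omega)}=\sup_{v\in H^{m+1}_0(\Omega,\mathbb{R}^n)\setminus\{0\}}\frac{|(f,\nabla\cdot v)_{m,\Omega}|}{\|v\|_{m+1,\Omega}}.$$ *)

(* Defs.v *)
From HB Require Import structures.
From mathcomp Require Import all_boot all_order all_algebra.
From mathcomp Require Import all_classical all_reals all_analysis.

Set Implicit Arguments.
Unset Strict Implicit.
Unset Printing Implicit Defensive.

Import Order.TTheory GRing.Theory Num.Theory.
Import numFieldNormedType.Exports.

Local Open Scope classical_set_scope.
Local Open Scope ring_scope.

(* 'rV[R]_n carries the product of the Borel sigma-algebras of its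
   coordinates, as n.-tuple R does in the library. *)
Section measurable_rV.
Context (R : realType) (n : nat).

Let coor (i : 'I_n) (x : 'rV[R]_n) : measurableTypeR R := x 0 i.

Let rV_set0 : g_sigma_preimage coor set0.
Proof. exact: sigma_algebra0. Qed.

Let rV_setC A : g_sigma_preimage coor A -> g_sigma_preimage coor (~` A).
Proof. exact: sigma_algebraC. Qed.

Let rV_bigcup (F : (set 'rV[R]_n)^nat) :
  (forall i, g_sigma_preimage coor (F i)) ->
  g_sigma_preimage coor (\bigcup_i F i).
Proof. exact: sigma_algebra_bigcup. Qed.

HB.instance Definition _ := @isMeasurable.Build default_measure_display
  'rV[R]_n (g_sigma_preimage coor) rV_set0 rV_setC rV_bigcup.

Lemma measurable_coor (i : 'I_n) :
  measurable_fun [set: 'rV[R]_n] (fun x => x 0 i : measurableTypeR R).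
Proof.
move=> _ Y mY; rewrite setTI; apply: sub_sigma_algebra => /=.
rewrite -bigcup_seq/=; exists i => /=; first by rewrite mem_index_enum.
by exists Y => //; rewrite setTI.
Qed.

Lemma measurable_fun_coorP d (T : measurableType d) (f : T -> 'rV[R]_n) :
  (forall i, measurable_fun [set: T] (fun t => f t 0 i : measurableTypeR R)) ->
  measurable_fun [set: T] f.
Proof.
move=> mf _ Y mY.
pose G := image_set_system [set: T] f measurable.
suff: G Y by rewrite /G /image_set_system.
apply: mY; split; first exact/sigma_algebra_image/sigma_algebra_measurable.
move=> A; rewrite -bigcup_seq/= => -[i _ [B mB <-]].
rewrite /G /image_set_system /= setTI.
exact: (mf i measurableT B mB).
Qed.

End measurable_rV.

Section lebesgue_rV.
Context (R : realType).

Definition rV_cons n (p : measurableTypeR R * 'rV[R]_n) : 'rV[R]_n.+1 :=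
  row_mx (const_mx p.1 : 'rV[R]_1) p.2.

Lemma rV_cons0 n p : @rV_cons n p 0 ord0 = p.1.
Proof.
rewrite (_ : ord0 = lshift n (ord0 : 'I_1)); last exact/val_inj.
by rewrite /rV_cons; apply: (etrans (row_mxEl _ _ _ _)); rewrite mxE.
Qed.

Lemma rV_consS n p (j : 'I_n) : rV_cons p 0 (lift ord0 j) = p.2 0 j.
Proof.
rewrite (_ : lift ord0 j = rshift 1 j); last exact/val_inj.
exact: row_mxEr.
Qed.

Lemma measurable_rV_cons n : measurable_fun setT (@rV_cons n).
Proof.
apply: measurable_fun_coorP => i; case: (unliftP ord0 i) => [j|] ->.
  rewrite (_ : (fun _ => _) = (fun x : 'rV[R]_n => x 0 j) \o snd).
    by apply: measurableT_comp; [exact: measurable_coor|exact: measurable_snd].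
  by apply/funext => p; exact: rV_consS.
rewrite (_ : (fun _ => _) = fst); first exact: measurable_fst.
by apply/funext => p; exact: rV_cons0.
Qed.

Section step.
Context (n : nat) (mu : {sigma_finite_measure set 'rV[R]_n -> \bar R}).

Definition lebesgue_cons : set 'rV[R]_n.+1 -> \bar R :=
  pushforward (lebesgue_measure \x mu)%E (@rV_cons n).

Let mpre A : measurable A -> measurable (@rV_cons n @^-1` A).
Proof.
by move=> mA; rewrite -[X in measurable X]setTI; exact: measurable_rV_cons.
Qed.

Let nu0 : lebesgue_cons set0 = 0%E.
Proof. by rewrite /lebesgue_cons /pushforward preimage_set0 measure0. Qed.

Let nu_ge0 A : (0 <= lebesgue_cons A)%E.
Proof. exact: (measure_ge0 (lebesgue_measure \x mu)%E). Qed.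

Let nu_sigma_additive : semi_sigma_additive lebesgue_cons.
Proof.
move=> F mF tF mUF; rewrite /lebesgue_cons /pushforward preimage_bigcup.
apply: measure_semi_sigma_additive.
- by move=> k; apply: mpre; exact: mF.
- apply/trivIsetP => /= i j _ _ ij; rewrite -preimage_setI.
  by move/trivIsetP : tF => /(_ _ _ _ _ ij) ->//; rewrite preimage_set0.
- by rewrite -preimage_bigcup; exact: mpre.
Qed.

HB.instance Definition _ := isMeasure.Build _ _ _ lebesgue_cons
  nu0 nu_ge0 nu_sigma_additive.

Let nu_sigma_finite : sigma_finite setT lebesgue_cons.
Proof.
have /sigma_finiteP[F [FT ndF Foo]] := sigma_finiteT (@lebesgue_measure R).
have /sigma_finiteP[G [GT ndG Goo]] := sigma_finiteT mu.
pose dec (x : 'rV[R]_n.+1) : measurableTypeR R * 'rV[R]_n :=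
  (x 0 ord0, \row_j x 0 (lift ord0 j)).
have mdec : measurable_fun setT dec.
  apply/measurable_fun_pairP; split => /=; first exact: measurable_coor.
  apply: measurable_fun_coorP => i /=.
  rewrite (_ : (fun _ => _) = (fun x : 'rV[R]_n.+1 => x 0 (lift ord0 i))).
    exact: measurable_coor.
  by apply/funext => x /=; rewrite mxE.
have consK p : dec (rV_cons p) = p.
  case: p => a x; rewrite /dec rV_cons0; congr pair.
  by apply/rowP => j; rewrite mxE rV_consS.
exists (fun k => dec @^-1` (F k `*` G k)).
  apply/esym/seteqP; split => // x _.
  have [k _ Fk] : (\bigcup_k F k) (dec x).1 by rewrite -FT.
  have [l _ Gl] : (\bigcup_k G k) (dec x).2 by rewrite -GT.
  exists (maxn k l) => //; split.
    by move: Fk; exact/subsetPset/ndF/leq_maxl.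
  by move: Gl; exact/subsetPset/ndG/leq_maxr.
move=> k; have [mF Fk] := Foo k; have [mG Gk] := Goo k.
have mFG : measurable (F k `*` G k) by exact: measurableX.
split; first by rewrite -[X in measurable X]setTI; exact: mdec.
rewrite /lebesgue_cons /pushforward -comp_preimage.
rewrite (_ : dec \o _ = id); last by apply/funext => p /=; exact: consK.
by rewrite preimage_id product_measure1E// lte_mul_pinfty// ge0_fin_numE.
Qed.

HB.instance Definition _ := Measure_isSigmaFinite.Build _ _ _ lebesgue_cons
  nu_sigma_finite.

End step.

Fixpoint lebesgue_rV n : {sigma_finite_measure set 'rV[R]_n -> \bar R} :=
  match n with
  | 0 => dirac (0 : 'rV[R]_0)
  | n'.+1 => lebesgue_cons (lebesgue_rV n')
  end.

End lebesgue_rV.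

(* Locally, and up to an isometry x |-> x *m Q, the set is the strict epigraph
   of a Lipschitz function.  The norms here are the library's sup norms, which
   define the same notion as the Euclidean ones. *)
Definition lipschitz_boundary (R : realType) (n : nat) (Om : set 'rV[R]_n) :=
  forall x, (closure Om `\` interior Om) x ->
    exists (Q : 'M[R]_n) (i : 'I_n) (g : 'rV[R]_n.-1 -> R) (r : R),
      [/\ Q *m Q^T = 1%:M, [lipschitz g y | y in setT], 0 < r &
          forall y, ball x r y ->
            (Om y <-> g (col' i (y *m Q)) < (y *m Q) 0 i)].

Definition bounded_lipschitz_domain (R : realType) (n : nat)
    (Om : set 'rV[R]_n) :=
  [/\ Om !=set0, open Om, connected Om, bounded_set Om & lipschitz_boundary Om].

Section sobolev.
Context (R : realType) (n : nat) (Om : set 'rV[R]_n).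
Implicit Types (u w f : 'rV[R]_n -> R) (v : 'rV[R]_n -> 'rV[R]_n) (m : nat).

Local Notation mu := (lebesgue_rV R n).

Definition ae_eq_on u w := {ae mu, forall x, Om x -> u x = w x}.

(* Iterated classical partial derivative along a list of coordinate indices. *)
Fixpoint pderiv (s : seq 'I_n) u : 'rV[R]_n -> R :=
  if s is i :: s' then fun x => 'D_(delta_mx 0 i) (pderiv s' u) x else u.

Definition test_function u :=
  [/\ forall s x, differentiable (pderiv s u) x,
      compact (closure [set x | u x != 0]) &
      closure [set x | u x != 0] `<=` Om].

Definition L2 u := u \_ Om \in Lfun mu 2%:E.

Definition is_weak_deriv (s : seq 'I_n) u w := L2 w /\
  forall phi, test_function phi ->
    \int[mu]_(x in Om) (u x * pderiv s phi x) =
    (-1) ^+ size s * \int[mu]_(x in Om) (w x * phi x).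

(* A representative of the weak derivative in L^2(Om) (unique up to a.e.
   equality), and 0 if there is none. *)
Definition wderiv (s : seq 'I_n) u : 'rV[R]_n -> R :=
  xget (cst 0) [set w | is_weak_deriv s u w].

Definition sobolev m u := L2 u /\
  forall s : seq 'I_n, (size s <= m)%N -> exists w, is_weak_deriv s u w.

(* Mixed derivatives are counted with multiplicity, which gives a norm
   equivalent to the one indexed by multi-indices. *)
Definition sobolev_norm m u : R :=
  Num.sqrt (\sum_(j < m.+1) \sum_(s : j.-tuple 'I_n)
              \int[mu]_(x in Om) (wderiv s u x ^+ 2)).

Definition sobolev0 m u := sobolev m u /\
  forall e : R, 0 < e -> exists2 phi, test_function phi &
    sobolev_norm m (fun x => u x - phi x) < e.

Definition wlaplacian u : 'rV[R]_n -> R :=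
  fun x => \sum_(i < n) wderiv [:: i; i] u x.

Definition inner m u w : R :=
  let k := m./2 in
  let Du := iter k wlaplacian u in
  let Dw := iter k wlaplacian w in
  if odd m then
    \int[mu]_(x in Om) (\sum_(i < n) wderiv [:: i] Du x * wderiv [:: i] Dw x)
  else \int[mu]_(x in Om) (Du x * Dw x).

Definition hnorm m u : R := Num.sqrt (inner m u u).

Definition vcomp v (i : 'I_n) : 'rV[R]_n -> R := fun x => v x 0 i.

Definition vsobolev0 m v := forall i, sobolev0 m (vcomp v i).

Definition vnorm m v : R :=
  Num.sqrt (\sum_(i < n) inner m (vcomp v i) (vcomp v i)).

Definition wdiv v : 'rV[R]_n -> R :=
  fun x => \sum_(i < n) wderiv [:: i] (vcomp v i) x.

Definition zero_mean f := \int[mu]_(x in Om) f x = 0.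

Definition X_ m f := sobolev0 m f /\ zero_mean f.

(* Valued in \bar R: the infimum is +oo when f is not a divergence, and
   finiteness is not built into the definition. *)
Definition bogovskii_constant m : \bar R :=
  ereal_sup [set
    ereal_inf [set (vnorm m.+1 v ^+ 2)%:E | v in
                [set v | vsobolev0 m.+1 v /\ ae_eq_on (wdiv v) f]]
  | f in [set f | X_ m f /\ hnorm m f = 1]].

Definition dual_norm m (L : ('rV[R]_n -> 'rV[R]_n) -> R) : \bar R :=
  ereal_sup [set (`|L v| / vnorm m v)%:E | v in
    [set v | vsobolev0 m v /\ ~ {ae mu, forall x, Om x -> v x = 0}]].

(* The functional grad((-Delta)^m f) on H^(m+1)_0(Om, R^n). *)
Definition grad_polylaplacian m f : ('rV[R]_n -> 'rV[R]_n) -> R :=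
  fun v => - inner m f (wdiv v).

End sobolev.

(* Main.v *)
From HB Require Import structures.
Require Import Defs.
From mathcomp Require Import all_boot all_order all_algebra.
From mathcomp Require Import all_classical all_reals all_analysis.
From mathcomp Require Import measurable_realfun.
From mathcomp Require Import ring lra.

Set Implicit Arguments.
Unset Strict Implicit.
Unset Printing Implicit Defensive.

Import Order.TTheory GRing.Theory Num.Theory.
Import numFieldNormedType.Exports.

Local Open Scope classical_set_scope.
Local Open Scope ring_scope.

(** Let [a] be the scalar product of H^(m+1)_0 (vector fields), [b] that of
    X_m, and B h v = (h, div v)_m.  The left-hand side of the formula measures
    how cheaply the equation B h v = b h f (for all h) can be solved for v; the
    right-hand side is the inf-sup constant of B.  The formula is the duality
    between the two, proved for abstract forms in [inf_sup_duality].

    One inequality is Cauchy-Schwarz: if div v = f, then b f f = B f v is at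
    most the dual norm of B f times the norm of v.

    For the other, let the supremum on the right be a real number K, and let
    T h be the Riesz representative of B h for [a].  The norm of T h is the dual
    norm of B h, so b h h <= K * a (T h) (T h) for every h in X_m.  Hence
    h |-> b h f is bounded for the form a (T g) (T h).  A minimising sequence g
    for that functional makes T (g k) a Cauchy sequence in H^(m+1)_0, and its
    limit v satisfies B h v = b h f for all h, with a v v <= K * b f f
    ([dual_solvable]).  Thus div v - f, an element of X_m, is orthogonal to X_m,
    hence to itself, and div v = f.  Solvability of the divergence equation
    comes out of the argument when K is finite; when K is infinite the
    inequality is trivial.

    The analytic input is threefold: H^(m+1)_0 is complete for [a]
    ([complete_vinner]), [b] vanishes only on null functions ([inner_eq0]), and
    the divergence maps H^(m+1)_0 boundedly into X_m ([wdiv_bound],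
    [wdiv_mean0]).  All of it rests on the equivalence on H^m_0 of (u, u)_m and
    the sum of the squared norms of all derivatives of order at most m
    ([hform_le_inner]).  For test functions, two integrations by parts turn the
    squared norm of the Laplacian into the sum of those of all second
    derivatives, and Poincare's inequality controls the lower orders;
    induction and density do the rest.  Completeness then follows from
    Riesz-Fischer, since weak derivatives are stable under L^2 limits.

    The calculus of test functions is derived from one fact: the integral of a
    partial derivative of a compactly supported function vanishes, because the
    integrals of its difference quotients do, by translation invariance of
    Lebesgue measure ([integral_derive0]).  Integration by parts, the symmetry
    of second derivatives and Poincare's inequality all come from it.  Weak
    derivatives are unique by the fundamental lemma ([fundamental_lemma]),
    whose test functions are products of one-dimensional bumps exp(-c/t). *)

(** * Semi-inner products and the duality formula *)

(** A form [a] given on a part [S] of a function space, where almost everywhere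
    equal functions are not identified: hence relative to [S] and without
    definiteness. *)
Record semi_inner (R : realType) (V : lmodType R) (S : set V)
    (a : V -> V -> R) : Prop := SemiInner {
  si_0 : S 0;
  si_comb : forall c u v, S u -> S v -> S (c *: u + v);
  si_lin : forall c u v w, S u -> S v -> S w ->
    a (c *: u + v) w = c * a u w + a v w;
  si_sym : forall u v, S u -> S v -> a u v = a v u;
  si_ge0 : forall u, S u -> 0 <= a u u }.

Definition cauchy_form (R : realType) (V : lmodType R) (a : V -> V -> R)
    (g : nat -> V) :=
  forall e : R, 0 < e -> exists N, forall i j, (N <= i)%N -> (N <= j)%N ->
    a (g i - g j) (g i - g j) < e.

Definition complete_form (R : realType) (V : lmodType R) (S : set V)
    (a : V -> V -> R) :=
  forall g : nat -> V, (forall k, S (g k)) -> cauchy_form a g ->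
  exists2 w, S w & (fun k => a (g k - w) (g k - w)) @ \oo --> 0.

Section semi_inner_theory.
Context (R : realType) (V : lmodType R) (S : set V) (a : V -> V -> R).
Hypothesis Sa : semi_inner S a.
Implicit Types (u v w : V) (c : R).

Lemma si_subB u v : S u -> S v -> S (u - v).
Proof. by move=> Su Sv; rewrite -scaleN1r addrC; apply: (si_comb Sa). Qed.

Lemma si_subZ c u : S u -> S (c *: u).
Proof. by move=> Su; rewrite -[_ *: _]addr0; apply: (si_comb Sa) => //; exact: si_0 Sa. Qed.

Lemma si_linr c u v w : S u -> S v -> S w ->
  a w (c *: u + v) = c * a w u + a w v.
Proof.
move=> Su Sv Sw; rewrite (si_sym Sa)//; last exact: (si_comb Sa).
by rewrite (si_lin Sa)// (si_sym Sa Su)// (si_sym Sa Sv).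
Qed.

Lemma si_Bl u v w : S u -> S v -> S w -> a (u - v) w = a u w - a v w.
Proof.
by move=> Su Sv Sw; rewrite -scaleN1r addrC (si_lin Sa)// mulN1r addrC.
Qed.

Lemma si_Br u v w : S u -> S v -> S w -> a w (u - v) = a w u - a w v.
Proof.
by move=> Su Sv Sw; rewrite -scaleN1r addrC si_linr// mulN1r addrC.
Qed.

Lemma si_0r u : S u -> a u 0 = 0.
Proof.
move=> Su; have S0 := si_0 Sa; have := si_linr 1 S0 S0 Su.
by rewrite scale1r addr0 mul1r; lra.
Qed.

Lemma si_sq_comb c u v : S u -> S v ->
  a (c *: u + v) (c *: u + v) = c ^+ 2 * a u u + 2 * c * a u v + a v v.
Proof.
move=> Su Sv; have Suv := si_comb Sa c Su Sv.
by rewrite (si_lin Sa)// !si_linr// (si_sym Sa Sv Su); ring.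
Qed.

Lemma si_sq_B u v : S u -> S v ->
  a (u - v) (u - v) = a u u - 2 * a u v + a v v.
Proof.
by move=> Su Sv; rewrite si_Br ?si_Bl//; [rewrite (si_sym Sa Sv Su); ring|exact: si_subB].
Qed.

Lemma si_sq_BC u v : S u -> S v -> a (u - v) (u - v) = a (v - u) (v - u).
Proof. by move=> Su Sv; rewrite !si_sq_B// (si_sym Sa Sv Su); ring. Qed.

End semi_inner_theory.

(** Behind the Cauchy-Schwarz inequality, and also the convergence rate in
    [riesz_sequence]. *)
Lemma quadratic_ge0_disc (R : realType) (p q r : R) :
  (forall t, 0 <= p * t ^+ 2 + 2 * q * t + r) -> q ^+ 2 <= p * r.
Proof.
move=> h; pose P : {poly R} := Poly [:: r; 2 * q; p].
have P0 x : 0 <= P.[x].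
  by apply: le_trans (h x) _; rewrite horner_Poly /= le_eqVlt; apply/orP; left; apply/eqP; ring.
have := deg_le2_poly_ge0 (size_Poly _ : (size P <= 3)%N) P0.
by rewrite !coef_Poly /=; lra.
Qed.

Section cauchy_schwarz.
Context (R : realType) (V : lmodType R) (S : set V) (a : V -> V -> R).
Hypothesis Sa : semi_inner S a.
Implicit Types (u v w : V) (c : R).

Lemma si_cauchy_schwarz u v : S u -> S v -> a u v ^+ 2 <= a u u * a v v.
Proof.
move=> Su Sv; apply: quadratic_ge0_disc => t.
have := si_ge0 Sa (si_comb Sa t Su Sv).
by rewrite (si_sq_comb Sa)// [_ * a u u]mulrC -!mulrA [t * _]mulrC.
Qed.

Lemma si_norm_cs u v : S u -> S v ->
  `|a u v| <= Num.sqrt (a u u) * Num.sqrt (a v v).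
Proof.
move=> Su Sv; rewrite -sqrtrM ?(si_ge0 Sa)// -sqrtr_sqr ler_wsqrtr//.
exact: si_cauchy_schwarz.
Qed.

Lemma si_sqrtD u v : S u -> S v ->
  Num.sqrt (a (u + v) (u + v)) <= Num.sqrt (a u u) + Num.sqrt (a v v).
Proof.
move=> Su Sv; rewrite -[leRHS]ger0_norm ?addr_ge0 ?sqrtr_ge0//.
rewrite -sqrtr_sqr ler_wsqrtr// sqrrD !sqr_sqrtr ?(si_ge0 Sa)//.
have := si_sq_comb Sa 1 Su Sv; rewrite scale1r => ->.
have := le_trans (ler_norm _) (si_norm_cs Su Sv).
by rewrite -mulr_natr; nra.
Qed.

Lemma si_cvgr (g : nat -> V) w v : (forall k, S (g k)) -> S w -> S v ->
  (fun k => a (g k - w) (g k - w)) @ \oo --> 0 ->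
  (fun k => a (g k) v) @ \oo --> a w v.
Proof.
move=> Sg Sw Sv gw; apply/subr_cvg0.
have h : (fun k => Num.sqrt (a (g k - w) (g k - w)) * Num.sqrt (a v v)) @ \oo --> 0.
  rewrite -(mul0r (Num.sqrt (a v v))); apply: cvgMl.
  rewrite -[X in _ --> X]sqrtr0; apply: (continuous_cvg _ _ gw).
  exact: sqrt_continuous.
apply/norm_cvg0P; apply: (@squeeze_cvgr _ _ _ _ (fun=> 0)) h; last exact: cvg_cst.
apply: nearW => k; rewrite normr_ge0/= -(si_Bl Sa)//.
by apply: si_norm_cs => //; exact: (si_subB Sa).
Qed.

Lemma si_cvg_sq (g : nat -> V) w : (forall k, S (g k)) -> S w ->
  (fun k => a (g k - w) (g k - w)) @ \oo --> 0 ->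
  (fun k => a (g k) (g k)) @ \oo --> a w w.
Proof.
move=> Sg Sw gw; have h := si_cvgr Sg Sw Sw gw.
have h2 := cvgD gw (cvgB (cvgM (cvg_cst (2 : R)) h) (cvg_cst (a w w))).
rewrite (_ : a w w = 0 + (2 * a w w - a w w)); last by ring.
rewrite (_ : (fun k => a (g k) (g k)) =
   (fun k => a (g k - w) (g k - w) + (2 * a (g k) w - a w w))); last first.
  by apply/funext => k; rewrite (si_sq_B Sa)//; ring.
exact: h2.
Qed.

(** A minimising sequence of J u = a u u - 2 l u.  The parallelogram identity
    makes it Cauchy, and inf J <= J (t v + g k) for all t bounds
    (a (g k) v - l v)^2 by a discriminant.  There is no limit in the
    conclusion because [dual_solvable] needs it for a form whose domain is not
    complete. *)
Lemma riesz_sequence (l : V -> R) K :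
  (forall c u v, S u -> S v -> l (c *: u + v) = c * l u + l v) ->
  (forall u, S u -> l u ^+ 2 <= K * a u u) -> 0 <= K ->
  exists g : nat -> V, [/\ forall k, S (g k), cauchy_form a g &
     forall v, S v -> (fun k => a (g k) v) @ \oo --> l v].
Proof.
move=> llin lK K0.
pose J u := a u u - 2 * l u.
have JK u : S u -> - K <= J u.
  move=> Su; rewrite /J.
  have l0 := lK _ Su; have a0 := si_ge0 Sa Su.
  have h : (2 * l u) ^+ 2 <= (a u u + K) ^+ 2 by have := sqr_ge0 (a u u - K); nra.
  have /(le_trans (ler_norm _)) : `|2 * l u| <= a u u + K.
    by rewrite -(@ger0_norm _ (a u u + K)) ?addr_ge0// -ler_sqr ?nnegrE// !real_normK ?num_real.
  lra.
pose I := inf [set J u | u in S].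
have hI : has_inf [set J u | u in S].
  split; first by exists (J 0); exists 0 => //; exact: si_0 Sa.
  by exists (- K) => _ [u Su <-]; exact: JK.
have IJ u : S u -> I <= J u by move=> Su; apply: ge_inf; [exact: hI.2|exists u].
have /choice[g gP] : forall k, exists u, S u /\ J u < I + k.+1%:R^-1.
  move=> k; have k0 : (0 : R) < k.+1%:R^-1 by rewrite invr_gt0.
  have [_ [u Su <-] uI] := inf_adherent k0 hI.
  by exists u.
have Sg k : S (g k) by case: (gP k).
have Jg k : J (g k) < I + k.+1%:R^-1 by case: (gP k).
exists g; split => //.
- move=> e e0.
  have [N NP] : exists N, N.+1%:R^-1 < e / 4 :> R.
    have e4 : 0 < e / 4 by lra.
    have [N _ h] := near_infty_natSinv_lt (PosNum e4).
    by exists N; exact: (h N (leqnn N)).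
  exists N => i j Ni Nj.
  have le k : (N <= k)%N -> k.+1%:R^-1 <= N.+1%:R^-1 :> R.
    by move=> Nk; rewrite lef_pV2 ?posrE// ler_nat.
  (* The midpoint of g i and g j is no better than the infimum. *)
  have h := IJ _ (si_subZ Sa 2^-1 (si_comb Sa 1 (Sg i) (Sg j))).
  have lZ c u : S u -> l (c *: u) = c * l u.
    move=> Su; have l0 : l 0 = 0.
      by have := llin 1 0 0 (si_0 Sa) (si_0 Sa); rewrite scale1r addr0; lra.
    by rewrite -[c *: u]addr0 llin ?l0 ?addr0//; exact: si_0 Sa.
  have aZ c u : S u -> a (c *: u) (c *: u) = c ^+ 2 * a u u.
    move=> Su; rewrite -[c *: u]addr0 (si_sq_comb Sa)//; last exact: si_0 Sa.
    by rewrite !(si_0r Sa)//; [ring|exact: si_0 Sa].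
  have Sij := si_comb Sa 1 (Sg i) (Sg j).
  rewrite /J aZ// lZ// llin// (si_sq_comb Sa)// in h.
  rewrite (si_sq_B Sa)//.
  have := Jg i; have := Jg j; rewrite /J => hj hi.
  have := le _ Ni; have := le _ Nj => h1 h2.
  have {}h : 4 * I <= a (g i) (g i) + 2 * a (g i) (g j) + a (g j) (g j)
      - 4 * l (g i) - 4 * l (g j).
    have e2 : 2 * 2^-1 = 1 :> R by field.
    rewrite [2 * (2^-1 * _)]mulrA e2 in h.
    have : 2^-1 ^+ 2 = 4^-1 :> R by field.
    move=> e3; rewrite e3 in h; lra.
  move: (N.+1%:R^-1) (i.+1%:R^-1) (j.+1%:R^-1) NP h1 h2 hi hj h => x y z.
  move: (a _ _) (a _ _) (a _ _) (l _) (l _) => a1 a2 a3 l1 l2.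
  lra.
- move=> v Sv; apply/subr_cvg0.
  have key k : (a (g k) v - l v) ^+ 2 <= a v v * k.+1%:R^-1.
    apply: quadratic_ge0_disc => t.
    have := IJ _ (si_comb Sa t Sv (Sg k)).
    rewrite /J llin// (si_sq_comb Sa)// (si_sym Sa Sv (Sg k)).
    have := Jg k; rewrite /J; move: (k.+1%:R^-1) => z; nra.
  apply/norm_cvg0P.
  have h : (fun k => Num.sqrt (a v v * k.+1%:R^-1)) @ \oo --> 0.
    rewrite -[X in _ --> X]sqrtr0.
    apply: continuous_cvg; first exact: sqrt_continuous.
    rewrite -(mulr0 (a v v)); exact: (cvgM (cvg_cst _) cvg_harmonic).
  apply: (@squeeze_cvgr _ _ _ _ (fun=> 0)) h; last exact: cvg_cst.
  apply: nearW => k; rewrite normr_ge0/= -sqrtr_sqr ler_wsqrtr//.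
Qed.

End cauchy_schwarz.

Section semi_inner_sums.
Context (R : realType) (V : lmodType R) (S : set V).

Lemma semi_inner_sum (I : Type) (r : seq I) (a : I -> V -> V -> R) :
  S 0 -> (forall c u v, S u -> S v -> S (c *: u + v)) ->
  (forall i, semi_inner S (a i)) ->
  semi_inner S (fun u w => \sum_(i <- r) a i u w).
Proof.
move=> S0 Sc Sa; split => //.
- move=> c u v w Su Sv Sw; rewrite mulr_sumr -big_split; apply: eq_bigr => i _.
  exact: (si_lin (Sa i)).
- by move=> u v Su Sv; apply: eq_bigr => i _; exact: (si_sym (Sa i)).
- by move=> u Su; apply: sumr_ge0 => i _; exact: (si_ge0 (Sa i)).
Qed.

Lemma si_sum_bound (a : V -> V -> R) (I : Type) (r : seq I) (F : I -> V) M :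
  semi_inner S a -> 0 <= M ->
  (forall i, S (F i)) -> (forall i, a (F i) (F i) <= M) ->
  a (\sum_(i <- r) F i) (\sum_(i <- r) F i) <= (size r)%:R ^+ 2 * M.
Proof.
move=> Sa M0 SF aM.
have SS : forall r, S (\sum_(i <- r) F i).
  move=> r'; elim/big_ind : _ => //; first exact: si_0 Sa.
  by move=> u v Su Sv; rewrite -[u]scale1r; exact: (si_comb Sa).
have h : Num.sqrt (a (\sum_(i <- r) F i) (\sum_(i <- r) F i)) <= (size r)%:R * Num.sqrt M.
  elim: r => [|i r IH].
    by rewrite !big_nil (si_0r Sa (si_0 Sa)) sqrtr0 mul0r.
  rewrite big_cons; apply: le_trans (si_sqrtD Sa (SF i) (SS r)) _.
  rewrite /= -add1n natrD mulrDl mul1r lerD//.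
  by rewrite ler_wsqrtr.
have p := si_ge0 Sa (SS r).
rewrite -(sqr_sqrtr p) -[X in _ <= _ * X](sqr_sqrtr M0) -exprMn.
by rewrite lerXn2r ?nnegrE ?mulr_ge0 ?sqrtr_ge0.
Qed.

Lemma si_sqrtZ (a : V -> V -> R) c u : semi_inner S a -> S u ->
  Num.sqrt (a (c *: u) (c *: u)) = `|c| * Num.sqrt (a u u).
Proof.
move=> Sa Su; have S0 := si_0 Sa.
have := si_sq_comb Sa c Su S0; rewrite addr0 => ->.
by rewrite !(si_0r Sa)// mulr0 !addr0 sqrtrM ?sqr_ge0// sqrtr_sqr.
Qed.

Lemma si_sqrtB (a : V -> V -> R) u v : semi_inner S a -> S u -> S v ->
  Num.sqrt (a u u) <= Num.sqrt (a (u - v) (u - v)) + Num.sqrt (a v v).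
Proof.
move=> Sa Su Sv; have := si_sqrtD Sa (si_subB Sa Su Sv) Sv.
by rewrite subrK.
Qed.

End semi_inner_sums.

Lemma semi_innerS (R : realType) (V : lmodType R) (S S' : set V) (a : V -> V -> R) :
  semi_inner S a -> S' `<=` S -> S' 0 ->
  (forall c u v, S' u -> S' v -> S' (c *: u + v)) -> semi_inner S' a.
Proof.
move=> Sa S'S S'0 S'c; split => //.
- by move=> c u v w /S'S Su /S'S Sv /S'S Sw; exact: (si_lin Sa).
- by move=> u v /S'S Su /S'S Sv; exact: (si_sym Sa).
- by move=> u /S'S Su; exact: (si_ge0 Sa).
Qed.

Lemma si_sqrt_comb_lt (R : realType) (V : lmodType R) (S : set V) (a : V -> V -> R)
    (c e : R) u v : semi_inner S a -> S u -> S v ->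
  Num.sqrt (a u u) < e / (2 * (`|c| + 1)) -> Num.sqrt (a v v) < e / 2 ->
  Num.sqrt (a (c *: u + v) (c *: u + v)) < e.
Proof.
move=> Sa Su Sv h1 h2.
apply: le_lt_trans (si_sqrtD Sa (si_subZ Sa c Su) Sv) _.
rewrite (si_sqrtZ c Sa Su).
move: (Num.sqrt (a u u)) (Num.sqrt (a v v)) (sqrtr_ge0 (a u u)) h1 h2 => x y x0 h1 h2.
have c0 := normr_ge0 c; have c1 : 0 < 2 * (`|c| + 1) by lra.
rewrite ltr_pdivlMr// in h1.
nra.
Qed.

Section riesz.
Context (R : realType) (V : lmodType R) (S : set V) (a : V -> V -> R).
Hypothesis Sa : semi_inner S a.
Hypothesis Ca : complete_form S a.

Lemma riesz (l : V -> R) K :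
  (forall c u v, S u -> S v -> l (c *: u + v) = c * l u + l v) ->
  (forall u, S u -> l u ^+ 2 <= K * a u u) -> 0 <= K ->
  exists2 w, S w & forall v, S v -> a w v = l v.
Proof.
move=> llin lK K0; have [g [Sg cg gl]] := riesz_sequence Sa llin lK K0.
have [w Sw gw] := Ca Sg cg; exists w => // v Sv.
exact: cvg_unique (si_cvgr Sa Sg Sw Sv gw) (gl _ Sv).
Qed.

End riesz.

Section inf_sup_duality.
Context (R : realType) (V W : lmodType R) (S : set V) (a : V -> V -> R)
  (X : set W) (b : W -> W -> R) (B : W -> V -> R).
Hypothesis Sa : semi_inner S a.
Hypothesis Ca : complete_form S a.
Hypothesis Xb : semi_inner X b.
Hypothesis Bl : forall c g h v, X g -> X h -> S v ->
  B (c *: g + h) v = c * B g v + B h v.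
Hypothesis Br : forall c u v h, S u -> S v -> X h ->
  B h (c *: u + v) = c * B h u + B h v.
Hypothesis BM : forall h, X h ->
  exists2 M, 0 <= M & forall v, S v -> B h v ^+ 2 <= M * a v v.

(** With T h the Riesz representative of B h, the hypothesis on [K] says that
    b h h <= K * a (T h) (T h); so b . f is bounded for the form
    b' g h = a (T g) (T h).  The images under T of a [riesz_sequence] for b'
    converge in the complete space S, and their limit is the solution. *)
Lemma dual_solvable K f : 0 <= K -> X f ->
  (forall h c, X h -> 0 <= c ->
    (forall v, S v -> B h v ^+ 2 <= c * a v v) -> b h h <= K * c) ->
  exists2 v, S v & (forall h, X h -> B h v = b h f) /\ a v v <= K * b f f.
Proof.
move=> K0 Xf hK.
have /choice[T TP] : forall h, exists w,
    X h -> S w /\ forall v, S v -> a w v = B h v.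
  move=> h; have [Xh|nXh] := pselect (X h); last by exists 0 => /nXh.
  have [M M0 hM] := BM Xh.
  have [w Sw wP] := riesz Sa Ca (fun c u v Su Sv => Br c Su Sv Xh) hM M0.
  by exists w.
have ST h : X h -> S (T h) by case/TP.
have aT h v : X h -> S v -> a (T h) v = B h v by move=> /TP[_]; apply.
pose b' g h := a (T g) (T h).
have Xb' : semi_inner X b'.
  split; [exact: si_0 Xb|exact: si_comb Xb| | |].
  - move=> c u v w Xu Xv Xw; rewrite /b' !aT ?Bl//; try exact: ST.
    exact: si_comb Xb _ _ _ _ _.
  - by move=> u v Xu Xv; rewrite /b' (si_sym Sa)//; exact: ST.
  - by move=> u Xu; apply: (si_ge0 Sa); exact: ST.
have bK h : X h -> b h h <= K * b' h h.
  move=> Xh; apply: hK => //; first exact: (si_ge0 Xb').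
  by move=> v Sv; rewrite -aT//; apply: (si_cauchy_schwarz Sa) => //; exact: ST.
have b0 := si_ge0 Xb Xf.
have lK h : X h -> b h f ^+ 2 <= K * b f f * b' h h.
  move=> Xh; apply: (le_trans (si_cauchy_schwarz Xb Xh Xf)).
  by rewrite mulrAC ler_wpM2r// bK.
have [g [Xg cg gl]] := riesz_sequence Xb' (l := fun h => b h f)
  (fun c u v Xu Xv => si_lin Xb c Xu Xv Xf) lK (mulr_ge0 K0 b0).
have STg k : S (T (g k)) by apply: ST.
have cTg : cauchy_form a (T \o g).
  move=> e e0; have [N NP] := cg _ e0; exists N => i j Ni Nj /=.
  have := NP i j Ni Nj; rewrite (si_sq_B Xb')// (si_sq_B Sa)//.
have [v Sv vP] := Ca STg cTg.
have Bv h : X h -> B h v = b h f.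
  move=> Xh; rewrite -aT// (si_sym Sa)//; last exact: ST.
  by apply: cvg_unique (si_cvgr Sa STg Sv (ST _ Xh) vP) (gl _ Xh).
exists v => //; split => //.
have h1 := si_cvgr Sa STg Sv Sv vP.
have h2 := si_cvg_sq Sa STg Sv vP.
have h3 : (fun k => a (T (g k)) v ^+ 2) @ \oo --> a v v ^+ 2 by apply: cvgM.
have h4 : (fun k => K * b f f * a (T (g k)) (T (g k))) @ \oo --> K * b f f * a v v.
  exact: (cvgM (cvg_cst _) h2).
have : a v v ^+ 2 <= K * b f f * a v v.
  apply: ler_cvg_to h3 h4 _; apply: nearW => k.
  by rewrite aT// Bv//; exact: lK.
have := si_ge0 Sa Sv; rewrite le_eqVlt => /predU1P[<- _|av].
  by rewrite mulr_ge0.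
by rewrite expr2 ler_pM2r.
Qed.

(** To be read as: [v] has divergence [f] almost everywhere, [v] is not a null
    field, [f] is not a null function. *)
Variables (E : V -> W -> Prop) (N : set V) (M : set W).
Hypothesis EP : forall v f, S v -> X f ->
  E v f <-> forall h, X h -> B h v = b h f.
Hypothesis NP : forall v, S v -> N v <-> a v v != 0.
Hypothesis MP : forall f, X f -> M f <-> b f f != 0.
Hypothesis SN : exists2 v, S v & N v.

Let dual f : \bar R :=
  ereal_sup [set (`|B f v| / Num.sqrt (a v v))%:E | v in [set v | S v /\ N v]].
Let ratio f : \bar R := ((Num.sqrt (b f f) ^+ 2)%:E / dual f ^+ 2)%E.
Let cost f : \bar R := ereal_inf [set (Num.sqrt (a v v) ^+ 2)%:E | v in
  [set v | S v /\ E v f]].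

Let a_gt0 v : S v -> N v -> 0 < a v v.
Proof. by move=> Sv /(NP Sv) av; rewrite lt0r av (si_ge0 Sa). Qed.

Let dual_ge0 f : (0 <= dual f)%E.
Proof.
have [v Sv Nv] := SN; apply: le_trans (ereal_sup_ubound _); last by exists v.
by rewrite lee_fin divr_ge0// sqrtr_ge0.
Qed.

Let ratio_fin f d : 0 < d -> dual f = d%:E -> ratio f = (Num.sqrt (b f f) ^+ 2 / d ^+ 2)%:E.
Proof.
move=> d0 fd; rewrite /ratio fd -EFin_expe inver gt_eqF ?exprn_gt0//.
Qed.

Let ratio_pinfty f : dual f = +oo%E -> ratio f = 0%E.
Proof. by move=> fd; rewrite /ratio fd expe2 mulyy invey mule0. Qed.

Let ratio_ge0 f : (0 <= ratio f)%E.
Proof. by rewrite /ratio mule_ge0 ?inve_ge0 ?expe_ge0 // lee_fin sqr_ge0. Qed.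

(** If v solves the equation for f / |f|, then B f v = |f|, so the dual norm of
    B f is at least |f| / |v|. *)
Lemma ratio_le_cost f v : X f -> 0 < b f f -> S v ->
  E v ((Num.sqrt (b f f))^-1 *: f) -> (ratio f <= (Num.sqrt (a v v) ^+ 2)%:E)%E.
Proof.
move=> Xf f0 Sv; have nf0 : 0 < Num.sqrt (b f f) by rewrite sqrtr_gt0.
have Xg := si_subZ Xb (Num.sqrt (b f f))^-1 Xf.
move=> /(EP Sv Xg)/(_ f Xf); have X0 := si_0 Xb.
have -> : b f ((Num.sqrt (b f f))^-1 *: f) = Num.sqrt (b f f).
  have := si_linr Xb (Num.sqrt (b f f))^-1 Xf X0 Xf.
  rewrite addr0 (si_0r Xb Xf) => ->; rewrite addr0 -{2}(sqr_sqrtr (ltW f0)).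
  by rewrite expr2 mulrA mulVf ?mul1r// gt_eqF.
move=> Bfv; have av0 : a v v != 0.
  apply/eqP => av; have [K _ /(_ v Sv)] := BM Xf.
  by rewrite av mulr0 Bfv leNgt exprn_gt0.
have av : 0 < a v v by rewrite lt0r av0 (si_ge0 Sa).
have h : ((Num.sqrt (b f f) / Num.sqrt (a v v))%:E <= dual f)%E.
  apply: ereal_sup_ubound; exists v; first by split => //; apply/NP.
  by rewrite Bfv ger0_norm// ltW.
have sv0 : 0 < Num.sqrt (a v v) by rewrite sqrtr_gt0.
case fd : (dual f) h => [d| |] h; last 2 first.
- by rewrite ratio_pinfty// lee_fin sqr_ge0.
- by [].
move: h; rewrite lee_fin ler_pdivrMr// => h.
have d0 : 0 < d by rewrite -(pmulr_lgt0 _ sv0) (lt_le_trans nf0).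
rewrite (ratio_fin d0 fd) lee_fin ler_pdivrMr ?exprn_gt0// -exprMn.
rewrite lerXn2r ?nnegrE ?sqrtr_ge0 // ; first by rewrite mulr_ge0 ?sqrtr_ge0 ?ltW.
by rewrite mulrC.
Qed.

(** The bound on B h says that its dual norm is at most the square root of c.
    Were the dual norm 0, the ratio of h would be +oo, as 0^-1 = +oo in the
    extended reals. *)
Lemma ratio_bound K h c : X h -> M h -> (ratio h <= K%:E)%E -> 0 <= K -> 0 <= c ->
  (forall v, S v -> B h v ^+ 2 <= c * a v v) -> b h h <= K * c.
Proof.
move=> Xh Mh rK K0 c0 hB; have h0 : 0 < b h h.
  by rewrite lt0r (MP Xh).1// (si_ge0 Xb).
have dc : (dual h <= (Num.sqrt c)%:E)%E.
  apply: ge_ereal_sup => _ [v [Sv Nv] <-]; have av := a_gt0 Sv Nv.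
  rewrite lee_fin ler_pdivrMr ?sqrtr_gt0// -sqrtrM// -sqrtr_sqr ler_wsqrtr//.
  exact: hB.
have := dual_ge0 h; case hd : (dual h) dc => [d| |]// dc d0.
rewrite !lee_fin in dc d0.
have nh0 : 0 < Num.sqrt (b h h) ^+ 2 by rewrite exprn_gt0// sqrtr_gt0.
move: d0; rewrite le0r => /predU1P[d0|d0].
  move: rK; rewrite /ratio hd d0 -EFin_expe expr0n/= inve0 gt0_muley//.
move: rK; rewrite (ratio_fin d0 hd) lee_fin ler_pdivrMr ?exprn_gt0//.
rewrite (sqr_sqrtr (ltW h0)) => /le_trans; apply; rewrite ler_wpM2l//.
by rewrite -[leRHS]sqr_sqrtr// lerXn2r ?nnegrE ?sqrtr_ge0 ?(ltW d0).
Qed.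

Theorem inf_sup_duality :
  ereal_sup [set cost f | f in [set f | X f /\ Num.sqrt (b f f) = 1]] =
  ereal_sup [set ratio f | f in [set f | X f /\ M f]].
Proof.
apply/eqP; rewrite eq_le; apply/andP; split; apply: ge_ereal_sup.
- move=> _ [f [Xf f1] <-].
  have bf : b f f = 1 by rewrite -(sqr_sqrtr (si_ge0 Xb Xf)) f1 expr1n.
  have ub h : X h -> M h ->
      (ratio h <= ereal_sup [set ratio f | f in [set f | X f /\ M f]])%E.
    by move=> Xh Mh; apply: ereal_sup_ubound; exists h.
  have Mf : M f by apply/(MP Xf); rewrite bf oner_eq0.
  case supE : ereal_sup => [K| |]; last 2 first.
  + exact: leey.
  + by have := le_trans (ratio_ge0 f) (ub f Xf Mf); rewrite supE.
  rewrite supE in ub.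
  have K0 : 0 <= K by rewrite -lee_fin (le_trans (ratio_ge0 f))// ub.
  have [h c Xh c0 hB|v Sv [hv avK]] := dual_solvable K0 Xf.
    have [h0|h0] := eqVneq (b h h) 0; first by rewrite h0 mulr_ge0.
    have Mh := (MP Xh).2 h0; exact: ratio_bound Mh (ub h Xh Mh) K0 c0 hB.
  apply: le_trans (ereal_inf_lbound _) _.
    by exists v => //; split => //; apply/EP.
  by rewrite lee_fin sqr_sqrtr ?(si_ge0 Sa)// -[K]mulr1 -bf.
- move=> _ [f [Xf Mf] <-]; have f0 : 0 < b f f.
    by rewrite lt0r (MP Xf).1// (si_ge0 Xb).
  pose g := (Num.sqrt (b f f))^-1 *: f.
  have Xg : X g by exact: (si_subZ Xb).
  have g1 : Num.sqrt (b g g) = 1.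
    have := si_sq_comb Xb (Num.sqrt (b f f))^-1 Xf (si_0 Xb).
    rewrite addr0 -/g => ->; rewrite !(si_0r Xb) ?mulr0 ?addr0//; last exact: si_0 Xb.
    by rewrite exprVn sqr_sqrtr ?ltW// mulVf ?sqrtr1// gt_eqF.
  apply: (@le_trans _ _ (cost g)); last by apply: ereal_sup_ubound; exists g.
  by apply: le_ereal_inf_tmp => _ [v [Sv vg] <-]; exact: ratio_le_cost.
Qed.

End inf_sup_duality.

(** * Square-integrable functions *)

Lemma limn_einf_le_ub (R : realType) (u : (\bar R)^nat) (e : \bar R) :
  (forall n, (u n <= e)%E) -> (limn_einf u <= e)%E.
Proof.
move=> ue; rewrite limn_einf_lim (cvg_lim _ (@cvg_einfs_sup _ u))//.
apply: ge_ereal_sup => _ [n _ <-]; apply: le_trans (ue n).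
by apply: ereal_inf_lbound; exists n => /=.
Qed.

Section square_integrable.
Context d (T : measurableType d) (R : realType)
  (mu : {measure set T -> \bar R}) (D : set T).
Hypothesis mD : measurable D.
Implicit Types u v w : T -> R.

Definition square_integrable u :=
  measurable_fun D u /\ mu.-integrable D (EFin \o (fun x => u x ^+ 2)).

Definition ip u w : R := \int[mu]_(x in D) (u x * w x).

Lemma sqintM u w : square_integrable u -> square_integrable w ->
  mu.-integrable D (EFin \o (fun x => u x * w x)).
Proof.
move=> [mu_ iu] [mw iw]; have iuw := integrableD mD iu iw.
apply: le_integrable iuw => //.
  by apply/measurable_EFinP; exact: measurable_funM.
move=> x Dx /=; rewrite lee_fin normrM.
rewrite [leRHS]ger0_norm ?addr_ge0 ?sqr_ge0//.
have := sqr_ge0 (`|u x| - `|w x|).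
rewrite sqrrB !real_normK ?num_real//.
by have := sqr_ge0 (u x); have := sqr_ge0 (w x); rewrite mulr2n; lra.
Qed.

Lemma sqint_comb c u v : square_integrable u -> square_integrable v ->
  square_integrable (c *: u + v).
Proof.
move=> hu hv; split.
  apply: measurable_funD; last by case: hv.
  by apply: measurable_funM => //; case: hu.
have := integrableD mD (integrableD mD (integrableZl mD (c ^+ 2) hu.2)
  (integrableZl mD (2 * c) (sqintM hu hv))) hv.2.
apply: eq_integrable => // x _ /=.
rewrite -!EFinM -!EFinD; congr EFin.
by rewrite -[(c *: u + v) x]/(c * u x + v x); ring.
Qed.

Lemma sqint0 : square_integrable (0 : T -> R).
Proof.
split; first exact: measurable_cst.
apply: eq_integrable (integrable0 _ _) => // x _ /=.
by rewrite -[(0 : T -> R) x]/(0 : R) expr0n.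
Qed.

Lemma ip_ge0 u : 0 <= ip u u.
Proof. by apply: Rintegral_ge0 => x _; rewrite -expr2 sqr_ge0. Qed.

Lemma ipC u w : ip u w = ip w u.
Proof. by apply: eq_Rintegral => x _; rewrite mulrC. Qed.

Lemma ip_lin c u v w : square_integrable u -> square_integrable v ->
  square_integrable w -> ip (c *: u + v) w = c * ip u w + ip v w.
Proof.
move=> hu hv hw; rewrite /ip -RintegralZl//; last exact: sqintM.
rewrite -RintegralD//; last first.
- exact: sqintM.
- have := integrableZl mD c (sqintM hu hw); apply: eq_integrable => // x _ /=.
by apply: eq_Rintegral => x _; rewrite -[(c *: u + v) x]/(c * u x + v x) mulrDl mulrA.
Qed.

Lemma semi_inner_ip : semi_inner square_integrable ip.
Proof.
split; [exact: sqint0|exact: sqint_comb|exact: ip_lin|by move=> *; exact: ipC|].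
by move=> u _; exact: ip_ge0.
Qed.

Lemma ip_ae u u' w : square_integrable u -> square_integrable u' ->
  square_integrable w ->
  ae_eq mu D u u' -> ip u w = ip u' w.
Proof.
move=> hu hu' hw uu'; congr fine; apply: ae_eq_integral => //.
- by apply: measurable_int (sqintM hu hw).
- by apply: measurable_int (sqintM hu' hw).
- by apply: filterS uu' => x /[apply] ->.
Qed.

Lemma ip_integral u : square_integrable u ->
  (\int[mu]_(x in D) (u x ^+ 2)%:E)%E = (ip u u)%:E.
Proof.
move=> hu; rewrite /ip /Rintegral fineK.
  by apply: eq_integral => x _; rewrite expr2.
exact: (integrable_fin_num mD (sqintM hu hu)).
Qed.

Lemma ip_eq0 u : square_integrable u -> ip u u = 0 -> ae_eq mu D u (cst 0).
Proof.
move=> hu u0; have := ip_integral hu; rewrite u0 => h.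
have [H _] := ae_eq_integral_abs mu mD (measurable_int mu hu.2).
have {H} : ae_eq mu D (EFin \o (fun x => u x ^+ 2)) (cst 0%E).
  apply: H; rewrite -[RHS]h; apply: eq_integral => x _ /=.
  by rewrite ger0_norm// sqr_ge0.
by apply: filterS => x + Dx => /(_ Dx)/= [/eqP]; rewrite sqrf_eq0 => /eqP.
Qed.

(** Riesz-Fischer.  Along a subsequence whose increments h k have squared norm
    less than 8^-k, the series of the (2^k h k)^2 is integrable, as
    4^k 8^-k = 2^-k.  So almost everywhere h k = O(2^-k) and the subsequence
    converges; Fatou's lemma shows that its limit is the limit in mean
    square. *)
Lemma complete_ip : complete_form square_integrable ip.
Proof.
move=> g Sg cg.
have Sip := semi_inner_ip.
have /choice[N0 N0P] : forall k : nat, exists N, forall i j, (N <= i)%N -> (N <= j)%N ->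
    ip (g i - g j) (g i - g j) < 8^-1 ^+ k.
  by move=> k; apply: cg; rewrite exprn_gt0// invr_gt0.
(* The sum makes n_ nondecreasing and at least N0, the term k unbounded. *)
pose n_ k := (k + \sum_(i < k.+1) N0 i)%N.
have kn k : (k <= n_ k)%N by exact: leq_addr.
have nN k : (N0 k <= n_ k)%N by rewrite /n_ big_ord_recr/= addnA leq_addl.
have nS k : (n_ k <= n_ k.+1)%N.
  by rewrite [leqRHS]/n_ big_ord_recr/= addnA (leq_trans _ (leq_addr _ _))// leq_add2r.
pose h k : T -> R := g (n_ k.+1) - g (n_ k).
have Sh k : square_integrable (h k) by exact: (si_subB Sip).
have hk k : ip (h k) (h k) < 8^-1 ^+ k.
  by apply: N0P => //; exact: leq_trans (nS k).
pose F k x : \bar R := ((2 ^+ k * h k x) ^+ 2)%:E.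
have mh k : measurable_fun D (h k) by case: (Sh k).
have mF k : measurable_fun D (F k).
  apply/measurable_EFinP; apply: measurable_funX.
  by apply: measurable_funM => //; exact: measurable_cst.
have F0 k x : D x -> (0 <= F k x)%E by move=> _; rewrite lee_fin sqr_ge0.
have iF k : (\int[mu]_(x in D) F k x <= (geometric 1 2^-1 k)%:E)%E.
  under eq_integral do rewrite /F exprMn EFinM.
  rewrite integralZl//; [|exact: (Sh k).2].
  rewrite ip_integral// -EFinM lee_fin /= mul1r.
  apply: (@le_trans _ _ ((2 ^+ k) ^+ 2 * 8^-1 ^+ k)).
    by rewrite ler_wpM2l ?sqr_ge0// ltW.
  by rewrite -exprM mulnC exprM -exprMn (_ : 2 ^+ 2 * 8^-1 = 2^-1 :> R)//; field.
have IF : mu.-integrable D (fun x => \sum_(0 <= k <oo) F k x)%E.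
  apply/integrableP; split; first by apply: ge0_emeasurable_sum => // k x Dx _; exact: F0.
  rewrite (eq_integral (fun x => \sum_(0 <= k <oo) F k x)%E); last first.
    move=> x /set_mem Dx; rewrite gee0_abs//; apply: nneseries_ge0 => k _ _; exact: F0.
  rewrite integral_nneseries//.
  apply: (@le_lt_trans _ _ (\sum_(0 <= k <oo) (geometric 1 2^-1 k)%:E)%E).
    apply: lee_nneseries => k _; last exact: iF.
    by move=> _; apply: integral_ge0 => x Dx; exact: F0.
  have h12 : `|2^-1 : R| < 1 by rewrite ger0_norm// invf_lt1// ltr1n.
  apply: (@le_lt_trans _ _ (1 * (1 - 2^-1)^-1 : R)%:E); last exact: ltry.
  apply: lime_le.
    by apply: is_cvg_nneseries => k _ _; rewrite lee_fin geometric_ge0// invr_ge0.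
  by apply: nearW => k; rewrite sumEFin lee_fin; exact: geometric_le_lim.
have cvgx : {ae mu, forall x, D x -> cvgn (fun k => g (n_ k) x)}.
  have := integrable_ae mD IF; apply: filterS => x + Dx => /(_ Dx).
  set M := limn _ => Mfin.
  have FM k : (F k x <= M)%E.
    apply: le_trans (nneseries_lim_ge (P := xpredT) k.+1 _); last by move=> *; exact: F0.
    by rewrite big_nat_recr//= leeDr// sume_ge0// => *; exact: F0.
  have M0 : (0 <= M)%E by apply: le_trans (FM 0%N); exact: F0.
  have hM k : `|h k x| <= geometric (Num.sqrt (fine M)) 2^-1 k.
    have := FM k; rewrite -(fineK Mfin) lee_fin => hk2.
    rewrite /= exprVn ler_pdivlMr ?exprn_gt0//.
    rewrite -(@ger0_norm _ (2 ^+ k)) ?exprn_ge0// -normrM mulrC -sqrtr_sqr.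
    by rewrite ler_wsqrtr.
  have h12 : `|2^-1 : R| < 1 by rewrite ger0_norm// invf_lt1// ltr1n.
  have : cvgn (series (telescope (fun k => g (n_ k) x))).
    apply: normed_cvg.
    apply: series_le_cvg (@is_cvg_geometric_series _ (Num.sqrt (fine M)) _ h12).
    - by move=> k /=; rewrite normr_ge0.
    - by move=> k; rewrite geometric_ge0// ?invr_ge0// sqrtr_ge0.
    - exact: hM.
  rewrite telescopeK => c.
  rewrite (_ : (fun k => g (n_ k) x) =
    (fun k => (g (n_ k) x - g (n_ 0%N) x) + g (n_ 0%N) x)).
    by apply: is_cvgD c _; exact: is_cvg_cst.
  by apply/funext => k; rewrite subrK.
pose w x := fine (limn_esup (fun k => (g (n_ k) x)%:E)).
have mg k : measurable_fun D (g k) by case: (Sg k).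
have mw : measurable_fun D w.
  apply: measurableT_comp => //; apply: measurable_fun_limn_esup => k.
  exact/measurable_EFinP.
have gw : {ae mu, forall x, D x -> (fun k => g (n_ k) x) @ \oo --> w x}.
  apply: filterS cvgx => x + Dx => /(_ Dx) /cvg_ex[l cl].
  have /cvg_limn_einf_sup[_] : (fun k => (g (n_ k) x)%:E) @ \oo --> l%:E.
    by apply: cvg_EFin => //; exact: nearW.
  by rewrite /w => ->.
have key j N e : (N <= j)%N ->
    (forall i j, (N <= i)%N -> (N <= j)%N -> ip (g i - g j) (g i - g j) < e) ->
    square_integrable (g j - w) /\ ip (g j - w) (g j - w) <= e.
  move=> Nj hN.
  have mgw : measurable_fun D (g j - w) by exact: measurable_funB.
  have mgw2 : measurable_fun D (EFin \o (fun x => (g j - w) x ^+ 2)).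
    by apply/measurable_EFinP; exact: measurable_funX.
  pose f k x := ((g j - g (n_ (k + N)%N)) x ^+ 2)%:E.
  have mf k : measurable_fun D (f k).
    apply/measurable_EFinP; apply: measurable_funX.
    exact: measurable_funB.
  have f0 k x : D x -> (0 <= f k x)%E by move=> _; rewrite lee_fin sqr_ge0.
  have le_e : (\int[mu]_(x in D) ((g j - w) x ^+ 2)%:E <= e%:E)%E.
    rewrite (ge0_ae_eq_integral (g := fun x => limn_einf (f ^~ x)))//.
    - apply: le_trans (fatou mu mD mf f0) _; apply: limn_einf_le_ub => k.
      rewrite /f ip_integral ?lee_fin; last exact: (si_subB Sip).
      by apply: ltW; apply: hN => //; rewrite (leq_trans _ (kn _))// leq_addl.
    - rewrite /limn_einf; apply: measurableT_comp => //.
      apply: (measurable_fun_limn_esup (f := fun k x => (- f k x)%E)) => k.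
      exact: measurableT_comp.
    - by move=> x _; rewrite lee_fin sqr_ge0.
    - move=> x Dx; rewrite limn_einf_lim (cvg_lim _ (@cvg_einfs_sup _ _))//.
      apply: le_trans (ereal_sup_ubound (x := einfs (f ^~ x) 0%N) _); last by exists 0%N.
      by apply: le_ereal_inf_tmp => _ [k _ <-]; exact: f0.
    - apply: filterS gw => x + Dx => /(_ Dx) gwx.
      suff /cvg_limn_einf_sup[->//] : (f ^~ x) @ \oo --> ((g j - w) x ^+ 2)%:E.
      apply: cvg_EFin; first exact: nearW.
      have c : (fun k => g j x - g (n_ (k + N)%N) x) @ \oo --> g j x - w x.
        apply: cvgB; first exact: cvg_cst.
        exact: (cvg_comp (fun k => (k + N)%N) (fun k => g (n_ k) x) (cvg_addnr N) gwx).
      exact: (cvgM c c).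
  have Sw : square_integrable (g j - w).
    split => //; apply/integrableP; split => //.
    apply: le_lt_trans (ltry e); apply: le_trans le_e.
    by apply: ge0_le_integral => // [|x _ /=]; [exact: measurableT_comp|
       rewrite ger0_norm// sqr_ge0].
  by split => //; rewrite -lee_fin -ip_integral.
have Sw : square_integrable w.
  have [N hN] := cg 1 ltr01.
  have [h1 _] := key N N 1 (leqnn N) hN.
  have := si_subB Sip (Sg N) h1; rewrite opprB addrC subrK//.
exists w => //; apply/cvgrPdist_lt => e e0.
have e2 : 0 < e / 2 by rewrite divr_gt0.
have [N hN] := cg _ e2; exists N => // k /= Nk.
rewrite sub0r normrN ger0_norm ?ip_ge0//.
have [_ h1] := key k N _ Nk hN; apply: le_lt_trans h1 _.
by rewrite ltr_pdivrMr// ltr_pMr// ltr1n.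
Qed.

End square_integrable.

(** * Lebesgue measure on row vectors *)

Section boxes.
Context (R : realType) (n : nat).
Implicit Types (a b x : 'rV[R]_n) (U : set 'rV[R]_n).

Definition open_box a b := [set x : 'rV[R]_n | forall i, a 0 i < x 0 i < b 0 i].
Definition closed_box a b := [set x : 'rV[R]_n | forall i, a 0 i <= x 0 i <= b 0 i].

Lemma open_boxS a b : open_box a b `<=` closed_box a b.
Proof. by move=> x h i; have /andP[/ltW-> /ltW->] := h i. Qed.

Lemma open_boxI a b c d : open_box a b `&` open_box c d =
  open_box (\row_i Num.max (a 0 i) (c 0 i)) (\row_i Num.min (b 0 i) (d 0 i)).
Proof.
apply/seteqP; split => x.
  move=> [h1 h2] i; rewrite !mxE gt_max lt_min; have /andP[-> ->] := h1 i.
  by have /andP[h3 h4] := h2 i; rewrite h3 h4.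
move=> h; split => i; have := h i; rewrite !mxE gt_max lt_min;
  by move=> /andP[/andP[h1 h2] /andP[h3 h4]]; rewrite ?h1 ?h2 ?h3 ?h4.
Qed.

Lemma measurable_open_box a b : measurable (open_box a b).
Proof.
rewrite (_ : open_box a b =
    \bigcap_(i in [set: 'I_n]) ((fun x => x 0 i : measurableTypeR R) @^-1` `]a 0 i, b 0 i[%classic)).
  apply: fin_bigcap_measurable => [|i _].
    exact: finite_finset.
  rewrite -[X in measurable X]setTI; apply: measurable_coor => //.
apply/seteqP; split => x /=.
  by move=> abx i _ /=; rewrite in_itv/=.
by move=> abx i; have := abx i I; rewrite /= in_itv.
Qed.

Definition rat_box (p : 'rV[rat]_n * 'rV[rat]_n) :=
  open_box (map_mx ratr p.1) (map_mx ratr p.2).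

Definition rat_cbox (p : 'rV[rat]_n * 'rV[rat]_n) :=
  closed_box (map_mx ratr p.1) (map_mx ratr p.2).

(** Rational corners, so that an open set is a countable union of such boxes. *)
Lemma open_rat_box U x : open U -> U x ->
  exists2 p, rat_box p x & rat_cbox p `<=` U.
Proof.
move=> oU Ux; have := open_nbhs_nbhs (conj oU Ux).
move=> /nbhs_ballP[e /= e0 xeU].
have /choice[p pP] : forall i, exists p : rat * rat,
    x 0 i - e < ratr p.1 < x 0 i /\ x 0 i < ratr p.2 < x 0 i + e.
  move=> i.
  have [q1] : exists q, ratr q \in `]x 0 i - e, x 0 i[.
    by apply: rat_in_itvoo; rewrite ltrBlDr ltrDl.
  have [q2] : exists q, ratr q \in `]x 0 i, x 0 i + e[.
    by apply: rat_in_itvoo; rewrite ltrDl.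
  by rewrite !in_itv/= => h2 h1; exists (q1, q2).
exists (\row_i (p i).1, \row_i (p i).2) => /=.
  move=> i; rewrite !mxE /=.
  by have [/andP[_ ->] /andP[-> _]] := pP i.
move=> y hy; apply: xeU; split => // i j; rewrite (ord1 i){i}.
have := hy j; rewrite !mxE /= => /andP[h1 h2].
have [/andP[h3 h4] /andP[h5 h6]] := pP j.
rewrite /ball/= distrC ltr_distl.
by rewrite (lt_le_trans h3 h1) (le_lt_trans h2 h6).
Qed.

Lemma open_measurable_rV U : open U -> measurable U.
Proof.
move=> oU; rewrite (_ : U = \bigcup_(p in [set p | rat_box p `<=` U]) rat_box p).
  rewrite bigcup_mkcond; apply: countable_bigcupT_measurable => [|p].
    exact: countableP.
  by case: ifP => _; [exact: measurable_open_box|exact: measurable0].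
apply/seteqP; split => x; last by move=> [p /= pU /pU].
move=> Ux; have [p px pU] := open_rat_box oU Ux; exists p => //=.
exact: subset_trans (@open_boxS _ _) pU.
Qed.

Lemma continuous_measurable_rV (f : 'rV[R]_n -> R) :
  continuous f -> measurable_fun setT f.
Proof.
move=> /continuousP cf; apply: (measurability _ (RGenOpens.measurableE R)).
move=> _ [_ [a [b ->] <-]]; rewrite setTI; apply: open_measurable_rV.
exact/cf/interval_open.
Qed.

Lemma le_coord_norm (x : 'rV[R]_n) i : `|x 0 i| <= `|x|.
Proof.
rewrite [leRHS]/Num.norm/= mx_normrE.
exact: (le_bigmax _ (fun ij => `|x ij.1 ij.2|) (0, i)).
Qed.

Definition boxes := [set A | exists a b, A = open_box a b].

Lemma boxes_setI : setI_closed boxes.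
Proof. by move=> _ _ [a [b ->]] [c [d ->]]; rewrite open_boxI; do 2!eexists. Qed.

(** The preimage of an interval under a coordinate is the union over k of the
    boxes whose other sides are ]-k, k[. *)
Lemma measurable_rVE : @measurable _ 'rV[R]_n = <<s boxes >>.
Proof.
apply/seteqP; split; last first.
  apply: smallest_sub; first exact: sigma_algebra_measurable.
  by move=> _ [a [b ->]]; exact: measurable_open_box.
apply: smallest_sub; first exact: smallest_sigma_algebra.
move=> A; rewrite -bigcup_seq/= => -[i _ [B mB <-]].
have : @measurable_fun _ _ (g_sigma_algebraType boxes) (measurableTypeR R) setT
    (fun x : 'rV[R]_n => x 0 i).
  apply: (measurability _ (RGenOpens.measurableE R)).
  move=> _ [_ [a [b ->] <-]]; rewrite setTI.
  rewrite (_ : _ @^-1` _ = \bigcup_k open_box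
    (\row_j (if j == i then a else - k%:R)) (\row_j (if j == i then b else k%:R))).
    apply: bigcupT_measurable => k; apply: sub_sigma_algebra.
    by eexists; eexists.
  apply/seteqP; split => x /=; rewrite in_itv/=.
    move=> /andP[ax xb]; have [k xk] : exists k : nat, `|x| < k%:R.
      by exists (Num.bound `|x|); exact: archi_boundP.
    exists k => // j; rewrite !mxE; case: eqP => [->|_]; first by rewrite ax xb.
    by rewrite -ltr_norml (le_lt_trans (le_coord_norm _ _) xk).
  by move=> [k _ /(_ i)]; rewrite !mxE eqxx.
by move=> /(_ measurableT B mB).
Qed.

End boxes.

Section translation.
Context (R : realType).

Section line.
Context (c : R).

(** Translations carry a measurable function instance, needed to push a measure
    forward along them. *)
Definition shift1 (x : measurableTypeR R) : measurableTypeR R := x + c.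

Let mshift1 : measurable_fun setT shift1.
Proof.
apply: (@continuous_measurable_fun R (fun x => x + c)) => x.
by apply: continuousD; [exact: cvg_id|exact: cvg_cst].
Qed.

HB.instance Definition _ := isMeasurableFun.Build _ _ _ _ shift1 mshift1.

Lemma lebesgue_measure_shift (A : set (measurableTypeR R)) : measurable A ->
  lebesgue_measure (shift1 @^-1` A) = lebesgue_measure A.
Proof.
move=> mA; apply/esym.
apply: (@lebesgue_measure_unique _ (pushforward lebesgue_measure shift1)) => // _ [[a b]] _ <-.
transitivity (lebesgue_measure `]a - c, b - c]%classic).
  rewrite /= !lebesgue_measure_itv/= !lte_fin ltrD2r.
  by case: ifP => // _; rewrite -!EFinD; congr EFin; ring.
congr (lebesgue_measure _); apply/seteqP; split => x /=;
  by rewrite !in_itv/= /shift1 ltrBlDr lerBrDr.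
Qed.

End line.

Definition shiftV n (v x : 'rV[R]_n) : 'rV[R]_n := x + v.

Lemma measurable_shiftV n (v : 'rV[R]_n) : measurable_fun setT (shiftV v).
Proof.
apply: measurable_fun_coorP => i.
rewrite (_ : (fun x => _) = (shift1 (v 0 i)) \o (fun x : 'rV[R]_n => x 0 i)).
  by apply: measurableT_comp => //; exact: measurable_coor.
by apply/funext => x /=; rewrite mxE.
Qed.

HB.instance Definition _ n (v : 'rV[R]_n) :=
  isMeasurableFun.Build _ _ _ _ (shiftV v) (measurable_shiftV v).

Definition shiftP n (c : R) (v : 'rV[R]_n) (p : measurableTypeR R * 'rV[R]_n) :
  measurableTypeR R * 'rV[R]_n := (shift1 c p.1, shiftV v p.2).

Lemma measurable_shiftP n c (v : 'rV[R]_n) : measurable_fun setT (shiftP c v).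
Proof.
apply/measurable_fun_pairP; split => /=.
  by apply: (measurableT_comp (f := shift1 c)) => //; exact: measurable_fst.
by apply: (measurableT_comp (f := shiftV v)) => //; exact: measurable_snd.
Qed.

HB.instance Definition _ n c (v : 'rV[R]_n) :=
  isMeasurableFun.Build _ _ _ _ (shiftP c v) (measurable_shiftP c v).

(** By induction on the dimension: the translate of the product measure takes
    the value of the product measure on rectangles, and a product measure is
    determined by those. *)
Lemma lebesgue_rV_shift n (v : 'rV[R]_n) (A : set 'rV[R]_n) : measurable A ->
  lebesgue_rV R n (shiftV v @^-1` A) = lebesgue_rV R n A.
Proof.
elim: n v A => [|n IH] v A mA.
  by congr (lebesgue_rV R 0 _); apply/seteqP; split => x /=;
    rewrite /shiftV (_ : v = 0) ?addr0//; apply/rowP => -[].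
rewrite /= /lebesgue_cons /pushforward.
pose w : 'rV[R]_n := \row_j v 0 (lift ord0 j).
rewrite (_ : _ @^-1` _ = shiftP (v 0 ord0) w @^-1` (@rV_cons R n @^-1` A)).
  have mA' : measurable (@rV_cons R n @^-1` A).
    by rewrite -[X in measurable X]setTI; exact: measurable_rV_cons.
  apply/esym; apply: (@product_measure_unique _ _ _ _ _ lebesgue_measure (lebesgue_rV R n)
    (pushforward (lebesgue_measure \x lebesgue_rV R n)%E (shiftP (v 0 ord0) w))) => // B C mB mC.
  transitivity ((lebesgue_measure \x lebesgue_rV R n)%E
    ((shift1 (v 0 ord0) @^-1` B) `*` (shiftV w @^-1` C))) => //.
  rewrite product_measure1E//.
  - by congr (_ * _)%E; [exact: lebesgue_measure_shift|exact: IH].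
  - by rewrite -[X in measurable X]setTI; exact: measurable_funP.
  - by rewrite -[X in measurable X]setTI; exact: measurable_funP.
have E p : shiftV v (rV_cons p) = rV_cons (shiftP (v 0 ord0) w p).
  apply/rowP => i; rewrite [LHS]mxE; case: (unliftP ord0 i) => [j|] ->.
    by rewrite !rV_consS [RHS]mxE [X in _ = _ + X]mxE.
  by rewrite !rV_cons0.
by apply/seteqP; split => p; rewrite /preimage /= E.
Qed.

Lemma integrable_shift n (v : 'rV[R]_n) (f : 'rV[R]_n -> R) :
  (lebesgue_rV R n).-integrable setT (EFin \o f) ->
  (lebesgue_rV R n).-integrable setT (EFin \o (f \o shiftV v)).
Proof.
move=> /integrableP[mf fi]; apply/integrableP; split.
  by apply: (measurableT_comp (f := EFin \o f)).
have := @ge0_integral_pushforward _ _ _ _ _ (shiftV v) (measurable_shiftV v) (lebesgue_rV R n)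
  setT (fun x => `|(f x)%:E|%E) measurableT.
rewrite preimage_setT /= => <-//.
- rewrite (eq_measure_integral (lebesgue_rV R n))// => A mA _.
  exact: lebesgue_rV_shift.
- by apply/measurable_EFinP; apply: measurableT_comp => //; exact/measurable_EFinP.
Qed.

Lemma integral_shift n (v : 'rV[R]_n) (f : 'rV[R]_n -> R) :
  (lebesgue_rV R n).-integrable setT (EFin \o f) ->
  \int[lebesgue_rV R n]_x f (x + v) = \int[lebesgue_rV R n]_x f x.
Proof.
move=> fi; congr fine.
have := @integral_pushforward _ _ _ _ _ (shiftV v) (measurable_shiftV v) (lebesgue_rV R n)
  setT (EFin \o f) (measurable_int _ fi) (integrable_shift v fi) measurableT.
rewrite preimage_setT => <-.
apply: eq_measure_integral => A mA _; exact: lebesgue_rV_shift.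
Qed.

End translation.

Section bounded_sets.
Context (R : realType).

Lemma lebesgue_open_box_lty n (a b : 'rV[R]_n) :
  (lebesgue_rV R n (open_box a b) < +oo)%E.
Proof.
elim: n a b => [|n IH] a b.
  by rewrite /= diracE ltry.
rewrite /= /lebesgue_cons /pushforward.
rewrite (_ : _ @^-1` _ = `]a 0 ord0, b 0 ord0[%classic `*`
   open_box (\row_j a 0 (lift ord0 j)) (\row_j b 0 (lift ord0 j))).
  rewrite product_measure1E//; last exact: measurable_open_box.
  apply: lte_mul_pinfty => //.
    by rewrite ge0_fin_numE//= lebesgue_measure_itv/=; case: ifP => _; rewrite -?EFinD ltry.
apply/seteqP; split => p /=.
  move=> h; split; first by have := h ord0; rewrite rV_cons0 in_itv.
  by move=> j; have := h (lift ord0 j); rewrite rV_consS !mxE.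
move=> [h1 h2] i; case: (unliftP ord0 i) => [j|] ->.
  by have := h2 j; rewrite rV_consS !mxE.
by rewrite rV_cons0; move: h1; rewrite in_itv.
Qed.

End bounded_sets.

(** * Difference quotients under the integral *)

Section differential_calculus.
Context (R : realType) (n : nat).
Implicit Types (u w f g : 'rV[R]_n -> R) (i j : 'I_n) (x y : 'rV[R]_n).

Local Notation mu := (lebesgue_rV R n).
Local Notation e_ i := (delta_mx 0 i : 'rV[R]_n).

Definition cube (B : R) : set 'rV[R]_n := open_box (const_mx (- B)) (const_mx B).

Lemma cubeE B x : cube B x <-> forall i, `|x 0 i| < B.
Proof.
split=> h i; first by have := h i; rewrite !mxE -ltr_norml.
by rewrite !mxE -ltr_norml.
Qed.

Lemma measurable_cube B : measurable (cube B).
Proof. exact: measurable_open_box. Qed.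

Lemma not_cube B x : ~ cube B x -> exists i, B <= `|x 0 i|.
Proof.
move=> nB; apply: contrapT => /forallNP h; apply: nB; apply/cubeE => i.
by rewrite ltNge; apply/negP; exact: h.
Qed.

Lemma not_cubeD B x t i : `|t| <= 1 -> ~ cube (B + 1) x -> ~ cube B (t *: e_ i + x).
Proof.
move=> t1 /not_cube[j Bj] /cubeE/(_ j); rewrite !mxE eqxx /=.
have h : `|t * (j == i)%:R| <= 1.
  by case: (j == i); rewrite ?mulr1// mulr0 normr0.
have := lerB_normD (x 0 j) (t * (j == i)%:R); rewrite [x 0 j + _]addrC; lra.
Qed.

Lemma cubeW B B' : B <= B' -> cube B `<=` cube B'.
Proof. by move=> BB' x /cubeE h; apply/cubeE => i; exact: lt_le_trans (h i) BB'. Qed.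

Definition supp_cube B f := forall x, ~ cube B x -> f x = 0.

Lemma derive_lineE f x i (t : R) :
  (fun h : R => h^-1 *: (((fun s : R => f (s *: e_ i + x)) \o shift t) (h *: (1:R)) - f (t *: e_ i + x))) =
  (fun h : R => h^-1 *: ((f \o shift (t *: e_ i + x)) (h *: e_ i) - f (t *: e_ i + x))).
Proof.
apply/funext => h /=; congr (_ *: (f _ - _)).
by rewrite -[h *: (1 : R)]/(h * 1) mulr1 scalerDl -addrA.
Qed.

Lemma is_derive_line f x i (t : R) : derivable f (t *: e_ i + x) (e_ i) ->
  is_derive t 1 (fun s : R => f (s *: e_ i + x)) ('D_(e_ i) f (t *: e_ i + x)).
Proof.
move=> df; split.
  by rewrite /derivable derive_lineE; exact: df.
by rewrite /derive derive_lineE.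
Qed.

Lemma MVT_line f x i (h : R) : 0 < h -> (forall y, derivable f y (e_ i)) ->
  exists2 t, 0 <= t <= h & f (h *: e_ i + x) - f x = h * 'D_(e_ i) f (t *: e_ i + x).
Proof.
move=> h0 df.
have cl : {within `[0, h], continuous (fun s : R => f (s *: e_ i + x))}.
  apply: continuous_subspaceT => s; apply: differentiable_continuous.
  by have [? _] := is_derive_line (df (s *: e_ i + x)); exact/derivable1_diffP.
have [t] := MVT h0 (fun s _ => is_derive_line (df _)) cl.
rewrite in_itv/= => /andP[t0 th]; rewrite scale0r add0r subr0 => ->.
by exists t; rewrite ?ltW// mulrC.
Qed.

(** The larger cube leaves room for the increments in the difference
    quotient. *)
Lemma supp_cube_derive B f i : supp_cube B f -> supp_cube (B + 1) ('D_(e_ i) f).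
Proof.
move=> Bf x nx; apply: lim_near_cst => //.
exists 1 => //= h h1 _; rewrite !Bf ?subr0 ?scaler0//.
  by apply: contra_not nx; apply: cubeW; rewrite lerDl.
apply: not_cubeD => //; move: h1; rewrite /= sub0r normrN; exact: ltW.
Qed.

Lemma supp_cube_bounded B f : continuous f -> supp_cube B f ->
  exists2 M, 0 <= M & forall x, `|f x| <= M.
Proof.
move=> cf Bf.
pose K := [set x : 'rV[R]_n | forall i, `[- B, B]%classic (x 0 i)].
have cK : compact K.
  by apply: (@rV_compact R n (fun=> `[- B, B]%classic)) => i; exact: segment_compact.
have := compact_bounded (continuous_compact (continuous_subspaceT cf) cK).
move=> [M [Mr hM]]; exists (`|M| + 1); first by rewrite addr_ge0.
move=> x; have [Bx|nBx] := pselect (cube B x); last first.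
  by rewrite Bf// normr0 addr_ge0.
apply: (hM (`|M| + 1)); first by rewrite (le_lt_trans (ler_norm _))// ltrDl.
exists x => //= i; rewrite /= in_itv/= -ler_norml ltW//.
by move: Bx => /cubeE.
Qed.

Lemma integrable_supp_cube B f : continuous f -> supp_cube B f ->
  mu.-integrable setT (EFin \o f).
Proof.
move=> cf Bf; have [M M0 fM] := supp_cube_bounded cf Bf.
have mf := continuous_measurable_rV cf.
have mB := measurable_cube B.
have : mu.-integrable (cube B) (EFin \o f).
  apply: measurable_bounded_integrable => //.
  - exact: lebesgue_open_box_lty.
  - exact: measurable_funTS.
  - exists M; split; first exact: num_real.
    by move=> y My x _; apply: le_trans (fM x) (ltW My).
move=> /(integrable_mkcond _ mB); apply: eq_integrable => // x _ /=.
by rewrite /patch; case: ifPn => // /negP; rewrite inE => /Bf ->.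
Qed.

Lemma Rintegral_support (E : set 'rV[R]_n) f : (forall x, ~ E x -> f x = 0) ->
  \int[mu]_(x in E) f x = \int[mu]_x f x.
Proof.
move=> Ef; rewrite Rintegral_mkcond; apply: eq_Rintegral => x _.
by rewrite /patch; case: ifPn => // /negP; rewrite inE => /Ef ->.
Qed.

Definition dquot i k f x := k.+1%:R * (f (k.+1%:R^-1 *: e_ i + x) - f x).

Section difference_quotient.
Context (f : 'rV[R]_n -> R) (i : 'I_n) (B : R).
Hypotheses (cf : continuous f) (df : forall x, derivable f x (e_ i))
  (cdf : continuous ('D_(e_ i) f)) (Bf : supp_cube B f).

Lemma continuous_dquot k : continuous (dquot i k f).
Proof.
move=> x.
have h : {for x, continuous (fun y => f (k.+1%:R^-1 *: e_ i + y))}.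
  apply: (@continuous_comp _ _ _ (fun y => k.+1%:R^-1 *: e_ i + y) f); last exact: cf.
  exact: (cvgD (cvg_cst _) cvg_id).
exact: (cvgM (cvg_cst (k.+1%:R : R)) (cvgB h (@cf x))).
Qed.

Lemma supp_dquot k : supp_cube (B + 1) (dquot i k f).
Proof.
move=> x nx; rewrite /dquot !Bf ?subr0 ?mulr0//.
  by apply: contra_not nx; apply: cubeW; rewrite lerDl.
apply: not_cubeD => //; rewrite ger0_norm ?invr_ge0//.
by rewrite invf_le1// ler1n.
Qed.

Lemma dquot_cvg x : (fun k => dquot i k f x) @ \oo --> 'D_(e_ i) f x.
Proof.
have c : (k.+1%:R^-1 : R) @[k --> \oo] --> 0^'.
  move=> A [e /= e0 hA]; have := near_infty_natSinv_lt (PosNum e0).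
  apply: filterS => k hk; apply: hA => /=; last by rewrite invr_neq0.
  by rewrite sub0r normrN ger0_norm.
rewrite (_ : (fun k => _) = (fun h : R => h^-1 *: ((f \o shift x) (h *: e_ i) - f x))
   \o (fun k => k.+1%:R^-1)).
  by apply: cvg_comp c _; exact: df.
by apply/funext => k /=; rewrite invrK.
Qed.

Lemma dquot_bounded : exists2 M, 0 <= M & forall k x, `|dquot i k f x| <= M.
Proof.
have [M M0 hM] := supp_cube_bounded cdf (supp_cube_derive i Bf).
exists M => // k x; rewrite /dquot.
have k0 : 0 < k.+1%:R^-1 :> R by rewrite invr_gt0.
have [t _ ->] := MVT_line x k0 df.
by rewrite mulrA mulfV ?mul1r// pnatr_eq0.
Qed.

(** Dominated convergence: by the mean value theorem the difference quotients
    are bounded by the supremum of the derivative, and they all vanish outside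
    one cube. *)
Lemma dquot_integral (g : 'rV[R]_n -> R) G : continuous g ->
  (forall x, `|g x| <= G) ->
  (\int[mu]_x (dquot i k f x * g x)) @[k --> \oo] --> \int[mu]_x ('D_(e_ i) f x * g x).
Proof.
move=> cg gG; have [M M0 hM] := dquot_bounded.
have mE := measurable_cube (B + 1).
have mgE : measurable_fun (cube (B + 1)) g.
  exact: (measurable_funTS (continuous_measurable_rV cg)).
have [] := @dominated_convergence _ _ _ mu (cube (B + 1)) mE
  (fun k x => (dquot i k f x * g x)%:E) (fun x => ('D_(e_ i) f x * g x)%:E)
  (cst (M * G)%:E).
- move=> k; apply/measurable_EFinP; apply: measurable_funM => //.
  apply: measurable_funTS; apply: continuous_measurable_rV.
  exact: continuous_dquot.
- apply/measurable_EFinP; apply: measurable_funM => //.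
  by apply: measurable_funTS; exact: continuous_measurable_rV.
- apply: aeW => x _; apply: cvg_EFin; first exact: nearW.
  by apply: cvgM; [exact: dquot_cvg|exact: cvg_cst].
- apply: measurable_bounded_integrable => //.
  + exact: lebesgue_open_box_lty.
  + exists (M * G); split; first exact: num_real.
    move=> y hy x _; rewrite /= ger0_norm ?mulr_ge0//; first exact: ltW.
    exact: le_trans (normr_ge0 _) (gG 0).
- by apply: aeW => x k _; rewrite lee_fin normrM ler_pM.
- move=> ifg _ h.
  have hk k : \int[mu]_x (dquot i k f x * g x) = \int[mu]_(x in cube (B + 1)) (dquot i k f x * g x).
    by apply/esym/Rintegral_support => x nx; rewrite supp_dquot// mul0r.
  rewrite -(Rintegral_support (E := cube (B + 1))); last first.
    by move=> x nx; rewrite (supp_cube_derive i Bf)// mul0r.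
  under eq_fun do rewrite hk.
  apply: fine_cvg; rewrite fineK; first exact: h.
  exact: integrable_fin_num.
Qed.

(** The integrals of the difference quotients vanish by translation
    invariance. *)
Lemma integral_derive0 : \int[mu]_x 'D_(e_ i) f x = 0.
Proof.
have h1 (x : 'rV[R]_n) : `|cst (1:R) x| <= 1 by rewrite /= normr1.
have := dquot_integral (@cst_continuous _ _ (1:R)) h1.
rewrite (_ : (fun k => _) = cst 0).
  move=> h; transitivity (\int[mu]_x ('D_(e_ i) f x * cst 1 x)).
    by apply: eq_Rintegral => x _; rewrite mulr1.
  by apply: cvg_unique h (cvg_cst _).
apply/funext => k /=.
under eq_Rintegral do rewrite mulr1.
have fi := integrable_supp_cube cf Bf.
have fs := integrable_shift (k.+1%:R^-1 *: e_ i) fi.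
rewrite RintegralZl//; last first.
  apply: eq_integrable (integrableB measurableT fs fi) => // x _ /=.
  by rewrite /shiftV [x + _]addrC.
rewrite RintegralB//; last first.
  by apply: eq_integrable fs => // x _ /=; rewrite /shiftV [x + _]addrC.
under eq_Rintegral => x _ do rewrite addrC.
by rewrite integral_shift// subrr mulr0.
Qed.

End difference_quotient.

End differential_calculus.

(** * Integration by parts and test functions *)

Section parts.
Context (R : realType) (n : nat).
Implicit Types (f g : 'rV[R]_n -> R) (i j : 'I_n).

Local Notation mu := (lebesgue_rV R n).
Local Notation e_ i := (delta_mx 0 i : 'rV[R]_n).

Lemma supp_cubeM B f g : supp_cube B f -> supp_cube B (fun x => f x * g x).
Proof. by move=> Bf x nx; rewrite Bf// mul0r. Qed.

Lemma integral_by_parts f g i B :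
  continuous f -> (forall x, derivable f x (e_ i)) -> continuous ('D_(e_ i) f) ->
  continuous g -> (forall x, derivable g x (e_ i)) -> continuous ('D_(e_ i) g) ->
  supp_cube B f ->
  \int[mu]_x ('D_(e_ i) f x * g x) = - \int[mu]_x (f x * 'D_(e_ i) g x).
Proof.
move=> cf df cdf cg dg cdg Bf.
have Dfg : 'D_(e_ i) (f * g) = (fun x => f x * 'D_(e_ i) g x + 'D_(e_ i) f x * g x).
  by apply/funext => x; rewrite deriveM// [_ *: _ in X in _ + X]mulrC.
have cfg1 : continuous (fun x => f x * 'D_(e_ i) g x).
  by move=> x; exact: (cvgM (@cf x) (@cdg x)).
have cfg2 : continuous (fun x => 'D_(e_ i) f x * g x).
  by move=> x; exact: (cvgM (@cdf x) (@cg x)).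
have i1 : mu.-integrable setT (EFin \o (fun x => f x * 'D_(e_ i) g x)).
  by apply: (integrable_supp_cube cfg1 (B := B)); exact: supp_cubeM.
have i2 : mu.-integrable setT (EFin \o (fun x => 'D_(e_ i) f x * g x)).
  apply: (integrable_supp_cube cfg2 (B := B + 1)).
  by apply: supp_cubeM; exact: supp_cube_derive.
have : \int[mu]_x ('D_(e_ i) (f * g) x) = 0.
  apply: (@integral_derive0 _ _ _ _ B).
  - by move=> x; exact: (cvgM (@cf x) (@cg x)).
  - by move=> x; exact: derivableM.
  - by rewrite Dfg => x; exact: (cvgD (@cfg1 x) (@cfg2 x)).
  - exact: supp_cubeM.
by rewrite Dfg RintegralD// => /eqP; rewrite addrC addr_eq0 => /eqP.
Qed.

Lemma quot_shiftE f (v x : 'rV[R]_n) i :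
  (fun h : R => h^-1 *: (((fun y => f (v + y)) \o shift x) (h *: e_ i) - f (v + x))) =
  (fun h : R => h^-1 *: ((f \o shift (v + x)) (h *: e_ i) - f (v + x))).
Proof. by apply/funext => h /=; rewrite addrCA. Qed.

Lemma derive_shiftE f (v x : 'rV[R]_n) i :
  'D_(e_ i) (fun y => f (v + y)) x = 'D_(e_ i) f (v + x).
Proof. by rewrite /derive quot_shiftE. Qed.

Lemma derivable_shiftE f (v x : 'rV[R]_n) i :
  derivable f (v + x) (e_ i) -> derivable (fun y => f (v + y)) x (e_ i).
Proof. by rewrite /derivable quot_shiftE. Qed.

Lemma derive_dquot f i j k x : (forall x, derivable f x (e_ j)) ->
  'D_(e_ j) (dquot i k f) x = dquot i k ('D_(e_ j) f) x.
Proof.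
move=> df.
have d1 := derivable_shiftE (df (k.+1%:R^-1 *: e_ i + x)).
have := deriveZ k.+1%:R (derivableB d1 (df x)).
by rewrite (deriveB d1 (df x)) derive_shiftE; apply.
Qed.

Lemma derivable_dquot f i j k x : (forall x, derivable f x (e_ j)) ->
  derivable (dquot i k f) x (e_ j).
Proof.
move=> df.
have d1 := derivable_shiftE (df (k.+1%:R^-1 *: e_ i + x)).
by have := @derivableZ _ _ _ _ k.+1%:R _ _ (derivableB d1 (df x)).
Qed.

Lemma is_derive_coord i (x v : 'rV[R]_n) : is_derive x v (fun y : 'rV[R]_n => y 0 i) (v 0 i).
Proof.
have h : (fun h : R => h^-1 *: (((fun y : 'rV[R]_n => y 0 i) \o shift x) (h *: v) - x 0 i))
    @ 0^' --> v 0 i.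
  apply: cvg_near_cst; exists 1 => //= h _ h0.
  by rewrite !mxE addrK -[_ *: _]/(_ * _) mulKf.
split; first by apply/cvg_ex; exists (v 0 i).
exact: cvg_lim h.
Qed.

Lemma lebesgue_open_box_gt0 (m : nat) (a b : 'rV[R]_m) : (forall i : 'I_m, a 0 i < b 0 i) ->
  (0 < lebesgue_rV R m (open_box a b))%E.
Proof.
elim: m a b => [|m IH] a b ab.
  rewrite /= diracE (_ : _ \in _) ?lte01//; apply/mem_set => -[].
  by [].
rewrite /= /lebesgue_cons /pushforward.
rewrite (_ : _ @^-1` _ = `]a 0 ord0, b 0 ord0[%classic `*`
   open_box (\row_j a 0 (lift ord0 j)) (\row_j b 0 (lift ord0 j))).
  rewrite product_measure1E//; last exact: measurable_open_box.
  apply: mule_gt0.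
    by rewrite /= lebesgue_measure_itv/= lte_fin ab -EFinD lte_fin subr_gt0.
  by apply: IH => i; rewrite !mxE.
apply/seteqP; split => p /=.
  move=> h; split; first by have := h ord0; rewrite rV_cons0 in_itv.
  by move=> j; have := h (lift ord0 j); rewrite rV_consS !mxE.
move=> [h1 h2] i; case: (unliftP ord0 i) => [j|] ->.
  by have := h2 j; rewrite rV_consS !mxE.
by rewrite rV_cons0; move: h1; rewrite in_itv.
Qed.

(** Around a point where f does not vanish there is a box of positive measure on
    which it does not vanish. *)
Lemma continuous_ae0 f (U : set 'rV[R]_n) : open U -> continuous f ->
  ae_eq_on U f (cst 0) -> forall x, U x -> f x = 0.
Proof.
move=> oU cf [N [mN N0 hN]] x Ux; apply: contrapT => /eqP fx.
have oV : open (U `&` f @^-1` [set~ 0]).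
  apply: openI => //; move/continuousP : cf; apply.
  by rewrite openC; exact: closed_eq.
have [p px pV] := open_rat_box oV (conj Ux (elimN eqP fx)).
have : (0 < mu (rat_box p))%E.
  by apply: lebesgue_open_box_gt0 => i; have /andP[] := px i; exact: lt_trans.
suff -> : mu (rat_box p) = 0%E by rewrite ltxx.
apply: (subset_measure0 (measurable_open_box _ _) mN) => // y py.
apply: hN => /= h.
have [Uy] : (U `&` f @^-1` [set~ 0]) y.
  by apply: pV; exact: open_boxS.
by apply; exact: h.
Qed.

End parts.

Section test_functions.
Context (R : realType) (n : nat) (Om : set 'rV[R]_n) (B : R).
Hypotheses (oOm : open Om) (OmB : Om `<=` cube B).
Implicit Types (f g phi psi : 'rV[R]_n -> R) (i j : 'I_n) (s t : seq 'I_n).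

Local Notation mu := (lebesgue_rV R n).
Local Notation e_ i := (delta_mx 0 i : 'rV[R]_n).
Local Notation test := (test_function Om).
Local Notation ip := (ip mu Om).

Let mOm : measurable Om. Proof. exact: open_measurable_rV. Qed.

Lemma pderiv_cat s t f : pderiv s (pderiv t f) = pderiv (s ++ t) f.
Proof. by elim: s => //= i s ->. Qed.

Lemma test_differentiable phi x : test phi -> differentiable phi x.
Proof. by move=> [/(_ [::] x)]. Qed.

Lemma test_continuous phi : test phi -> continuous phi.
Proof. by move=> tphi x; apply: differentiable_continuous; exact: test_differentiable. Qed.

Lemma test_derivable phi x v : test phi -> derivable phi x v.
Proof. by move=> tphi; apply: diff_derivable; exact: test_differentiable. Qed.

Lemma test_out phi x : test phi -> ~ Om x -> phi x = 0.
Proof.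
move=> [_ _ sub]; apply: contra_notP => /eqP h.
by apply: sub; apply: subset_closure.
Qed.

Lemma test_supp phi : test phi -> supp_cube B phi.
Proof. by move=> tphi x nx; apply: (test_out tphi); apply: contra_not nx; exact: OmB. Qed.

Lemma supp_derive_sub f v :
  closure [set x | 'D_v f x != 0] `<=` closure [set x | f x != 0].
Proof.
suff h : [set x | 'D_v f x != 0] `<=` closure [set x | f x != 0].
  have [+ _] := closure_id (closure [set x | f x != 0]).
  by move=> /(_ (@closed_closure _ _)) ->; exact: closure_subset.
move=> x /= Dx; apply: contrapT => nx.
have : nbhs x (~` closure [set x | f x != 0]).
  by apply: open_nbhs_nbhs; split => //; apply: closed_openC; exact: closed_closure.
move=> hx; move: Dx; rewrite (@near_eq_derive _ _ _ f (cst 0)) ?derive_cst ?eqxx//.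
apply: filterS hx => y ny /=; apply: contrapT => /eqP fy; apply: ny.
exact: subset_closure.
Qed.

Lemma test_pderiv1 i phi : test phi -> test (pderiv [:: i] phi).
Proof.
move=> [sphi cphi subphi]; split.
- by move=> s x; rewrite pderiv_cat; exact: sphi.
- apply: subclosed_compact cphi _; first exact: closed_closure.
  exact: supp_derive_sub.
- by apply: subset_trans subphi; exact: supp_derive_sub.
Qed.

Lemma test_pderiv s phi : test phi -> test (pderiv s phi).
Proof. by move=> tphi; elim: s => //= i s; exact: test_pderiv1. Qed.

Lemma pderiv_comb s c phi psi : test phi -> test psi ->
  pderiv s (c *: phi + psi) = c *: pderiv s phi + pderiv s psi.
Proof.
move=> tphi tpsi; elim: s => //= i s ->; apply/funext => x.
have d1 := @test_derivable _ x (e_ i) (test_pderiv s tphi).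
have d2 := @test_derivable _ x (e_ i) (test_pderiv s tpsi).
by rewrite deriveD ?deriveZ//; exact: (@derivableZ _ _ _ _ c).
Qed.

Lemma test_comb c phi psi : test phi -> test psi -> test (c *: phi + psi).
Proof.
move=> tphi tpsi; have [sphi cphi subphi] := tphi; have [spsi cpsi subpsi] := tpsi.
have sub : closure [set x | (c *: phi + psi) x != 0] `<=`
    closure [set x | phi x != 0] `|` closure [set x | psi x != 0].
  rewrite -closureU; apply: closure_subset => x /=.
  have [p0|] := eqVneq (phi x) 0; last by left.
  by rewrite -[_ x]/(c * phi x + psi x) p0 mulr0 add0r; right.
split.
- move=> s x; rewrite pderiv_comb//; apply: differentiableD; last exact: spsi.
  exact: differentiableZ.
- apply: subclosed_compact _ _ sub; first exact: closed_closure.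
  have := @bigsetU_compact _ bool (fun b : bool => if b then closure [set x | phi x != 0]
    else closure [set x | psi x != 0]) [:: true; false] xpredT.
  by rewrite !big_cons big_nil/= setU0; apply => -[].
- by apply: subset_trans sub _; rewrite subUset.
Qed.

Lemma test0 : test 0.
Proof.
have p0 s : pderiv s (0 : 'rV[R]_n -> R) = 0.
  by elim: s => //= i s ->; apply/funext => x; exact: derive_cst.
have c0 : closure [set x : 'rV[R]_n | (0 : 'rV[R]_n -> R) x != 0] = set0.
  rewrite (_ : [set _ | _] = set0) ?closure0//.
  by apply/seteqP; split => x //=; rewrite eqxx.
split.
- by move=> s x; rewrite p0; exact: differentiable_cst.
- by rewrite c0; exact: compact0.
- by rewrite c0.
Qed.

Lemma test_sum (I : Type) (r : seq I) (P : pred I) (F : I -> 'rV[R]_n -> R) :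
  (forall k, P k -> test (F k)) -> test (\sum_(k <- r | P k) F k).
Proof.
move=> tF; elim/big_ind : _ => //; first exact: test0.
by move=> u v tu tv; rewrite -[u]scale1r; exact: test_comb.
Qed.

Lemma test_sqint phi : test phi -> square_integrable mu Om phi.
Proof.
move=> tphi; have c := test_continuous tphi; split.
  by apply: measurable_funTS; exact: continuous_measurable_rV.
have : mu.-integrable setT (EFin \o (fun x => phi x ^+ 2)).
  apply: (@integrable_supp_cube _ _ B); first by move=> x; exact: (cvgM (@c x) (@c x)).
  by move=> x nx; rewrite (test_supp tphi)// expr0n.
exact: integrableS.
Qed.

Lemma ip_test f g : test g -> ip f g = \int[mu]_x (f x * g x).
Proof.
by move=> tg; apply: Rintegral_support => x nx; rewrite (test_out tg)// mulr0.
Qed.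

Lemma test_parts i phi psi : test phi -> test psi ->
  ip (pderiv [:: i] phi) psi = - ip phi (pderiv [:: i] psi).
Proof.
move=> tphi tpsi; rewrite !ip_test//; last exact: test_pderiv1.
apply: (@integral_by_parts _ _ _ _ _ B) => //.
- exact: test_continuous.
- by move=> x; exact: test_derivable.
- exact: test_continuous (test_pderiv1 i tphi).
- exact: test_continuous.
- by move=> x; exact: test_derivable.
- exact: test_continuous (test_pderiv1 i tpsi).
- exact: test_supp.
Qed.

Lemma test_bounded phi : test phi -> exists M, forall x, `|phi x| <= M.
Proof.
move=> tphi; have [M _ hM] := supp_cube_bounded (test_continuous tphi) (test_supp tphi).
by exists M.
Qed.

(** The difference quotient in direction i commutes with the j-th derivative, so
    the identity holds for difference quotients after one integration by parts
    in direction j; then the step tends to 0. *)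
Lemma test_ip_swap i j phi psi : test phi -> test psi ->
  ip (pderiv [:: i; j] phi) psi = ip (pderiv [:: j; i] phi) psi.
Proof.
move=> tphi tpsi.
have tj := test_pderiv1 j tphi; have ti := test_pderiv1 i tphi.
have tij := test_pderiv1 i tj.
have [M hM] := test_bounded tpsi; have [M' hM'] := test_bounded (test_pderiv1 j tpsi).
have h1 := dquot_integral (test_continuous tj) (fun x => @test_derivable _ x (e_ i) tj)
  (test_continuous tij) (test_supp tj) (test_continuous tpsi) hM.
have h2 := dquot_integral (test_continuous tphi) (fun x => @test_derivable _ x (e_ i) tphi)
  (test_continuous ti) (test_supp tphi) (test_continuous (test_pderiv1 j tpsi)) hM'.
have tjpsi := test_pderiv1 j tpsi.
have e1 := test_parts j ti tpsi.
rewrite (ip_test _ tjpsi) in e1; apply: etrans (esym e1).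
rewrite (ip_test _ tpsi).
apply: (cvg_unique _ h1) => //.
rewrite (_ : (fun k => _) = (fun k => - \int[mu]_x (dquot i k phi x * pderiv [:: j] psi x))).
  exact: (cvgN h2).
apply/funext => k.
transitivity (\int[mu]_x ('D_(e_ j) (dquot i k phi) x * psi x)).
  apply: eq_Rintegral => x _; rewrite derive_dquot// => y; exact: test_derivable.
have cphi := test_continuous tphi.
apply: (@integral_by_parts _ _ _ _ _ (B + 1)).
- exact: continuous_dquot.
- by move=> x; apply: derivable_dquot => y; exact: test_derivable.
- rewrite (_ : 'D_(e_ j) (dquot i k phi) = dquot i k (pderiv [:: j] phi)).
    by apply: continuous_dquot; exact: test_continuous tj.
  by apply/funext => x; apply: derive_dquot => y; exact: test_derivable.
- exact: test_continuous.
- by move=> x; exact: test_derivable.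
- exact: test_continuous (test_pderiv1 j tpsi).
- by apply: supp_dquot; exact: test_supp.
Qed.

(** By [test_ip_swap] the difference of the two mixed derivatives is orthogonal to
    every test function, in particular to itself. *)
Lemma pderiv_swap i j phi : test phi -> pderiv [:: i; j] phi = pderiv [:: j; i] phi.
Proof.
move=> tphi; have tij := test_pderiv [:: i; j] tphi; have tji := test_pderiv [:: j; i] tphi.
pose chi := pderiv [:: i; j] phi - pderiv [:: j; i] phi.
have chiE : chi = (-1) *: pderiv [:: j; i] phi + pderiv [:: i; j] phi.
  by rewrite scaleN1r addrC.
have tchi : test chi by rewrite chiE; exact: test_comb.
have Sip := semi_inner_ip mu mOm.
have chi0 : ip chi chi = 0.
  apply: etrans (si_Bl Sip (test_sqint tij) (test_sqint tji) (test_sqint tchi)) _.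
  by apply/eqP; rewrite subr_eq0; apply/eqP; exact: (test_ip_swap i j tphi tchi).
apply/eqP; rewrite -subr_eq0; apply/eqP/funext => x.
have [Ox|nOx] := pselect (Om x); last exact: (test_out tchi nOx).
apply: (continuous_ae0 oOm (test_continuous tchi)) => //.
exact: (ip_eq0 mOm (test_sqint tchi) chi0).
Qed.

(** Integrating the i-th derivative of x_i phi^2 gives
    (phi, phi) = - 2 (phi, x_i D_i phi); conclude by Cauchy-Schwarz, as
    |x_i| < B on Om. *)
Lemma poincare i phi : test phi ->
  ip phi phi <= (2 * B) ^+ 2 * ip (pderiv [:: i] phi) (pderiv [:: i] phi).
Proof.
move=> tphi; have c := test_continuous tphi.
have ti := test_pderiv1 i tphi; have ci := test_continuous ti.
pose X (x : 'rV[R]_n) : R := x 0 i.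
have dX x : is_derive x (e_ i) X 1.
  by have := is_derive_coord i x (e_ i); rewrite mxE !eqxx.
have DX1 x : 'D_(e_ i) X x = 1 by exact: derive_val.
have DX : 'D_(e_ i) X = cst 1 by apply/funext => x; exact: DX1.
have Dphi2x x : 'D_(e_ i) (phi * phi) x =
    phi x * pderiv [:: i] phi x + phi x * pderiv [:: i] phi x.
  have d := @test_derivable _ x (e_ i) tphi; exact: (deriveM d d).
have Dphi2 : 'D_(e_ i) (phi * phi) = (fun x => phi x * pderiv [:: i] phi x + phi x * pderiv [:: i] phi x).
  by apply/funext => x; exact: Dphi2x.
have cX : continuous X by exact: coord_continuous.
have cphiD : continuous (fun x => phi x * pderiv [:: i] phi x).
  by move=> x; exact: (cvgM (@c x) (@ci x)).
have parts : \int[mu]_x ('D_(e_ i) (phi * phi) x * X x) =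
    - \int[mu]_x ((phi * phi) x * 'D_(e_ i) X x).
  apply: (@integral_by_parts _ _ _ _ _ B) => //.
  - by move=> x; exact: (cvgM (@c x) (@c x)).
  - by move=> x; apply: derivableM; exact: test_derivable.
  - by rewrite Dphi2 => x; exact: (cvgD (@cphiD x) (@cphiD x)).
  - by rewrite DX; exact: cst_continuous.
  - by move=> x nx; rewrite -[LHS]/(phi x * phi x) (test_supp tphi nx) mul0r.
pose w (x : 'rV[R]_n) := X x * pderiv [:: i] phi x.
have cw : continuous w by move=> x; exact: (cvgM (@cX x) (@ci x)).
have w0 x : ~ Om x -> w x = 0 by move=> nx; rewrite /w (test_out ti nx) mulr0.
have Bw : supp_cube B (fun x => w x ^+ 2).
  move=> x nx; rewrite w0 ?expr0n//; by apply: contra_not nx; exact: OmB.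
have Sw : square_integrable mu Om w.
  split; first by apply: measurable_funTS; exact: continuous_measurable_rV.
  have : mu.-integrable setT (EFin \o (fun x => w x ^+ 2)).
    by apply: integrable_supp_cube Bw => x; exact: (cvgM (@cw x) (@cw x)).
  exact: integrableS.
have Sphi := test_sqint tphi; have SD := test_sqint ti.
have Sip := semi_inner_ip mu mOm.
have e1 : ip phi phi = - 2 * ip phi w.
  rewrite (ip_test _ tphi).
  transitivity (\int[mu]_x ((phi * phi) x * 'D_(e_ i) X x)).
    by apply: eq_Rintegral => x _; rewrite DX1 mulr1.
  apply: oppr_inj; rewrite -parts mulNr opprK /ip -RintegralZl//; last exact: sqintM.
  rewrite -(@Rintegral_support _ _ Om); last first.
    move=> x nx; by rewrite Dphi2x (test_out tphi nx) !mul0r addr0 mul0r.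
  by apply: eq_Rintegral => x _; rewrite Dphi2x /w; ring.
have e2 : ip w w <= B ^+ 2 * ip (pderiv [:: i] phi) (pderiv [:: i] phi).
  rewrite /ip -RintegralZl//; last exact: sqintM.
  apply: le_Rintegral => //.
  - exact: sqintM.
  - have := integrableZl mOm (B ^+ 2) (sqintM mOm SD SD).
    by apply: eq_integrable.
  - move=> x /OmB /cubeE/(_ i) Xx.
    rewrite /w mulrACA -expr2 ler_wpM2r//; first by rewrite -expr2 sqr_ge0.
    have B0 : 0 <= B := le_trans (normr_ge0 _) (ltW Xx).
    by rewrite -[X x ^+ 2]real_normK ?num_real// ler_sqr ?nnegrE// ltW.
have cs := si_cauchy_schwarz Sip Sphi Sw.
have p0 := ip_ge0 mu Om phi.
have [p|p] := eqVneq (ip phi phi) 0.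
  by rewrite {1}p mulr_ge0 ?sqr_ge0 ?ip_ge0.
have {}p0 : 0 < ip phi phi by rewrite lt0r p.
have e3 : ip phi phi ^+ 2 <= 4 * (ip phi phi * (B ^+ 2 * ip (pderiv [:: i] phi) (pderiv [:: i] phi))).
  rewrite {1}e1 exprMn sqrrN (_ : 2 ^+ 2 = 4) ?ler_pM2l//; last by ring.
  by apply: le_trans cs _; rewrite ler_pM2l.
rewrite -(ler_pM2l p0) -expr2; apply: le_trans e3 _.
by rewrite [leLHS](_ : _ = ip phi phi * ((2 * B) ^+ 2 * ip (pderiv [:: i] phi) (pderiv [:: i] phi)))//; ring.
Qed.

End test_functions.

Lemma ip_cst1 (R : realType) (n : nat) (Om : set 'rV[R]_n) f :
  ip (lebesgue_rV R n) Om f (cst 1) = \int[lebesgue_rV R n]_(x in Om) f x.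
Proof. by apply: eq_Rintegral => x _; rewrite mulr1. Qed.

Lemma test_integral0 (R : realType) (n : nat) (Om : set 'rV[R]_n) (B : R) (OmB : Om `<=` cube B) i phi :
  test_function Om phi -> \int[lebesgue_rV R n]_x pderiv [:: i] phi x = 0.
Proof.
move=> tphi; apply: (@integral_derive0 _ _ _ _ B).
- exact: test_continuous tphi.
- by move=> x; exact: test_derivable tphi.
- exact: test_continuous (test_pderiv1 i tphi).
- exact: (test_supp OmB tphi).
Qed.

(** * Smooth bumps *)

Section flat.
Context (R : realType).
Implicit Types (c t : R) (p : {poly R}).

Lemma exp_dominates_monomial c (k : nat) : 0 < c ->
  exists2 M, 0 <= M & forall t, 0 < t -> t ^+ k * expR (- (c * t)) <= M.
Proof.
move=> c0; case: k => [|k].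
  exists 1 => // t t0; rewrite expr0 mul1r -expR0 ler_expR oppr_le0.
  by rewrite mulr_ge0// ltW.
have ck : 0 < c ^+ k.+1 by rewrite exprn_gt0.
exists ((k.+1)`!%:R / c ^+ k.+1); first by rewrite divr_ge0// ltW.
move=> t t0; rewrite expRN ler_pdivrMr ?expR_gt0// mulrAC ler_pdivlMr//.
have := expR_ge1Dxn k (mulr_ge0 (ltW c0) (ltW t0)).
move=> /(le_trans (ler_wpDl ler01 (lexx _))).
by rewrite ler_pdivrMr ?ltr0n ?fact_gt0// exprMn mulrC [expR _ * _]mulrC.
Qed.

Lemma exp_dominates_poly c p : 0 < c ->
  exists2 M, 0 <= M & forall t, 0 < t -> `|p.[t]| * expR (- (c * t)) <= M.
Proof.
move=> c0; have /choice[M hM] : forall k, exists M, 0 <= M /\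
    forall t, 0 < t -> t ^+ k * expR (- (c * t)) <= M.
  by move=> k; have [M M0 hM] := exp_dominates_monomial k c0; exists M.
exists (\sum_(i < size p) `|p`_i| * M i).
  by apply: sumr_ge0 => i _; rewrite mulr_ge0//; case: (hM i).
move=> t t0; rewrite horner_coef.
apply: (@le_trans _ _ ((\sum_(i < size p) `|p`_i| * t ^+ i) * expR (- (c * t)))).
  rewrite ler_wpM2r ?expR_ge0//; apply: le_trans (ler_norm_sum _ _ _) _.
  by apply: ler_sum => i _; rewrite normrM (@ger0_norm _ (t ^+ i))// exprn_ge0// ltW.
rewrite mulr_suml; apply: ler_sum => i _; rewrite -mulrA ler_wpM2l//.
by case: (hM i) => _; apply.
Qed.

(** The factor p(1/t) makes the family of functions p(1/t) exp(-c/t) stable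
    under derivation, with [flat_deriv] acting on p. *)
Definition flat c p t : R := if 0 < t then p.[t^-1] * expR (- (c * t^-1)) else 0.

Definition flat_deriv c p : {poly R} := 'X ^+ 2 * (c *: p - p^`()).

(** At 0 the difference quotient is O(t), since exp(-c/t) decreases faster than
    any power of t. *)
Lemma flat_is_derive c p t : 0 < c -> is_derive t 1 (flat c p) (flat c (flat_deriv c p) t).
Proof.
move=> c0; have [t0|t0|<-] := ltgtP 0 t.
- pose F (s : R) := p.[s^-1] * expR (- (c * s^-1)).
  apply: (@near_eq_is_derive _ _ _ F).
    have : \forall s \near t, 0 < s by exact: lt_nbhsr.
    by apply: filterS => s s0; rewrite /flat s0.
  have dV : is_derive t 1 (fun y : R => y^-1) (- t ^- 2 *: 1).
    by apply: (@is_deriveV _ id); rewrite gt_eqF.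
  have d1 := is_derive1_comp (is_derive_poly p t^-1) dV.
  have d2 : is_derive t 1 (fun s : R => - (c * s^-1)) (- (c *: (- t ^- 2 *: 1))).
    exact: (is_deriveN (is_deriveZ c dV)).
  have d3 := @is_derive1_comp _ expR (fun s : R => - (c * s^-1)) t _ _ (is_derive_expR _) d2.
  apply: is_derive_eq (is_deriveM d1 d3) _.
  rewrite /flat t0 /flat_deriv /= !hornerE /= -!exprVn.
  rewrite -[_ *: _ in X in X + _]/(_ * _) -[_ *: _ in X in _ + X]/(_ * _).
  by rewrite -[c *: _]/(c * _) -[_ *: 1]/(_ * 1); ring.
- have -> : flat c (flat_deriv c p) t = 0 by rewrite /flat ltNge (ltW t0).
  apply: (@near_eq_is_derive _ _ _ (cst 0)).
    have : \forall s \near t, s < 0 by exact: lt_nbhsl.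
    by apply: filterS => s s0; rewrite /flat ltNge (ltW s0).
- rewrite {2}/flat ltxx.
  have [M M0 hM] := exp_dominates_poly ('X ^+ 2 * p) c0.
  have h : (fun h : R => h^-1 *: ((flat c p \o shift 0) (h *: (1 : R)) - flat c p 0)) @ 0^' --> (0 : R).
    apply/norm_cvg0P; apply: (@squeeze_cvgr _ _ _ _ (fun=> 0) (fun h : R => M * `|h|)).
    - apply: nearW => h; rewrite normr_ge0 /= /flat ltxx subr0 addr0.
      rewrite -[h *: 1]/(h * 1) mulr1; case: ifPn => h0; last first.
        by rewrite scaler0 normr0 mulr_ge0.
      have := hM h^-1; rewrite invr_gt0 => /(_ h0).
      rewrite !hornerE -[_ *: _]/(_ * _) !normrM (@ger0_norm _ (expR _)) ?expR_ge0//.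
      rewrite (@gtr0_norm _ h^-1) ?invr_gt0//.
      rewrite [X in _ -> _ <= M * X](_ : _ = h) => [hM'|]; last exact: gtr0_norm.
      rewrite -ler_pdivrMr//; apply: le_trans hM'.
      by rewrite le_eqVlt; apply/orP; left; apply/eqP; ring.
    - exact: cvg_cst.
    - have c1 : (fun h : R => h) @ (0 : R)^' --> (0 : R).
        by move=> A A0; apply: cvg_within; exact: A0.
      have := cvgM (cvg_cst M) (cvg_norm c1).
      by rewrite normr0 mulr0; apply.
  split; first by apply/cvg_ex; exists 0.
  exact: cvg_lim h.
Qed.

End flat.

Section smooth_functions.
Context (R : realType) (n : nat).
Implicit Types (f g : 'rV[R]_n -> R) (i j : 'I_n) (x : 'rV[R]_n).

Local Notation e_ i := (delta_mx 0 i : 'rV[R]_n).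

(** A class of differentiable functions stable under partial derivatives: its
    members are smooth without any computation of higher derivatives. *)
Inductive smooth_expr : ('rV[R]_n -> R) -> Prop :=
| smooth_flat i (r a c : R) (p : {poly R}) :
    0 < c -> smooth_expr (fun x => flat c p (r * x 0 i + a))
| smooth_cst (k : R) : smooth_expr (fun=> k)
| smooth_add f g : smooth_expr f -> smooth_expr g -> smooth_expr (fun x => f x + g x)
| smooth_mul f g : smooth_expr f -> smooth_expr g -> smooth_expr (fun x => f x * g x).

Lemma affine_coord_differentiable i (r a : R) x :
  differentiable (fun y : 'rV[R]_n => r * y 0 i + a) x.
Proof.
apply: differentiableD; last exact: differentiable_cst.
apply: (@differentiableZ _ _ _ (fun y : 'rV[R]_n => y 0 i)).
exact: differentiable_coord.
Qed.

Lemma flat_coord_differentiable i (r a c : R) p x : 0 < c ->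
  differentiable (fun y : 'rV[R]_n => flat c p (r * y 0 i + a)) x.
Proof.
move=> c0.
apply: (@differentiable_comp _ _ _ _ (fun y : 'rV[R]_n => r * y 0 i + a) (flat c p)).
  exact: affine_coord_differentiable.
have [? _] := flat_is_derive p (r * x 0 i + a) c0.
exact/derivable1_diffP.
Qed.

Lemma flat_coord_derive i j (r a c : R) p x : 0 < c ->
  'D_(e_ j) (fun y : 'rV[R]_n => flat c p (r * y 0 i + a)) x =
  r * (j == i)%:R * flat c (flat_deriv c p) (r * x 0 i + a).
Proof.
move=> c0; set F := flat c p; set y := r * x 0 i + a; set v := r * (j == i)%:R.
have Fy := flat_is_derive p y c0; have [dF vF] := Fy.
transitivity ('D_v F y).
  rewrite /derive (_ : (fun h : R => h^-1 *:
      (((fun z : 'rV[R]_n => F (r * z 0 i + a)) \o shift x) (h *: e_ j) - F y)) =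
    (fun h : R => h^-1 *: ((F \o shift y) (h *: v) - F y)))//.
  apply/funext => h /=; congr (_ *: (F _ - _)).
  by rewrite !mxE eqxx /= /y /v -[h *: _]/(h * _) eq_sym; ring.
rewrite deriveE; last exact/derivable1_diffP.
rewrite diff1E; last exact/derivable1_diffP.
by rewrite derive1E vF.
Qed.

Lemma smooth_differentiable f x : smooth_expr f -> differentiable f x.
Proof.
move=> sf; elim: sf => {f}.
- by move=> i r a c p c0; exact: flat_coord_differentiable.
- by move=> k; exact: differentiable_cst.
- by move=> f g _ df _ dg; exact: differentiableD.
- by move=> f g _ df _ dg; exact: differentiableM.
Qed.

Lemma smooth_derive f j : smooth_expr f -> smooth_expr (fun x => 'D_(e_ j) f x).
Proof.
move=> sf; elim: sf => {f}.
- move=> i r a c p c0.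
  rewrite (_ : (fun x => _) = (fun x => r * (j == i)%:R * flat c (flat_deriv c p) (r * x 0 i + a))).
    by apply: smooth_mul; [exact: smooth_cst|exact: smooth_flat].
  by apply/funext => x; exact: flat_coord_derive.
- move=> k; have -> : (fun x => 'D_(e_ j) (fun _ : 'rV[R]_n => k) x) = (fun=> 0 : R).
    by apply/funext => x; exact: derive_cst.
  exact: smooth_cst.
- move=> f g sf df sg dg.
  rewrite (_ : (fun x => _) = (fun x => 'D_(e_ j) f x + 'D_(e_ j) g x)); first exact: smooth_add.
  apply/funext => x; apply: deriveD; exact/diff_derivable/smooth_differentiable.
- move=> f g sf df sg dg.
  rewrite (_ : (fun x => _) = (fun x => f x * 'D_(e_ j) g x + g x * 'D_(e_ j) f x)).
    by apply: smooth_add; exact: smooth_mul.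
  apply/funext => x; apply: deriveM; exact/diff_derivable/smooth_differentiable.
Qed.

Lemma smooth_pderiv f s x : smooth_expr f -> differentiable (pderiv s f) x.
Proof.
move=> sf; apply: smooth_differentiable.
by elim: s => //= i s; exact: smooth_derive.
Qed.

Lemma smooth_prod (I : Type) (r : seq I) (F : I -> 'rV[R]_n -> R) :
  (forall k, smooth_expr (F k)) -> smooth_expr (fun x => \prod_(k <- r) F k x).
Proof.
move=> sF; elim: r => [|k r IH].
  by rewrite (_ : (fun x => _) = (fun=> 1)); [exact: smooth_cst|apply/funext => x; rewrite big_nil].
rewrite (_ : (fun x => _) = (fun x => F k x * \prod_(j <- r) F j x)).
  exact: smooth_mul.
by apply/funext => x; rewrite big_cons.
Qed.

(** The factors 1 and -1 are slopes as in [smooth_flat].  As c tends to 0 the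
    bump tends to the indicator of the open box. *)
Definition box_bump (a b : 'rV[R]_n) (c : R) (x : 'rV[R]_n) : R :=
  \prod_(i < n) (flat c 1 (1 * x 0 i + - a 0 i) * flat c 1 (-1 * x 0 i + b 0 i)).

Lemma bump_out a b c x : ~ open_box a b x -> box_bump a b c x = 0.
Proof.
move=> nx; have [i /negP] : exists i, ~ (a 0 i < x 0 i < b 0 i).
  by apply: contrapT => /forallNP h; apply: nx => i; have := h i => /contrapT.
rewrite negb_and -!leNgt => h; rewrite /box_bump (bigD1 i)//=.
have f0 t : t <= 0 -> flat c 1 t = 0 by move=> t0; rewrite /flat ltNge t0.
by case/orP : h => h; [rewrite [X in X * _ * _]f0|rewrite [X in _ * X * _]f0];
  rewrite ?mul0r ?mulr0 ?mul0r//; lra.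
Qed.

Lemma flat1_bound (c t : R) : 0 < c -> 0 <= flat c 1 t <= 1.
Proof.
move=> c0; rewrite /flat; case: ifPn => t0; last by rewrite lexx ler01.
rewrite hornerC mul1r expR_ge0/= -expR0 ler_expR oppr_le0.
by rewrite mulr_ge0 ?invr_ge0 ?ltW.
Qed.

Lemma bump_bound a b c x : 0 < c -> 0 <= box_bump a b c x <= 1.
Proof.
move=> c0; rewrite /box_bump; apply/andP; split.
  have f0 t : 0 <= flat c 1 t by case/andP : (flat1_bound t c0).
  by apply: prodr_ge0 => i _; rewrite mulr_ge0.
apply: prodr_ile1 => i _.
have /andP[h1 h2] := flat1_bound (1 * x 0 i + - a 0 i) c0.
have /andP[h3 h4] := flat1_bound (-1 * x 0 i + b 0 i) c0.
by rewrite mulr_ge0//= mulr_ile1.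
Qed.

Lemma bump_gt0 a b c x : open_box a b x -> 0 < box_bump a b c x.
Proof.
move=> abx; apply: prodr_gt0 => i _; have /andP[ax xb] := abx i.
have f0 t : 0 < t -> 0 < flat c 1 t.
  by move=> t0; rewrite /flat t0 hornerC mul1r expR_gt0.
by apply: mulr_gt0; apply: f0; lra.
Qed.

Lemma bump_cvg a b x : open_box a b x ->
  (fun k => box_bump a b k.+1%:R^-1 x) @ \oo --> (1 : R).
Proof.
move=> abx.
have h i : (fun k => flat k.+1%:R^-1 1 (1 * x 0 i + - a 0 i) *
    flat k.+1%:R^-1 1 (-1 * x 0 i + b 0 i)) @ \oo --> (1 : R).
  have key t : 0 < t -> (fun k => flat k.+1%:R^-1 1 t) @ \oo --> (1 : R).
    move=> t0; rewrite (_ : (fun k => _) = (fun k => expR (- (k.+1%:R^-1 * t^-1)))); last first.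
      by apply/funext => k; rewrite /flat t0 hornerC mul1r.
    rewrite -[X in _ --> X](@expR0 R); apply: continuous_cvg; first exact: continuous_expR.
    have := cvgN (cvgM (@cvg_harmonic R) (cvg_cst t^-1)).
    by rewrite mul0r oppr0; apply.
  rewrite -[X in _ --> X](mulr1 (1 : R)); have /andP[ax xb] := abx i.
  by apply: cvgM; apply: key; lra.
rewrite /box_bump; elim: (index_enum _) => [|i r IH].
  by under eq_fun do rewrite big_nil; exact: cvg_cst.
under eq_fun do rewrite big_cons.
by have := cvgM (h i) IH; rewrite mulr1; apply.
Qed.

Lemma bump_test (Om : set 'rV[R]_n) a b c : 0 < c -> closed_box a b `<=` Om ->
  test_function Om (box_bump a b c).
Proof.
move=> c0 abO.
have cbox : compact (closed_box a b).
  pose A (i : 'I_n) := `[a 0 i, b 0 i]%classic.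
  rewrite (_ : closed_box a b = [set x : 'rV[R]_n | forall i, A i (x 0 i)]).
    by apply: (@rV_compact R n A) => i; exact: segment_compact.
  by apply/seteqP; split => x h i; have := h i; rewrite /A /= in_itv.
have sub : closure [set x | box_bump a b c x != 0] `<=` closed_box a b.
  have [+ _] := closure_id (closed_box a b).
  move=> /(_ (compact_closed (@norm_hausdorff _ _) cbox)) ->; apply: closure_subset.
  move=> x /= h i; move/eqP : h => h.
  have : open_box a b x by apply: contrapT => /bump_out.
  by move=> /(_ i)/andP[/ltW-> /ltW->].
split.
- move=> s x; apply: smooth_pderiv; apply: smooth_prod => i.
  by apply: smooth_mul; exact: smooth_flat.
- by apply: subclosed_compact cbox sub; exact: closed_closure.
- exact: subset_trans sub abO.
Qed.

End smooth_functions.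

(** * The fundamental lemma of the calculus of variations *)

Section fundamental_lemma.
Context (R : realType) (n : nat) (Om : set 'rV[R]_n) (B : R).
Hypotheses (oOm : open Om) (OmB : Om `<=` cube B).

Local Notation mu := (lebesgue_rV R n).

Let mOm : measurable Om. Proof. exact: open_measurable_rV. Qed.

Lemma lebesgue_Om_lty : (mu Om < +oo)%E.
Proof.
apply: le_lt_trans (lebesgue_open_box_lty (const_mx (- B)) (const_mx B)).
by apply: le_measure; rewrite ?inE//; exact: measurable_open_box.
Qed.

Lemma sqint_cst (c : R) : square_integrable mu Om (cst c).
Proof.
split; first exact: measurable_cst.
apply: measurable_bounded_integrable => //; first exact: lebesgue_Om_lty.
  exact: (@measurable_cst _ _ _ _ _ (c ^+ 2)).
exists (c ^+ 2); split; first exact: num_real.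
by move=> M hM x _ /=; rewrite ger0_norm ?sqr_ge0 ?ltW.
Qed.

Lemma sqint_integrable w : square_integrable mu Om w -> mu.-integrable Om (EFin \o w).
Proof.
move=> Sw; have := sqintM mOm Sw (sqint_cst 1); apply: eq_integrable => // x _ /=.
by rewrite mulr1.
Qed.

Section orthogonal_to_tests.
Context (w : 'rV[R]_n -> R).
Hypotheses (Sw : square_integrable mu Om w)
  (w0 : forall phi, test_function Om phi -> ip mu Om w phi = 0).

Let iw := sqint_integrable Sw.

(** The bumps of [bump_cvg] are bounded by 1 and tend to the indicator of the
    box. *)
Lemma integral_box0 (a b : 'rV[R]_n) : closed_box a b `<=` Om ->
  (\int[mu]_(x in open_box a b) (w x)%:E = 0)%E.
Proof.
move=> abO; have mab := measurable_open_box a b.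
have abO' : open_box a b `<=` Om.
  exact: subset_trans (@open_boxS _ _ _ _) abO.
have k0 k : (0 : R) < k.+1%:R^-1 by rewrite invr_gt0.
have mw : measurable_fun Om w by case: Sw.
have tb k := bump_test (k0 k) abO.
have [] := @dominated_convergence _ _ _ mu Om mOm
  (fun k x => (w x * box_bump a b k.+1%:R^-1 x)%:E)
  ((EFin \o w) \_ (open_box a b)) (abse \o (EFin \o w)).
- move=> k; apply/measurable_EFinP; apply: measurable_funM => //.
  by case: (test_sqint oOm OmB (tb k)).
- apply: (measurable_restrict _ mab mOm).1.
  apply: measurable_funS (measurable_int _ iw) => //.
- apply: aeW => x _; rewrite /patch; case: ifPn => [/set_mem xab|/negP]; last first.
    rewrite inE => nx; apply: cvg_near_cst; apply: nearW => k.
    by rewrite bump_out// mulr0.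
  apply: cvg_EFin; first exact: nearW.
  by have := cvgM (cvg_cst (w x)) (bump_cvg xab); rewrite mulr1; apply.
- exact: integrable_abse.
- apply: aeW => x k _ /=; rewrite lee_fin normrM.
  have /andP[h1 h2] := bump_bound a b x (k0 k).
  by rewrite [X in _ * X]ger0_norm// ler_piMr.
- move=> _ _; rewrite -integral_mkcondr setIC (setIidl abO') => h.
  apply: (cvg_unique _ h) => //.
  rewrite (_ : (fun k => _) = cst 0%E); first exact: cvg_cst.
  apply/funext => k /=.
  have iwk := sqintM mOm Sw (test_sqint oOm OmB (tb k)).
  rewrite -(@fineK _ (integral _ _ _)); last exact: (integrable_fin_num mOm iwk).
  by have := w0 (tb k); rewrite /ip /Rintegral => ->.
Qed.

(** From boxes to measurable sets by Dynkin's lemma; staying in a fixed box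
    contained in Om keeps the class stable under complement. *)
Lemma integral_ratbox0 p (A : set 'rV[R]_n) : rat_cbox p `<=` Om -> measurable A ->
  (\int[mu]_(x in rat_box p `&` A) (w x)%:E = 0)%E.
Proof.
move=> pO mA; have mp : measurable (rat_box p : set 'rV[R]_n) by exact: measurable_open_box.
have pO' : rat_box p `<=` Om.
  exact: subset_trans (@open_boxS _ _ _ _) pO.
have iwp (C : set 'rV[R]_n) : measurable C -> C `<=` rat_box p -> mu.-integrable C (EFin \o w).
  by move=> mC Cp; apply: integrableS iw => //; exact: subset_trans pO'.
have PT : (\int[mu]_(x in rat_box p) (w x)%:E = 0)%E by exact: integral_box0.
pose P (A : set 'rV[R]_n) := (\int[mu]_(x in rat_box p `&` A) (w x)%:E = 0)%E.
apply: (@dynkin_induction _ _ (@boxes R n) P (@measurable_rVE R n) (@boxes_setI R n)).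
- by rewrite /P setIT.
- move=> _ [a [b ->]]; rewrite /P /rat_box open_boxI; apply: integral_box0.
  move=> x h; apply: pO => i; have := h i; rewrite !mxE ge_max le_min.
  by move=> /andP[/andP[-> _] /andP[-> _]].
- move=> S mS PS; rewrite /P.
  have : (\int[mu]_(x in rat_box p `&` S `|` rat_box p `&` ~` S) (w x)%:E = 0)%E.
    by rewrite -setIUr setUv setIT.
  rewrite integral_setU_EFin//.
  + by rewrite [X in (X + _)%E]PS add0e.
  + exact: measurableI.
  + by apply: measurableI => //; exact: measurableC.
  + rewrite -setIUr setUv setIT; apply/measurable_EFinP.
    exact: measurable_int (iwp _ mp (@subset_refl _ _)).
  + by apply/disj_setPS => x [[_ Sx] [_ nSx]].
- move=> F mF tF PF; rewrite /P setI_bigcupr integral_bigcup//.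
  + by rewrite eseries0// => k _ _; exact: PF.
  + exact: trivIset_setIl.
  + by move=> k; exact: measurableI.
  + apply: iwp; last by rewrite -setI_bigcupr; exact: subIsetl.
    by apply: bigcupT_measurable => k; exact: measurableI.
- by rewrite -measurable_rVE.
Qed.

(** (du Bois-Reymond) On each of the countably many rational boxes that cover Om,
    the integral of w over any measurable subset is 0. *)
Lemma fundamental_lemma : ae_eq_on Om w (cst 0).
Proof.
have hp p : rat_cbox p `<=` Om -> ae_eq_on (rat_box p) w (cst 0).
  move=> pO; have mp : measurable (rat_box p : set 'rV[R]_n) by exact: measurable_open_box.
  have pO' : rat_box p `<=` Om.
    exact: subset_trans (@open_boxS _ _ _ _) pO.
  have : ae_eq mu (rat_box p) (EFin \o w) (cst 0%E).
    apply: integral_ae_eq => //.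
    - by apply: integrableS iw.
    - move=> E Ep mE; rewrite integral0.
      by have := integral_ratbox0 pO mE; rewrite (setIidr Ep).
  by apply: filterS => x h /h[].
(* Null sets indexed by codes of boxes, as negligible sets are closed under
   unions over nat. *)
pose Q k : set 'rV[R]_n := if unpickle k is Some p then
  (if `[< rat_cbox p `<=` Om >] then [set x | ~ (rat_box p x -> w x = 0)] else set0) else set0.
have : mu.-negligible (\bigcup_k Q k).
  apply: negligible_bigcup => k; rewrite /Q.
  case: unpickle => [p|]; last exact: negligible_set0.
  by case: asboolP => [/hp//|_]; exact: negligible_set0.
apply: negligibleS => x /= /not_implyP[Ox wx].
have [p px pO] := open_rat_box oOm Ox.
exists (pickle p) => //; rewrite /Q pickleK; case: asboolP => //= _.
by move=> /(_ px).
Qed.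

End orthogonal_to_tests.

End fundamental_lemma.

(** * Weak derivatives *)

Section weak_derivatives.
Context (R : realType) (n : nat) (Om : set 'rV[R]_n) (B : R).
Hypotheses (oOm : open Om) (OmB : Om `<=` cube B).
Implicit Types (u v w z f g phi psi : 'rV[R]_n -> R) (i j : 'I_n) (s t : seq 'I_n).

Local Notation mu := (lebesgue_rV R n).
Local Notation test := (test_function Om).
Local Notation ip := (ip mu Om).
Local Notation sqint := (square_integrable mu Om).
Local Notation wd := (is_weak_deriv Om).

Let mOm : measurable Om. Proof. exact: open_measurable_rV. Qed.
Let Sip := semi_inner_ip mu mOm.

Lemma L2E u : L2 Om u <-> sqint u.
Proof.
split.
  rewrite /L2 => Lu; have iu := Lfun2_integrable_sqr Lu.
  move: Lu; rewrite inE => /andP[]; rewrite inE/= => mu_ _; split.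
    by have := (measurable_restrict u mOm measurableT).2 mu_; rewrite setTI.
  apply/(integrable_mkcond _ mOm); apply: eq_integrable iu => // x _ /=.
  by rewrite /patch; case: ifPn => //=; rewrite expr0n.
move=> [mu_ /(integrable_mkcond _ mOm)/integrableP[_ iu]].
have mr : measurable_fun setT (u \_ Om) 
  by apply: (measurable_restrict u mOm measurableT).1; rewrite setTI.
rewrite /L2 inE; apply/andP; split; rewrite inE//=.
rewrite /finite_norm unlock poweR_lty//; apply: le_lt_trans iu.
rewrite le_eqVlt; apply/orP; left; apply/eqP; apply: eq_integral => x _ /=.
rewrite /patch; case: ifPn => _ /=.
  by rewrite powR_mulrn// real_normK ?num_real// ger0_norm// sqr_ge0.
by rewrite !normr0 powR_mulrn// expr0n.
Qed.

Lemma wd_sqint s u w : wd s u w -> sqint w.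
Proof. by case=> /L2E. Qed.

Lemma wdP s u w : sqint w ->
  (forall phi, test phi -> ip u (pderiv s phi) = (-1) ^+ size s * ip w phi) ->
  wd s u w.
Proof. by move=> /L2E. Qed.

Lemma wd_ip s u w phi : wd s u w -> test phi ->
  ip u (pderiv s phi) = (-1) ^+ size s * ip w phi.
Proof. by move=> [_]; apply. Qed.

Lemma sqint_test_pderiv s phi : test phi -> sqint (pderiv s phi).
Proof. by move=> tphi; apply: test_sqint oOm OmB _ _; exact: test_pderiv. Qed.

Lemma wd_unique s u w w' : wd s u w -> wd s u w' -> ae_eq_on Om w w'.
Proof.
move=> ww ww'; have Sw := wd_sqint ww; have Sw' := wd_sqint ww'.
have h : ae_eq_on Om (w - w') (cst 0).
  apply: (fundamental_lemma oOm OmB); first exact: (si_subB Sip).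
  move=> phi tphi; rewrite (si_Bl Sip Sw Sw' (test_sqint oOm OmB tphi)).
  apply/eqP; rewrite subr_eq0; apply/eqP.
  apply: (@mulfI _ ((-1) ^+ size s)); first by rewrite signr_eq0.
  by rewrite -(wd_ip ww tphi) -(wd_ip ww' tphi).
by apply: filterS h => x hx Ox; move/eqP: (hx Ox); rewrite subr_eq0 => /eqP.
Qed.

Lemma wd_comb c s u v w z : sqint u -> sqint v -> wd s u w -> wd s v z ->
  wd s (c *: u + v) (c *: w + z).
Proof.
move=> Su Sv uw vz; have Sw := wd_sqint uw; have Sz := wd_sqint vz.
apply: wdP; first exact: (si_comb Sip).
move=> phi tphi; have Ss := sqint_test_pderiv s tphi.
have S1 := test_sqint oOm OmB tphi.
rewrite (si_lin Sip c Su Sv Ss) (si_lin Sip c Sw Sz S1).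
by rewrite (wd_ip uw tphi) (wd_ip vz tphi) mulrDr mulrCA.
Qed.

Lemma wd_ael s u u' w : sqint u -> sqint u' -> ae_eq_on Om u u' -> wd s u w -> wd s u' w.
Proof.
move=> Su Su' uu' uw; apply: wdP; first exact: wd_sqint uw.
move=> phi tphi; rewrite -(wd_ip uw tphi); apply/esym.
by apply: ip_ae => //; exact: sqint_test_pderiv.
Qed.

Lemma wd_nil u : sqint u -> wd [::] u u.
Proof. by move=> Su; apply: wdP => // phi _; rewrite expr0 mul1r. Qed.

Lemma wd_cat s t u w z : wd s u w -> wd t w z -> wd (s ++ t) u z.
Proof.
move=> uw wz; apply: wdP; first exact: wd_sqint wz.
move=> phi tphi; rewrite -pderiv_cat (wd_ip uw (test_pderiv t tphi)).
by rewrite (wd_ip wz tphi) size_cat exprD mulrA.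
Qed.

(** Test the derivative of u along s against the derivatives of test functions
    along t. *)
Lemma wd_cat_inv s t u w z : wd s u w -> wd (s ++ t) u z -> wd t w z.
Proof.
move=> uw uz; apply: wdP; first exact: wd_sqint uz.
move=> phi tphi; apply: (@mulfI _ ((-1) ^+ size s)); first by rewrite signr_eq0.
rewrite -(wd_ip uw (test_pderiv t tphi)) pderiv_cat (wd_ip uz tphi).
by rewrite size_cat exprD mulrA.
Qed.

(** Weak derivatives compose from the head of the list ([wd_cat]), classical ones
    from its end; [wd_test] reconciles the two orders. *)
Lemma pderiv_rcons s i phi : test phi -> pderiv (s ++ [:: i]) phi = pderiv (i :: s) phi.
Proof.
move=> tphi; elim: s => [//|j s IH].
rewrite -[LHS]/(pderiv [:: j] (pderiv (s ++ [:: i]) phi)) IH.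
exact: (pderiv_swap oOm OmB j i (test_pderiv s tphi)).
Qed.

Lemma wd_test s phi : test phi -> wd s phi (pderiv s phi).
Proof.
elim: s phi => [|i s IH] phi tphi; first exact: wd_nil (test_sqint oOm OmB tphi).
have E : pderiv (i :: s) phi = pderiv s (pderiv [:: i] phi).
  by rewrite pderiv_cat pderiv_rcons.
rewrite E -cat1s; apply: (@wd_cat _ _ _ (pderiv [:: i] phi)).
  apply: wdP; first exact: sqint_test_pderiv.
  move=> psi tpsi; rewrite expr1 mulN1r (test_parts OmB i tphi tpsi).
  by rewrite opprK.
by apply: IH; exact: test_pderiv1.
Qed.

(** Both sides of the defining identity are continuous in mean square. *)
Lemma wd_cvg s (u : nat -> 'rV[R]_n -> R) (w : nat -> 'rV[R]_n -> R) u0 w0 :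
  (forall k, sqint (u k)) -> sqint u0 -> sqint w0 -> (forall k, wd s (u k) (w k)) ->
  (fun k => ip (u k - u0) (u k - u0)) @ \oo --> 0 ->
  (fun k => ip (w k - w0) (w k - w0)) @ \oo --> 0 -> wd s u0 w0.
Proof.
move=> Su Su0 Sw0 uw cu cw; apply: wdP => // phi tphi.
have Sw k := wd_sqint (uw k).
have h1 := si_cvgr Sip Su Su0 (sqint_test_pderiv s tphi) cu.
have h2 := si_cvgr Sip Sw Sw0 (test_sqint oOm OmB tphi) cw.
apply: (cvg_unique _ h1) => //.
rewrite (_ : (fun k => _) = (fun k => (-1) ^+ size s * ip (w k) phi)).
  exact: (cvgM (cvg_cst _) h2).
by apply/funext => k; exact: wd_ip.
Qed.

Lemma wderiv_sqint s u : sqint (wderiv Om s u).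
Proof.
rewrite /wderiv; case: xgetP => [w _ /wd_sqint//|_]; exact: (sqint_cst oOm OmB 0).
Qed.

Lemma wderiv_wd s u w : wd s u w -> wd s u (wderiv Om s u).
Proof. by move=> uw; apply: (@xgetPex _ _ [set w | wd s u w]); exists w. Qed.

Lemma wderivE s u w : wd s u w -> ae_eq_on Om (wderiv Om s u) w.
Proof. by move=> uw; apply: wd_unique (wderiv_wd uw) uw. Qed.

Lemma ae_eq_on_sym u w : ae_eq_on Om u w -> ae_eq_on Om w u.
Proof. by apply: filterS => x hx Ox; rewrite hx. Qed.

Lemma ae_eq_on_trans u v w : ae_eq_on Om u v -> ae_eq_on Om v w -> ae_eq_on Om u w.
Proof. by apply: filterS2 => x h1 h2 Ox; rewrite (h1 Ox) (h2 Ox). Qed.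

Lemma ae_eq_on_comb c u u' w w' : ae_eq_on Om u u' -> ae_eq_on Om w w' ->
  ae_eq_on Om (c *: u + w) (c *: u' + w').
Proof.
apply: filterS2 => x h1 h2 Ox.
by rewrite -[LHS]/(c * u x + w x) (h1 Ox) (h2 Ox).
Qed.

Lemma ae_eq_on_sum (I : Type) (r : seq I) (f g : I -> 'rV[R]_n -> R) :
  (forall k, ae_eq_on Om (f k) (g k)) ->
  ae_eq_on Om (\sum_(k <- r) f k) (\sum_(k <- r) g k).
Proof.
move=> fg; elim: r => [|k r IH]; first by rewrite !big_nil; apply: aeW.
rewrite !big_cons -[f k]scale1r -[g k]scale1r.
exact: ae_eq_on_comb.
Qed.

(** An equality of functions, since u and u' have the same weak derivatives and
    [wderiv] picks one by a choice depending on that set only. *)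
Lemma wderiv_ae s u u' : sqint u -> sqint u' -> ae_eq_on Om u u' ->
  wderiv Om s u = wderiv Om s u'.
Proof.
move=> Su Su' uu'; rewrite /wderiv; congr (xget _ _).
by apply/seteqP; split => w /=; apply: wd_ael => //; exact: ae_eq_on_sym.
Qed.

Lemma sobolev_sqint m u : sobolev Om m u -> sqint u.
Proof. by case=> /L2E. Qed.

Lemma sobolev_wd m u s : sobolev Om m u -> (size s <= m)%N -> wd s u (wderiv Om s u).
Proof. by move=> [_ h] /h[w uw]; exact: wderiv_wd uw. Qed.

Lemma sobolevP m u : sqint u ->
  (forall s, (size s <= m)%N -> exists w, wd s u w) -> sobolev Om m u.
Proof. by move=> /L2E. Qed.

Lemma sobolevW m m' u : (m <= m')%N -> sobolev Om m' u -> sobolev Om m u.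
Proof. by move=> mm' [Su h]; split => // s sm; apply: h; exact: leq_trans mm'. Qed.

Lemma sobolev_comb m c u v : sobolev Om m u -> sobolev Om m v -> sobolev Om m (c *: u + v).
Proof.
move=> hu hv; have Su := sobolev_sqint hu; have Sv := sobolev_sqint hv.
apply: sobolevP; first exact: (si_comb Sip).
move=> s sm; exists (c *: wderiv Om s u + wderiv Om s v).
by apply: wd_comb => //; exact: sobolev_wd sm.
Qed.

Lemma sobolev_test m phi : test phi -> sobolev Om m phi.
Proof.
move=> tphi; apply: sobolevP; first exact: (test_sqint oOm OmB tphi).
by move=> s _; exists (pderiv s phi); exact: wd_test.
Qed.

Lemma sobolev_0 m : sobolev Om m 0.
Proof. by apply: sobolev_test; exact: test0. Qed.

Lemma sobolev_sum m (I : Type) (r : seq I) (F : I -> 'rV[R]_n -> R) :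
  (forall k, sobolev Om m (F k)) -> sobolev Om m (\sum_(k <- r) F k).
Proof.
move=> hF; elim/big_ind : _ => //; first exact: sobolev_0.
by move=> u v hu hv; rewrite -[u]scale1r; exact: sobolev_comb.
Qed.

Lemma wderiv_comb m s c u v : sobolev Om m u -> sobolev Om m v -> (size s <= m)%N ->
  ae_eq_on Om (wderiv Om s (c *: u + v)) (c *: wderiv Om s u + wderiv Om s v).
Proof.
move=> hu hv sm; apply: wderivE; apply: wd_comb.
- exact: sobolev_sqint hu.
- exact: sobolev_sqint hv.
- exact: sobolev_wd sm.
- exact: sobolev_wd sm.
Qed.

Lemma wderiv_cat m s t u : sobolev Om m u -> (size s + size t <= m)%N ->
  wd t (wderiv Om s u) (wderiv Om (s ++ t) u).
Proof.
move=> hu st; apply: (@wd_cat_inv s).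
  by apply: (sobolev_wd hu); apply: leq_trans st; exact: leq_addr.
by apply: (sobolev_wd hu); rewrite size_cat.
Qed.

Lemma sobolev_wderiv m k s u : sobolev Om m u -> (size s + k <= m)%N ->
  sobolev Om k (wderiv Om s u).
Proof.
move=> hu sk; apply: sobolevP; first exact: wderiv_sqint.
move=> t tk; exists (wderiv Om (s ++ t) u); apply: wderiv_cat hu _.
by apply: leq_trans sk; rewrite leq_add2l.
Qed.

End weak_derivatives.

(** * The Sobolev form and the polyharmonic form *)

Lemma cvg0_sum (R : realType) (I : Type) (r : seq I) (f : I -> nat -> R) :
  (forall i, f i k @[k --> \oo] --> 0) ->
  \sum_(i <- r) f i k @[k --> \oo] --> 0.
Proof.
move=> h; elim: r => [|i r IH].
  by under eq_fun do rewrite big_nil; exact: cvg_cst.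
under eq_fun do rewrite big_cons.
by have := cvgD (h i) IH; rewrite addr0; apply.
Qed.

Lemma size_index_ord (k : nat) : size (index_enum 'I_k) = k.
Proof. by rewrite -sum1_size sum1_card card_ord. Qed.

Section sobolev_forms.
Context (R : realType) (n : nat) (Om : set 'rV[R]_n) (B : R).
Hypotheses (oOm : open Om) (OmB : Om `<=` cube B).
Implicit Types (u v w z f g phi psi : 'rV[R]_n -> R) (i j : 'I_n) (s t : seq 'I_n).

Local Notation mu := (lebesgue_rV R n).
Local Notation ip := (ip mu Om).
Local Notation sqint := (square_integrable mu Om).
Local Notation wlap := (wlaplacian Om).
Local Notation D := (wderiv Om).

Let mOm : measurable Om. Proof. exact: open_measurable_rV. Qed.
Let Sip := semi_inner_ip mu mOm.

Lemma ip_aer w u u' : sqint u -> sqint u' -> sqint w -> ae_eq_on Om u u' -> ip w u = ip w u'.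
Proof. by move=> Su Su' Sw uu'; rewrite ipC (ip_ae mOm Su Su' Sw uu') ipC. Qed.

Lemma ip_ae2 u u' : sqint u -> sqint u' -> ae_eq_on Om u u' -> ip u u = ip u' u'.
Proof. by move=> Su Su' uu'; rewrite (ip_ae mOm Su Su' Su uu') (ip_aer Su Su' Su' uu'). Qed.

Lemma semi_inner_op (S : set ('rV[R]_n -> R)) (T : ('rV[R]_n -> R) -> 'rV[R]_n -> R) :
  S 0 -> (forall c u v, S u -> S v -> S (c *: u + v)) ->
  (forall u, S u -> sqint (T u)) ->
  (forall c u v, S u -> S v -> ae_eq_on Om (T (c *: u + v)) (c *: T u + T v)) ->
  semi_inner S (fun u w => ip (T u) (T w)).
Proof.
move=> S0 Sc ST Tl; split => //.
- move=> c u v w Su Sv Sw.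
  rewrite (ip_ae mOm (ST _ (Sc c _ _ Su Sv)) (si_comb Sip c (ST _ Su) (ST _ Sv)) (ST _ Sw) (Tl c _ _ Su Sv)).
  exact: (si_lin Sip c (ST _ Su) (ST _ Sv) (ST _ Sw)).
- by move=> u v _ _; rewrite ipC.
- by move=> u _; exact: ip_ge0.
Qed.

Definition hform m u w : R :=
  \sum_(j < m.+1) \sum_(s : j.-tuple 'I_n) ip (D s u) (D s w).

Lemma hformE m u w : hform m u w =
  \sum_(j < m.+1) \sum_(s : j.-tuple 'I_n)
    ip (D s u) (D s w).
Proof. by []. Qed.

Lemma sobolev_normE m u : sobolev_norm Om m u = Num.sqrt (hform m u u).
Proof. by []. Qed.

Lemma semi_inner_D m s : (size s <= m)%N ->
  semi_inner (sobolev Om m) (fun u w => ip (D s u) (D s w)).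
Proof.
move=> sm; apply: semi_inner_op.
- exact: (sobolev_0 oOm OmB).
- by move=> c u v; exact: (sobolev_comb oOm OmB).
- by move=> u _; exact: (wderiv_sqint oOm OmB).
- by move=> c u v hu hv; exact: (wderiv_comb oOm OmB c hu hv sm).
Qed.

Lemma semi_inner_hform m : semi_inner (sobolev Om m) (hform m).
Proof.
have S0 := sobolev_0 oOm OmB m.
have Sc := fun c u v => @sobolev_comb R n Om B oOm OmB m c u v.
apply: (@semi_inner_sum _ _ _ _ (index_enum _)
  (fun (j : 'I_m.+1) u w => \sum_(s : j.-tuple 'I_n) ip (D s u) (D s w)) S0 Sc) => j.
apply: (@semi_inner_sum _ _ _ _ (index_enum _)
  (fun (s : j.-tuple 'I_n) u w => ip (D s u) (D s w)) S0 Sc) => s.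
by apply: semi_inner_D; rewrite size_tuple -ltnS.
Qed.

Lemma hform_ge0 m u : 0 <= hform m u u.
Proof. by apply: sumr_ge0 => j _; apply: sumr_ge0 => s _; exact: ip_ge0. Qed.

Lemma le_hform m u s : (size s <= m)%N -> ip (D s u) (D s u) <= hform m u u.
Proof.
move=> sm; have sm' : (size s < m.+1)%N by [].
rewrite /hform (bigD1 (Ordinal sm'))//= (bigD1 (in_tuple s))//= -!addrA lerDl.
rewrite addr_ge0//; first by apply: sumr_ge0 => t _; exact: ip_ge0.
by apply: sumr_ge0 => j _; apply: sumr_ge0 => t _; exact: ip_ge0.
Qed.

Definition hcount (m : nat) : R := \sum_(j < m.+1) \sum_(s : j.-tuple 'I_n) 1.

Lemma hcount_ge0 m : 0 <= hcount m.
Proof. by apply: sumr_ge0 => j _; apply: sumr_ge0. Qed.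

Lemma hform_le m u M : (forall s, (size s <= m)%N -> ip (D s u) (D s u) <= M) ->
  hform m u u <= hcount m * M.
Proof.
move=> h; rewrite /hcount mulr_suml; apply: ler_sum => j _.
rewrite mulr_suml; apply: ler_sum => s _; rewrite mul1r; apply: h.
by rewrite size_tuple -ltnS.
Qed.

Lemma hform_ae m u u' : sqint u -> sqint u' -> ae_eq_on Om u u' ->
  hform m u u = hform m u' u'.
Proof.
move=> Su Su' uu'; apply: eq_bigr => j _; apply: eq_bigr => s _.
by rewrite (wderiv_ae oOm OmB s Su Su' uu').
Qed.

Lemma hform_wderiv m u s : sobolev Om (size s + m) u ->
  hform m (D s u) (D s u) <= hcount m * hform (size s + m) u u.
Proof.
move=> hu; apply: hform_le => t tm.
have st : (size s + size t <= size s + m)%N by rewrite leq_add2l.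
have h := wderivE oOm OmB (wderiv_cat oOm hu st).
rewrite (ip_ae2 _ _ h); try exact: (wderiv_sqint oOm OmB).
by apply: le_hform; rewrite size_cat.
Qed.

Lemma wlapE u : wlap u = \sum_(i < n) D [:: i; i] u.
Proof. by apply/funext => x; rewrite fct_sumE. Qed.

Lemma wlap_sqint u : sqint (wlap u).
Proof.
rewrite wlapE; elim/big_ind : _ => [|f g Sf Sg|i _].
- exact: (si_0 Sip).
- by rewrite -[f]scale1r; exact: (si_comb Sip).
- exact: (wderiv_sqint oOm OmB).
Qed.

Lemma sobolev_wlap m u : sobolev Om m.+2 u -> sobolev Om m (wlap u).
Proof.
move=> hu; rewrite wlapE; apply: (sobolev_sum oOm OmB) => i.
exact: (sobolev_wderiv oOm OmB hu).
Qed.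

Lemma wlap_comb c u v : sobolev Om 2 u -> sobolev Om 2 v ->
  ae_eq_on Om (wlap (c *: u + v)) (c *: wlap u + wlap v).
Proof.
move=> hu hv; rewrite !wlapE.
have -> : c *: \sum_(i < n) D [:: i; i] u + \sum_(i < n) D [:: i; i] v =
    \sum_(i < n) (c *: D [:: i; i] u + D [:: i; i] v).
  by rewrite scaler_sumr -big_split.
by apply: ae_eq_on_sum => i; exact: (wderiv_comb oOm OmB c hu hv).
Qed.

Lemma wlap_ae u u' : sqint u -> sqint u' -> ae_eq_on Om u u' -> wlap u = wlap u'.
Proof.
move=> Su Su' uu'; rewrite !wlapE; apply: eq_bigr => i _.
exact: (wderiv_ae oOm OmB _ Su Su' uu').
Qed.

Lemma inner0 u w : inner Om 0 u w = ip u w.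
Proof. by []. Qed.

Lemma Rintegral_ip_sum (I : Type) (r : seq I) (f g : I -> 'rV[R]_n -> R) :
  (forall k, sqint (f k)) -> (forall k, sqint (g k)) ->
  \int[mu]_(x in Om) (\sum_(k <- r) f k x * g k x) = \sum_(k <- r) ip (f k) (g k).
Proof.
move=> Sf Sg.
have : mu.-integrable Om (EFin \o (fun x => \sum_(k <- r) f k x * g k x)) /\
  \int[mu]_(x in Om) (\sum_(k <- r) f k x * g k x) = \sum_(k <- r) ip (f k) (g k).
  elim: r => [|k r [IH1 IH2]].
    rewrite big_nil; split.
      by apply: eq_integrable (integrable0 _ _) => // x _ /=; rewrite big_nil.
    under eq_Rintegral do rewrite big_nil.
    by rewrite Rintegral_cst// mul0r.
  have i1 := sqintM mOm (Sf k) (Sg k).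
  split.
    apply: eq_integrable (integrableD mOm i1 IH1) => // x _ /=.
    by rewrite big_cons.
  under eq_Rintegral do rewrite big_cons.
  by rewrite RintegralD// IH2 big_cons.
by case.
Qed.

Lemma inner1 u w : inner Om 1 u w = \sum_(i < n) ip (D [:: i] u) (D [:: i] w).
Proof. by apply: Rintegral_ip_sum => i; exact: (wderiv_sqint oOm OmB). Qed.

Lemma innerSS m u w : inner Om m.+2 u w = inner Om m (wlap u) (wlap w).
Proof. by rewrite /inner /= negbK -!iterSr. Qed.

(** The form [inner] gains a Laplacian every second order. *)
Lemma nat_ind2 (P : nat -> Prop) : P 0%N -> P 1%N ->
  (forall m, P m -> P m.+2) -> forall m, P m.
Proof.
move=> P0 P1 PS m; suff : P m /\ P m.+1 by case.
by elim: m => // m [Pm Pm1]; split => //; exact: PS.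
Qed.

Lemma innerC m u w : inner Om m u w = inner Om m w u.
Proof.
elim/nat_ind2 : m u w => [u w|u w|m IH u w].
- by rewrite !inner0 ipC.
- by rewrite !inner1; apply: eq_bigr => i _; rewrite ipC.
- by rewrite !innerSS.
Qed.

Lemma inner_ael m u u' w : sqint u -> sqint u' -> sqint w -> ae_eq_on Om u u' ->
  inner Om m u w = inner Om m u' w.
Proof.
move=> Su Su' Sw uu'; case: m => [|[|m]].
- exact: ip_ae.
- by rewrite !inner1; apply: eq_bigr => i _; rewrite (wderiv_ae oOm OmB _ Su Su' uu').
- by rewrite !innerSS (wlap_ae Su Su' uu').
Qed.

Lemma inner_aer m u u' w : sqint u -> sqint u' -> sqint w -> ae_eq_on Om u u' ->
  inner Om m w u = inner Om m w u'.
Proof. by move=> Su Su' Sw uu'; rewrite innerC (inner_ael m Su Su' Sw uu') innerC. Qed.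

Lemma semi_inner_inner m : semi_inner (sobolev Om m) (inner Om m).
Proof.
elim/nat_ind2 : m => [||m IH].
- split.
  + exact: (sobolev_0 oOm OmB).
  + by move=> c u v; exact: (sobolev_comb oOm OmB).
  + move=> c u v w hu hv hw.
    exact: (si_lin Sip c (sobolev_sqint oOm hu) (sobolev_sqint oOm hv) (sobolev_sqint oOm hw)).
  + by move=> u v _ _; exact: innerC.
  + by move=> u _; exact: ip_ge0.
- have S0 := sobolev_0 oOm OmB 1.
  have Sc := fun c u v => @sobolev_comb R n Om B oOm OmB 1 c u v.
  rewrite (_ : inner Om 1 = (fun u w => \sum_(i < n) ip (D [:: i] u) (D [:: i] w))).
    apply: (@semi_inner_sum _ _ _ _ (index_enum _)
  (fun (i : 'I_n) u w => ip (D [:: i] u) (D [:: i] w)) S0 Sc) => i.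
    exact: semi_inner_D.
  by apply/funext => u; apply/funext => w; exact: inner1.
- split.
  + exact: (sobolev_0 oOm OmB).
  + by move=> c u v; exact: (sobolev_comb oOm OmB).
  + move=> c u v w hu hv hw; rewrite !innerSS.
    have h2 z : sobolev Om m.+2 z -> sobolev Om 2 z by exact: sobolevW.
    rewrite (inner_ael m (wlap_sqint _) _ (wlap_sqint _) (wlap_comb c (h2 _ hu) (h2 _ hv))).
      by apply: (si_lin IH); exact: sobolev_wlap.
    by apply: (si_comb Sip); exact: wlap_sqint.
  + by move=> u v _ _; exact: innerC.
  + by move=> u hu; rewrite innerSS; apply: (si_ge0 IH); exact: sobolev_wlap.
Qed.

Lemma hform_wlap m u : sobolev Om m.+2 u ->
  hform m (wlap u) (wlap u) <= n%:R ^+ 2 * (hcount m * hform m.+2 u u).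
Proof.
move=> hu; rewrite wlapE.
have := @si_sum_bound R _ (sobolev Om m) (hform m) 'I_n (index_enum 'I_n)
  (fun i => D [:: i; i] u) (hcount m * hform m.+2 u u) (semi_inner_hform m).
rewrite size_index_ord; apply.
- by rewrite mulr_ge0 ?hcount_ge0 ?hform_ge0.
- by move=> i; exact: (sobolev_wderiv oOm OmB hu).
- by move=> i; exact: (@hform_wderiv m u [:: i; i] hu).
Qed.

Lemma inner_le_hform m : exists2 C, 0 <= C &
  forall u, sobolev Om m u -> inner Om m u u <= C * hform m u u.
Proof.
elim/nat_ind2 : m => [||m [C C0 hC]].
- exists 1 => // u hu; rewrite mul1r inner0.
  have Su := sobolev_sqint oOm hu.
  have h := wderivE oOm OmB (wd_nil oOm Su).
  rewrite -(ip_ae2 (wderiv_sqint oOm OmB [::] u) Su h).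
  exact: le_hform.
- exists n%:R => // u hu; rewrite inner1.
  apply: (@le_trans _ _ (\sum_(i < n) hform 1 u u)).
    by apply: ler_sum => i _; exact: le_hform.
  by rewrite sumr_const card_ord mulr_natl.
- exists (C * (n%:R ^+ 2 * hcount m)).
    by rewrite !mulr_ge0 ?hcount_ge0.
  move=> u hu; rewrite innerSS; apply: le_trans (hC _ (sobolev_wlap hu)) _.
  rewrite -[C * _ * _]mulrA -[n%:R ^+ 2 * _ * _]mulrA ler_wpM2l//; exact: hform_wlap.
Qed.

End sobolev_forms.

(** * Equivalence of the two forms on limits of test functions *)

Lemma term_le_double_sum (R : realType) (n : nat) (F : 'I_n -> 'I_n -> R) i j :
  (forall k l, 0 <= F k l) -> F i j <= \sum_(l < n) \sum_(k < n) F k l.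
Proof.
move=> F0; rewrite (bigD1 j)//= (bigD1 i)//= -!addrA lerDl addr_ge0//.
  by apply: sumr_ge0 => k _; exact: F0.
by apply: sumr_ge0 => l _; apply: sumr_ge0 => k _; exact: F0.
Qed.

Lemma approx_le (R : realType) (c1 c2 e x1 x2 x3 x4 x5 x6 : R) : 0 <= c1 ->
  x5 <= x1 + x3 -> x3 <= c1 * x4 -> x4 <= x2 + x6 -> x2 <= c2 * x1 ->
  x1 * (1 + c1 * c2) <= e -> x5 <= c1 * x6 + e.
Proof.
move=> c10 a1 a2 a3 a4 h.
have b1 := ler_wpM2l c10 a3; have b2 := ler_wpM2l c10 a4.
have E : c1 * (c2 * x1) = x1 * (c1 * c2) by ring.
rewrite E in b2; lra.
Qed.

(* Unfolding these during unification is costly and never useful below. *)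
Local Opaque ip.

Section elliptic.
Context (R : realType) (n : nat) (Om : set 'rV[R]_n) (B : R).
Hypotheses (oOm : open Om) (OmB : Om `<=` cube B).
Implicit Types (u v w z f g phi psi chi : 'rV[R]_n -> R) (i j : 'I_n) (s t : seq 'I_n).

Local Notation mu := (lebesgue_rV R n).
Local Notation test := (test_function Om).
Local Notation ip := (ip mu Om).
Local Notation sqint := (square_integrable mu Om).
Local Notation wlap := (wlaplacian Om).
Local Notation D := (wderiv Om).

Let mOm : measurable Om. Proof. exact: open_measurable_rV. Qed.
Let Sip := semi_inner_ip mu mOm.

Definition lap phi : 'rV[R]_n -> R := \sum_(i < n) pderiv [:: i; i] phi.

Lemma test_lap phi : test phi -> test (lap phi).
Proof. by move=> tphi; apply: test_sum => i _; exact: test_pderiv. Qed.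

Lemma pderiv_sum s (I : Type) (r : seq I) (F : I -> 'rV[R]_n -> R) :
  (forall k, test (F k)) ->
  pderiv s (\sum_(k <- r) F k) = \sum_(k <- r) pderiv s (F k).
Proof.
move=> tF; elim: r => [|k r IH].
  rewrite !big_nil; elim: s => //= i s ->; apply/funext => x; exact: derive_cst.
rewrite !big_cons -[F k]scale1r (pderiv_comb s 1 (tF k)); last exact: test_sum.
by rewrite IH !scale1r.
Qed.

Lemma pderiv_cons i s f : pderiv [:: i] (pderiv s f) = pderiv (i :: s) f.
Proof. by []. Qed.

Lemma pderiv_nil f : pderiv [::] f = f.
Proof. by []. Qed.

Local Opaque pderiv.

Lemma pderiv_lap t phi : test phi -> pderiv t (lap phi) = lap (pderiv t phi).
Proof.
move=> tphi; rewrite pderiv_sum; last by move=> i; exact: test_pderiv.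
apply: eq_bigr => i _; rewrite !pderiv_cat.
rewrite -[t ++ _]/(t ++ ([:: i] ++ [:: i])) catA (pderiv_rcons oOm OmB _ _ tphi).
by rewrite -pderiv_cons (pderiv_rcons oOm OmB _ _ tphi) pderiv_cons.
Qed.

(** Integration by parts in direction i on the left and j on the right leads to
    the same integral, as the derivatives of chi commute. *)
Lemma ip_hessian i j chi : test chi ->
  ip (pderiv [:: i; j] chi) (pderiv [:: i; j] chi) =
  ip (pderiv [:: j; j] chi) (pderiv [:: i; i] chi).
Proof.
move=> tchi.
have tj := test_pderiv1 j tchi; have tij := test_pderiv [:: i; j] tchi.
have tii := test_pderiv [:: i; i] tchi.
have e1 := test_parts OmB i tj tij; have e2 := test_parts OmB j tj tii.
rewrite !pderiv_cons in e1; rewrite !pderiv_cons in e2.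
have E : pderiv [:: i; i; j] chi = pderiv [:: j; i; i] chi.
  exact: (pderiv_rcons oOm OmB [:: i; i] j tchi).
exact: (etrans e1 (etrans (congr1 (fun z => - ip (pderiv [:: j] chi) z) E) (esym e2))).
Qed.

Lemma ip_suml (I : Type) (r : seq I) (F : I -> 'rV[R]_n -> R) g :
  (forall k, sqint (F k)) -> sqint g ->
  ip (\sum_(k <- r) F k) g = \sum_(k <- r) ip (F k) g.
Proof.
move=> SF Sg.
have : sqint (\sum_(k <- r) F k) /\ ip (\sum_(k <- r) F k) g = \sum_(k <- r) ip (F k) g.
  elim: r => [|k r [IH1 IH2]].
    rewrite !big_nil; split; first exact: (si_0 Sip).
    have := si_lin Sip 1 (si_0 Sip) (si_0 Sip) Sg; rewrite scale1r addr0; lra.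
  rewrite !big_cons -[F k]scale1r; split; first exact: (si_comb Sip).
  by rewrite (si_lin Sip 1 (SF k) IH1 Sg) IH2 scale1r mul1r.
by case.
Qed.

(** By [ip_hessian] the squared norm of the Laplacian is the sum of the squared
    norms of all second derivatives. *)
Lemma hessian_le_lap i j chi : test chi ->
  ip (pderiv [:: i; j] chi) (pderiv [:: i; j] chi) <= ip (lap chi) (lap chi).
Proof.
move=> tchi.
have S2 k l : sqint (pderiv [:: k; l] chi) by exact: (sqint_test_pderiv oOm OmB).
have SL : sqint (lap chi) by apply: (test_sqint oOm OmB); exact: test_lap.
have E g : sqint g -> ip (lap chi) g = \sum_(k < n) ip (pderiv [:: k; k] chi) g.
  by move=> Sg; exact: (ip_suml _ (fun k => S2 k k) Sg).
have E2 l : ip (pderiv [:: l; l] chi) (lap chi) =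
    \sum_(k < n) ip (pderiv [:: k; l] chi) (pderiv [:: k; l] chi).
  apply: etrans (ipC _ _ _ _) _; apply: etrans (E _ (S2 l l)) _; apply: eq_bigr => k _.
  have H := ip_hessian k l tchi.
  have H' := ipC mu Om (pderiv [:: k; k] chi) (pderiv [:: l; l] chi).
  exact: (etrans H' (esym H)).
rewrite (E _ SL) (eq_bigr _ (fun l _ => E2 l)).
apply: (@term_le_double_sum _ _ (fun k l => ip (pderiv [:: k; l] chi) (pderiv [:: k; l] chi))).
by move=> k l; exact: ip_ge0.
Qed.

Hypothesis n0 : (0 < n)%N.

Let K : R := (2 * B) ^+ 2.

Let i0 : 'I_n := Ordinal n0.

Lemma grad_le_lap j chi : test chi ->
  ip (pderiv [:: j] chi) (pderiv [:: j] chi) <= K * ip (lap chi) (lap chi).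
Proof.
move=> tchi; apply: le_trans (poincare oOm OmB i0 (test_pderiv1 j tchi)) _.
by rewrite ler_wpM2l ?sqr_ge0//; exact: (hessian_le_lap i0 j tchi).
Qed.

Lemma fun_le_lap chi : test chi -> ip chi chi <= K * (K * ip (lap chi) (lap chi)).
Proof.
move=> tchi; apply: le_trans (poincare oOm OmB i0 tchi) _.
by rewrite ler_wpM2l ?sqr_ge0//; exact: grad_le_lap.
Qed.

Lemma D_test s phi : test phi -> ip (D s phi) (D s phi) = ip (pderiv s phi) (pderiv s phi).
Proof.
move=> tphi; apply: (ip_ae2 oOm (wderiv_sqint oOm OmB s phi) (sqint_test_pderiv oOm OmB s tphi)).
exact: (wderivE oOm OmB (wd_test oOm OmB s tphi)).
Qed.

Lemma wlap_test phi : test phi -> ae_eq_on Om (wlap phi) (lap phi).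
Proof.
move=> tphi; rewrite wlapE; apply: ae_eq_on_sum => i.
exact: (wderivE oOm OmB (wd_test oOm OmB _ tphi)).
Qed.

(** Induction applied to the Laplacian of phi bounds the Laplacian of every
    derivative of order at most m, hence by [hessian_le_lap] all derivatives of
    order between 2 and m + 2; Poincare's inequality gives orders 0 and 1. *)
Lemma elliptic_estimate m : exists2 C, 0 <= C & forall phi s, test phi -> (size s <= m)%N ->
  ip (pderiv s phi) (pderiv s phi) <= C * inner Om m phi phi.
Proof.
have K0 : 0 <= K by exact: sqr_ge0.
elim/nat_ind2 : m => [||m [C C0 hC]].
- by exists 1 => // phi [|//] tphi _; rewrite mul1r pderiv_nil.
- exists (K + 1); first by rewrite addr_ge0.
  move=> phi s tphi s1.
  have e1 : inner Om 1 phi phi = \sum_(i < n) ip (pderiv [:: i] phi) (pderiv [:: i] phi).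
    by rewrite (inner1 oOm OmB); apply: eq_bigr => i _; exact: D_test.
  have h i : ip (pderiv [:: i] phi) (pderiv [:: i] phi) <= inner Om 1 phi phi.
    rewrite e1 (bigD1 i)//= lerDl; apply: sumr_ge0 => k _; exact: ip_ge0.
  have p : 0 <= inner Om 1 phi phi by apply: le_trans (h i0); exact: ip_ge0.
  case: s s1 => [_|i [|//] _].
    rewrite pderiv_nil; apply: le_trans (poincare oOm OmB i0 tphi) _.
    have := ler_wpM2l K0 (h i0); rewrite -/K [(K + 1) * _]mulrDl mul1r; lra.
  have := mulr_ge0 K0 p; have := h i; rewrite [(K + 1) * _]mulrDl mul1r; lra.
- exists (C * (1 + K + K * K)); first by apply: mulr_ge0 => //; have := mulr_ge0 K0 K0; lra.
  move=> phi s tphi sm; have tL := test_lap tphi.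
  have e : inner Om m.+2 phi phi = inner Om m (lap phi) (lap phi).
    have Sw := wlap_sqint oOm OmB phi; have SL := test_sqint oOm OmB tL.
    rewrite innerSS (inner_ael oOm OmB m Sw SL Sw (wlap_test tphi)).
    exact: (inner_aer oOm OmB m Sw SL SL (wlap_test tphi)).
  have hL t : (size t <= m)%N ->
      ip (lap (pderiv t phi)) (lap (pderiv t phi)) <= C * inner Om m.+2 phi phi.
    by move=> tm; rewrite -(pderiv_lap t tphi) e; exact: hC.
  have h0 := hL [::] isT; rewrite pderiv_nil in h0.
  have p : 0 <= C * inner Om m.+2 phi phi by apply: le_trans h0; exact: ip_ge0.
  rewrite mulrAC; move: (C * inner Om m.+2 phi phi) h0 hL p => M h0 hL p.
  have M1 : M * (1 + K + K * K) = M + K * M + K * (K * M) by ring.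
  have KM : 0 <= K * M by rewrite mulr_ge0.
  have KKM : 0 <= K * (K * M) by rewrite mulr_ge0.
  rewrite M1; case: s sm => [_|i [_|j t tm]].
  + rewrite pderiv_nil; apply: le_trans (fun_le_lap tphi) _.
    apply: le_trans (ler_wpM2l K0 (ler_wpM2l K0 h0)) _.
    by rewrite lerDr addr_ge0.
  + apply: le_trans (grad_le_lap i tphi) _; apply: le_trans (ler_wpM2l K0 h0) _.
    by rewrite -addrA addrCA lerDl addr_ge0.
  + have E : pderiv [:: i; j] (pderiv t phi) = pderiv [:: i, j & t] phi.
      exact: (pderiv_cat [:: i; j] t phi).
    have H := hessian_le_lap i j (test_pderiv t tphi); rewrite E in H.
    apply: le_trans H _; apply: le_trans (hL t tm) _.
    by rewrite -addrA lerDl addr_ge0.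
Qed.

Lemma hform_test m : exists2 C, 0 <= C & forall phi, test phi ->
  hform Om m phi phi <= C * inner Om m phi phi.
Proof.
have [C C0 hC] := elliptic_estimate m; exists (hcount R n m * C).
  by rewrite mulr_ge0// hcount_ge0.
move=> phi tphi; rewrite -mulrA; apply: hform_le => s sm.
by rewrite D_test//; exact: hC.
Qed.

(** The estimate for test functions passes to limits in the Sobolev norm because
    both forms are continuous for it. *)
Lemma hform_le_inner m : exists2 C, 0 <= C & forall u, sobolev0 Om m u ->
  hform Om m u u <= C * inner Om m u u.
Proof.
have [C1 C10 h1] := hform_test m; have [C2 C20 h2] := inner_le_hform oOm OmB m.
have Sh := semi_inner_hform oOm OmB m; have Si := semi_inner_inner oOm OmB m.
exists C1 => // u [hu ucl].
pose c1 := Num.sqrt C1; pose c2 := Num.sqrt C2.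
have c10 : 0 <= c1 by exact: sqrtr_ge0.
have c20 : 0 <= c2 by exact: sqrtr_ge0.
have i_ge0 := si_ge0 Si hu.
suff h : Num.sqrt (hform Om m u u) <= c1 * Num.sqrt (inner Om m u u).
  rewrite -(sqr_sqrtr (hform_ge0 Om m u)) -[X in _ <= _ * X](sqr_sqrtr i_ge0).
  by rewrite -[X in _ <= X * _](sqr_sqrtr C10) -exprMn lerXn2r ?nnegrE ?mulr_ge0 ?sqrtr_ge0.
apply/ler_addgt0Pr => e e0.
have d0 : 0 < 1 + c1 * c2 by rewrite ltr_pwDl// mulr_ge0.
have e1 : 0 < e / (1 + c1 * c2) by rewrite divr_gt0.
have [phi tphi] := ucl _ e1; rewrite sobolev_normE => hphi.
have hp := sobolev_test oOm OmB m tphi.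
have hup := si_subB Si hu hp.
have a1 := si_sqrtB Sh hu hp.
have a2 : Num.sqrt (hform Om m phi phi) <= c1 * Num.sqrt (inner Om m phi phi).
  by rewrite -sqrtrM// ler_wsqrtr// h1.
have a3 := si_sqrtB Si hp hu; rewrite (si_sq_BC Si hp hu) in a3.
have a4 : Num.sqrt (inner Om m (u - phi) (u - phi)) <= c2 * Num.sqrt (hform Om m (u - phi) (u - phi)).
  by rewrite -sqrtrM// ler_wsqrtr// h2.
have {}hphi : Num.sqrt (hform Om m (u - phi) (u - phi)) * (1 + c1 * c2) <= e.
  by rewrite -ler_pdivlMr//; exact: ltW.
exact: approx_le c10 a1 a2 a3 a4 hphi.
Qed.

End elliptic.

(** * Limits of test functions *)

Lemma mean0_estimate (R : realType) (M x k y e : R) : 0 <= M -> 0 <= k -> 0 <= y -> 0 < e ->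
  x <= k * y -> y < e / (M + 1) / (k + 1) -> x * M <= e.
Proof.
move=> M0 k0 y0 e0 xk.
rewrite ltr_pdivlMr; last by lra.
rewrite ltr_pdivlMr; last by lra.
move=> h; apply: ltW; apply: le_lt_trans h.
have := ler_wpM2r M0 xk; have := mulr_ge0 y0 k0; have := mulr_ge0 y0 M0; nra.
Qed.

Local Opaque ip pderiv hform.

Section sobolev0.
Context (R : realType) (n : nat) (Om : set 'rV[R]_n) (B : R).
Hypotheses (oOm : open Om) (OmB : Om `<=` cube B).
Implicit Types (u v w z f g phi psi chi : 'rV[R]_n -> R) (i j : 'I_n) (s t : seq 'I_n).

Local Notation mu := (lebesgue_rV R n).
Local Notation test := (test_function Om).
Local Notation ip := (ip mu Om).
Local Notation wd := (is_weak_deriv Om).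
Local Notation D := (wderiv Om).

Let mOm : measurable Om. Proof. exact: open_measurable_rV. Qed.
Let Sip := semi_inner_ip mu mOm.
Let Sh m := semi_inner_hform oOm OmB m.
Let Si m := semi_inner_inner oOm OmB m.

Local Notation nrm m u := (Num.sqrt (hform Om m u u)).

Lemma sobolev0_sobolev m u : sobolev0 Om m u -> sobolev Om m u.
Proof. by case. Qed.

Lemma sobolev0_approx m u e : sobolev0 Om m u -> 0 < e ->
  exists2 phi, test phi & nrm m (u - phi) < e.
Proof. by move=> [_ h] /h[phi tphi he]; exists phi. Qed.

Lemma sobolev0P m u : sobolev Om m u ->
  (forall e, 0 < e -> exists2 phi, test phi & nrm m (u - phi) < e) -> sobolev0 Om m u.
Proof. by move=> hu h; split => // e /h[phi tphi he]; exists phi. Qed.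

Lemma sobolev0_test m phi : test phi -> sobolev0 Om m phi.
Proof.
move=> tphi; have hp := sobolev_test oOm OmB m tphi.
apply: sobolev0P => // e e0; exists phi => //.
rewrite (si_sq_B (Sh m) hp hp) (_ : _ - _ + _ = 0) ?sqrtr0//; ring.
Qed.

Lemma sobolev0_comb m c u v : sobolev0 Om m u -> sobolev0 Om m v ->
  sobolev0 Om m (c *: u + v).
Proof.
move=> hu hv; have su := sobolev0_sobolev hu; have sv := sobolev0_sobolev hv.
apply: sobolev0P; first exact: (sobolev_comb oOm OmB).
move=> e e0.
have c0 : 0 < `|c| + 1 by rewrite ltr_wpDl.
have e1 : 0 < e / (2 * (`|c| + 1)) by rewrite divr_gt0// mulr_gt0.
have e2 : 0 < e / 2 by rewrite divr_gt0.
have [phi tphi h1] := sobolev0_approx hu e1.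
have [psi tpsi h2] := sobolev0_approx hv e2.
exists (c *: phi + psi); first exact: test_comb.
have -> : (c *: u + v) - (c *: phi + psi) = c *: (u - phi) + (v - psi).
  by rewrite scalerBr opprD addrACA.
have hp := sobolev_test oOm OmB m tphi; have hq := sobolev_test oOm OmB m tpsi.
have su' := si_subB (Sh m) su hp; have sv' := si_subB (Sh m) sv hq.
exact: (si_sqrt_comb_lt (Sh m) su' sv' h1 h2).
Qed.

Lemma sobolev0_0 m : sobolev0 Om m 0.
Proof. by apply: sobolev0_test; exact: test0. Qed.

Lemma semi_inner_sobolev0 m : semi_inner (sobolev0 Om m) (inner Om m).
Proof.
apply: semi_innerS (Si m) _ _ _.
- exact: sobolev0_sobolev.
- exact: sobolev0_0.
- by move=> c u v; exact: sobolev0_comb.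
Qed.

Lemma sobolev0_sum m (I : Type) (r : seq I) (F : I -> 'rV[R]_n -> R) :
  (forall k, sobolev0 Om m (F k)) -> sobolev0 Om m (\sum_(k <- r) F k).
Proof.
move=> hF; elim: r => [|k r IH]; first by rewrite big_nil; exact: sobolev0_0.
by rewrite big_cons -[F k]scale1r; exact: (sobolev0_comb 1 (hF k) IH).
Qed.

Lemma hform_wderiv_B m i u phi : sobolev Om m.+1 u -> test phi ->
  hform Om m (D [:: i] u - pderiv [:: i] phi) (D [:: i] u - pderiv [:: i] phi) <=
  hcount R n m * hform Om m.+1 (u - phi) (u - phi).
Proof.
move=> hu tphi; have hp := sobolev_test oOm OmB m.+1 tphi.
have hup := si_subB (Sh m.+1) hu hp.
have Su := sobolev_sqint oOm hu; have Sp := test_sqint oOm OmB tphi.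
have h : wd [:: i] (u - phi) (D [:: i] u - pderiv [:: i] phi).
  have := wd_comb oOm OmB (-1) Sp Su (wd_test oOm OmB [:: i] tphi) (sobolev_wd hu (s := [:: i]) isT).
  by rewrite !scaleN1r ![- _ + _]addrC.
have S1 := wderiv_sqint oOm OmB [:: i] (u - phi).
rewrite -(hform_ae oOm OmB m S1 (wd_sqint oOm h) (wderivE oOm OmB h)).
exact: (@hform_wderiv R n Om B oOm OmB m (u - phi) [:: i] hup).
Qed.

(** Derivatives of test functions close to u are close to the derivative of
    u. *)
Lemma sobolev0_wderiv m i u : sobolev0 Om m.+1 u -> sobolev0 Om m (D [:: i] u).
Proof.
move=> hu; have su := sobolev0_sobolev hu.
apply: sobolev0P; first exact: (sobolev_wderiv oOm OmB su).
move=> e e0; pose c := Num.sqrt (hcount R n m) + 1.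
have c0 : 0 < c by rewrite ltr_wpDl ?sqrtr_ge0.
have [phi tphi h] := sobolev0_approx hu (divr_gt0 e0 c0).
exists (pderiv [:: i] phi); first exact: test_pderiv1.
have := ler_wsqrtr (hform_wderiv_B i su tphi).
rewrite sqrtrM ?hcount_ge0// => /le_lt_trans; apply.
move: h; rewrite ltr_pdivlMr// => h.
apply: le_lt_trans h; rewrite mulrC ler_wpM2l ?sqrtr_ge0//.
by rewrite /c lerDl.
Qed.

(** True for test functions by [test_integral0]; on the bounded set Om the mean is
    continuous in mean square, by Cauchy-Schwarz against 1. *)
Lemma wderiv_mean0 m i u : sobolev0 Om m.+1 u -> \int[mu]_(x in Om) D [:: i] u x = 0.
Proof.
move=> hu; have su := sobolev0_sobolev hu.
have S1 := sqint_cst oOm OmB 1; have SD := wderiv_sqint oOm OmB [:: i] u.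
rewrite -(ip_cst1 Om); apply/eqP; rewrite -normr_le0.
apply/ler_addgt0Pr => e e0; rewrite add0r.
pose M := Num.sqrt (ip (cst 1) (cst 1)).
have M0 : 0 <= M by exact: sqrtr_ge0.
have M1 : 0 < M + 1 by rewrite ltr_wpDl.
have hc0 := hcount_ge0 R n m.
pose c := Num.sqrt (hcount R n m) + 1.
have c0 : 0 < c by rewrite ltr_wpDl ?sqrtr_ge0.
have [phi tphi h] := sobolev0_approx hu (divr_gt0 (divr_gt0 e0 M1) c0).
have tD := test_pderiv1 i tphi; have SP := test_sqint oOm OmB tD.
have SB := si_subB Sip SD SP.
have p0 : ip (pderiv [:: i] phi) (cst 1) = 0.
  rewrite ip_cst1 (Rintegral_support (fun x nx => test_out tD nx)).
  exact: (test_integral0 OmB i tphi).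
have E : ip (D [:: i] u) (cst 1) = ip (D [:: i] u - pderiv [:: i] phi) (cst 1).
  by rewrite (si_Bl Sip SD SP S1) p0 subr0.
rewrite E; apply: le_trans (si_norm_cs Sip SB S1) _.
have h0 := wderivE oOm OmB (wd_nil oOm SB).
have h1 := le_hform Om (D [:: i] u - pderiv [:: i] phi) (s := [::]) (leq0n m).
rewrite (ip_ae2 oOm (wderiv_sqint oOm OmB [::] _) SB h0) in h1.
have h2 := ler_wsqrtr (le_trans h1 (hform_wderiv_B i su tphi)).
rewrite (sqrtrM _ hc0) in h2.
exact: (mean0_estimate M0 (sqrtr_ge0 _) (sqrtr_ge0 _) e0 h2 h).
Qed.

End sobolev0.

(** * Completeness and vector fields *)

Lemma sqrt_sum_lt (R : realType) (a b e : R) : 0 < e ->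
  a < (e / 2) ^+ 2 -> Num.sqrt b < e / 2 -> Num.sqrt a + Num.sqrt b < e.
Proof.
move=> e0 ha hb; have e2 : 0 < e / 2 by rewrite divr_gt0.
have : Num.sqrt a < e / 2.
  by rewrite -(@ger0_norm _ (e / 2)) ?ltW// -sqrtr_sqr ltr_sqrt// exprn_gt0.
lra.
Qed.

Section completeness.
Context (R : realType) (n : nat) (Om : set 'rV[R]_n) (B : R).
Hypotheses (oOm : open Om) (OmB : Om `<=` cube B) (n0 : (0 < n)%N).
Implicit Types (u v w z f g phi psi chi : 'rV[R]_n -> R) (i j : 'I_n) (s t : seq 'I_n).

Local Notation mu := (lebesgue_rV R n).
Local Notation ip := (ip mu Om).
Local Notation sqint := (square_integrable mu Om).
Local Notation wd := (is_weak_deriv Om).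
Local Notation D := (wderiv Om).

Let mOm : measurable Om. Proof. exact: open_measurable_rV. Qed.
Let Sip := semi_inner_ip mu mOm.
Let Sh m := semi_inner_hform oOm OmB m.
Let Si m := semi_inner_inner oOm OmB m.

Lemma ip_D_B m s u u' w' : sobolev Om m u -> sqint u' -> (size s <= m)%N -> wd s u' w' ->
  ip (D s u - w') (D s u - w') = ip (D s (u - u')) (D s (u - u')).
Proof.
move=> hu Su' sm uw'; have Su := sobolev_sqint oOm hu.
have h : wd s (u - u') (D s u - w').
  have := wd_comb oOm OmB (-1) Su' Su uw' (sobolev_wd hu sm).
  by rewrite !scaleN1r ![- _ + _]addrC.
have S1 := wderiv_sqint oOm OmB s (u - u').
exact: esym (ip_ae2 oOm S1 (wd_sqint oOm h) (wderivE oOm OmB h)).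
Qed.

(** A Cauchy sequence for [inner] is one for [hform] by [hform_le_inner], so all
    derivatives up to order m converge in mean square; by [wd_cvg] their limits
    are the derivatives of the limit. *)
Lemma complete_sobolev0 m : complete_form (sobolev0 Om m) (inner Om m).
Proof.
move=> g hg cg.
have [C C0 hC] := hform_le_inner oOm OmB n0 m.
have [C2 C20 hC2] := inner_le_hform oOm OmB m.
have gs k := sobolev0_sobolev (hg k).
have ch : cauchy_form (hform Om m) g.
  move=> e e0; have C1 : 0 < C + 1 by rewrite ltr_wpDl.
  have [N hN] := cg _ (divr_gt0 e0 C1); exists N => i j Ni Nj.
  have h := hN i j Ni Nj.
  have hij := si_subB (semi_inner_sobolev0 oOm OmB m) (hg i) (hg j).
  apply: le_lt_trans (hC _ hij) _.
  have p := si_ge0 (Si m) (sobolev0_sobolev hij).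
  rewrite ltr_pdivlMr// in h; apply: le_lt_trans h.
  by rewrite mulrC ler_wpM2l// lerDl.
have SD s k : sqint (D s (g k)) by exact: (wderiv_sqint oOm OmB).
have /choice[W hW] : forall s, exists w, (size s <= m)%N -> sqint w /\
    (fun k => ip (D s (g k) - w) (D s (g k) - w)) @ \oo --> 0.
  move=> s; have [sm|sm] := leqP (size s) m; last by exists 0.
  have cs : cauchy_form ip (fun k => D s (g k)).
    move=> e e0; have [N hN] := ch e e0; exists N => i j Ni Nj.
    have Sj := sobolev_sqint oOm (gs j).
    rewrite (ip_D_B (gs i) Sj sm (sobolev_wd (gs j) sm)).
    exact: le_lt_trans (le_hform _ _ sm) (hN i j Ni Nj).
  have [w Sw cw] := complete_ip mOm (SD s) cs.
  by exists w.
pose u := W [::].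
have [Su cu] := hW [::] isT.
have Sg k := sobolev_sqint oOm (gs k).
have cgu : (fun k => ip (g k - u) (g k - u)) @ \oo --> 0.
  rewrite (_ : (fun k => _) = (fun k => ip (D [::] (g k) - u) (D [::] (g k) - u)))//.
  apply/funext => k.
  have E : ae_eq_on Om (g k - u) (D [::] (g k) - u).
    have := wderivE oOm OmB (wd_nil oOm (Sg k)).
    by apply: filterS => x h Ox; rewrite -[RHS]/(D [::] (g k) x - u x) (h Ox).
  exact: (ip_ae2 oOm (si_subB Sip (Sg k) Su) (si_subB Sip (SD [::] k) Su) E).
have wdu s : (size s <= m)%N -> wd s u (W s).
  move=> sm; have [SW cW] := hW s sm.
  exact: (wd_cvg oOm OmB Sg Su SW (fun k => sobolev_wd (gs k) sm) cgu cW).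
have hu : sobolev Om m u.
  apply: (sobolevP oOm Su) => s sm; exists (W s); exact: wdu.
have hcvg : (fun k => hform Om m (g k - u) (g k - u)) @ \oo --> 0.
  rewrite (_ : (fun k => _) = (fun k => \sum_(j < m.+1) \sum_(s : j.-tuple 'I_n)
     ip (D s (g k - u)) (D s (g k - u)))); last by apply/funext => k; exact: hformE.
  apply: cvg0_sum => j; apply: cvg0_sum => s.
  have sm : (size s <= m)%N by rewrite size_tuple -ltnS.
  have [SW cW] := hW s sm.
  rewrite (_ : (fun k => _) = (fun k => ip (D s (g k) - W s) (D s (g k) - W s)))//.
  by apply/funext => k; exact: esym (ip_D_B (gs k) Su sm (wdu s sm)).
have h0 : sobolev0 Om m u.
  apply: (sobolev0P hu) => e e0.
  have e2 : 0 < e / 2 by rewrite divr_gt0.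
  have e22 : 0 < (e / 2) ^+ 2 by rewrite exprn_gt0.
  have [k hk] : exists k, hform Om m (g k - u) (g k - u) < (e / 2) ^+ 2.
    have /cvgrPdist_lt/(_ _ e22)[N _ hN] := hcvg; exists N.
    have := hN N (leqnn N).
    by rewrite /= sub0r normrN (ger0_norm (hform_ge0 _ _ _)).
  have [phi tphi hphi] := sobolev0_approx (hg k) e2; exists phi; first exact: tphi.
  have hp := sobolev_test oOm OmB m tphi.
  have -> : u - phi = (u - g k) + (g k - phi) by rewrite addrA subrK.
  apply: le_lt_trans (si_sqrtD (Sh m) (si_subB (Sh m) hu (gs k)) (si_subB (Sh m) (gs k) hp)) _.
  rewrite -(si_sq_BC (Sh m) hu (gs k)) in hk.
  exact: (sqrt_sum_lt e0 hk hphi).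
exists u; first exact: h0.
have h1 : (fun k => C2 * hform Om m (g k - u) (g k - u)) @ \oo --> 0.
  by have := cvgM (cvg_cst C2) hcvg; rewrite mulr0; apply.
apply: (@squeeze_cvgr _ _ _ _ (fun=> 0)) h1; last exact: cvg_cst.
apply: nearW => k; have hk := si_subB (Si m) (gs k) hu.
by rewrite (si_ge0 (Si m) hk) (hC2 _ hk).
Qed.

End completeness.

Section vector_fields.
Context (R : realType) (n : nat) (Om : set 'rV[R]_n) (B : R).
Hypotheses (oOm : open Om) (OmB : Om `<=` cube B) (n0 : (0 < n)%N).
Implicit Types (u v : 'rV[R]_n -> 'rV[R]_n) (i j : 'I_n).

Local Notation mu := (lebesgue_rV R n).
Local Notation D := (wderiv Om).

Let mOm : measurable Om. Proof. exact: open_measurable_rV. Qed.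
Let Si m := semi_inner_sobolev0 oOm OmB m.

Lemma vcomp_comb c u v i : vcomp (c *: u + v) i = c *: vcomp u i + vcomp v i.
Proof. by apply/funext => x; rewrite /vcomp !mxE. Qed.

Lemma vcomp_B u v i : vcomp (u - v) i = vcomp u i - vcomp v i.
Proof. by apply/funext => x; rewrite /vcomp !mxE. Qed.

Lemma vcomp_0 i : vcomp (0 : 'rV[R]_n -> 'rV[R]_n) i = 0.
Proof. by apply/funext => x; rewrite /vcomp mxE. Qed.

Definition vinner m v (w : 'rV[R]_n -> 'rV[R]_n) : R := \sum_(i < n) inner Om m (vcomp v i) (vcomp w i).

Lemma semi_inner_vinner m : semi_inner (vsobolev0 Om m) (vinner m).
Proof.
split.
- by move=> i; rewrite vcomp_0; exact: (sobolev0_0 oOm OmB).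
- by move=> c u v hu hv i; rewrite vcomp_comb; exact: (sobolev0_comb oOm OmB).
- move=> c u v w hu hv hw; rewrite mulr_sumr -big_split; apply: eq_bigr => i _.
  by rewrite vcomp_comb; exact: (si_lin (Si m) c (hu i) (hv i) (hw i)).
- by move=> u v hu hv; apply: eq_bigr => i _; exact: (si_sym (Si m)).
- by move=> u hu; apply: sumr_ge0 => i _; exact: (si_ge0 (Si m) (hu i)).
Qed.

Lemma le_vinner m v i : vsobolev0 Om m v ->
  inner Om m (vcomp v i) (vcomp v i) <= vinner m v v.
Proof.
move=> hv; rewrite /vinner (bigD1 i)//= lerDl; apply: sumr_ge0 => j _.
exact: (si_ge0 (Si m) (hv j)).
Qed.

Lemma complete_vinner m : complete_form (vsobolev0 Om m) (vinner m).
Proof.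
move=> g hg cg.
have /choice[W hW] : forall i, exists w : 'rV[R]_n -> R, sobolev0 Om m w /\
    (fun k => inner Om m (vcomp (g k) i - w) (vcomp (g k) i - w)) @ \oo --> 0.
  move=> i; have ci : cauchy_form (inner Om m) (fun k => vcomp (g k) i).
    move=> e e0; have [N hN] := cg e e0; exists N => k l Nk Nl.
    apply: le_lt_trans (hN k l Nk Nl); rewrite -vcomp_B; apply: le_vinner.
    exact: (si_subB (semi_inner_vinner m)).
  by have [w hw cw] := complete_sobolev0 oOm OmB n0 (fun k => hg k i) ci; exists w.
pose w : 'rV[R]_n -> 'rV[R]_n := fun x => \row_i W i x.
have wi i : vcomp w i = W i by apply/funext => x; rewrite /vcomp mxE.
exists w; first by move=> i; rewrite wi; case: (hW i).
apply: cvg0_sum => i; have [_] := hW i.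
by under [in X in _ -> X]eq_fun do rewrite vcomp_B wi.
Qed.

Lemma wdivE v : wdiv Om v = \sum_(i < n) D [:: i] (vcomp v i).
Proof. by apply/funext => x; rewrite fct_sumE. Qed.

Lemma wdiv_sobolev0 m v : vsobolev0 Om m.+1 v -> sobolev0 Om m (wdiv Om v).
Proof.
move=> hv; rewrite wdivE; apply: (sobolev0_sum oOm OmB) => i.
exact: (sobolev0_wderiv oOm OmB i (hv i)).
Qed.

Lemma wdiv_mean0 m v : vsobolev0 Om m.+1 v -> zero_mean Om (wdiv Om v).
Proof.
move=> hv; rewrite /zero_mean wdivE.
have S1 := sqint_cst oOm OmB 1.
have SD i := wderiv_sqint oOm OmB [:: i] (vcomp v i).
rewrite -ip_cst1 (ip_suml oOm _ SD S1) big1// => i _; rewrite ip_cst1.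
exact: (wderiv_mean0 oOm OmB i (hv i)).
Qed.

Lemma wdiv_comb m c u v : vsobolev0 Om m.+1 u -> vsobolev0 Om m.+1 v ->
  ae_eq_on Om (wdiv Om (c *: u + v)) (c *: wdiv Om u + wdiv Om v).
Proof.
move=> hu hv; rewrite !wdivE.
have -> : c *: \sum_(i < n) D [:: i] (vcomp u i) + \sum_(i < n) D [:: i] (vcomp v i) =
    \sum_(i < n) (c *: D [:: i] (vcomp u i) + D [:: i] (vcomp v i)).
  by rewrite scaler_sumr -big_split.
apply: ae_eq_on_sum => i; rewrite vcomp_comb.
have hui := sobolev0_sobolev (hu i); have hvi := sobolev0_sobolev (hv i).
exact: (wderiv_comb oOm OmB c hui hvi).
Qed.

Lemma wdiv_bound m : exists2 K, 0 <= K & forall v, vsobolev0 Om m.+1 v ->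
  inner Om m (wdiv Om v) (wdiv Om v) <= K * vinner m.+1 v v.
Proof.
have [C C0 hC] := hform_le_inner oOm OmB n0 m.+1.
have [C2 C20 hC2] := inner_le_hform oOm OmB m.
have hc := hcount_ge0 R n m.
exists (C2 * (n%:R ^+ 2 * (hcount R n m * C))).
  by apply: mulr_ge0 => //; apply: mulr_ge0; [exact: sqr_ge0|exact: mulr_ge0].
move=> v hv; apply: le_trans (hC2 _ (sobolev0_sobolev (wdiv_sobolev0 hv))) _.
rewrite -[C2 * _ * _]mulrA ler_wpM2l// wdivE.
have p : 0 <= vinner m.+1 v v by exact: (si_ge0 (semi_inner_vinner m.+1) hv).
have := @si_sum_bound R _ (sobolev Om m) (hform Om m) 'I_n (index_enum 'I_n)
  (fun i => D [:: i] (vcomp v i)) (hcount R n m * C * vinner m.+1 v v) (semi_inner_hform oOm OmB m).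
rewrite size_index_ord -[n%:R ^+ 2 * _ * _]mulrA; apply.
- by apply: mulr_ge0 => //; exact: mulr_ge0.
- by move=> i; exact: sobolev0_sobolev (sobolev0_wderiv oOm OmB i (hv i)).
- move=> i; have hi := sobolev0_sobolev (hv i).
  apply: le_trans (@hform_wderiv R n Om B oOm OmB m _ [:: i] hi) _.
  rewrite -mulrA ler_wpM2l//; apply: le_trans (hC _ (hv i)) _.
  by rewrite ler_wpM2l//; exact: le_vinner.
Qed.

End vector_fields.

(** * The divergence as a bilinear pairing *)

Section divergence.
Context (R : realType) (n : nat) (Om : set 'rV[R]_n) (B : R).
Hypotheses (oOm : open Om) (OmB : Om `<=` cube B) (n0 : (0 < n)%N).
Implicit Types (f g h : 'rV[R]_n -> R) (u v : 'rV[R]_n -> 'rV[R]_n).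

Local Notation mu := (lebesgue_rV R n).
Local Notation D := (wderiv Om).

Let mOm : measurable Om. Proof. exact: open_measurable_rV. Qed.
Let Sip := semi_inner_ip mu mOm.
Let Si m := semi_inner_sobolev0 oOm OmB m.

Lemma zero_mean_comb c f g : square_integrable mu Om f -> square_integrable mu Om g ->
  zero_mean Om f -> zero_mean Om g -> zero_mean Om (c *: f + g).
Proof.
rewrite /zero_mean -!(ip_cst1 Om) => Sf Sg f0 g0.
by rewrite (si_lin Sip c Sf Sg (sqint_cst oOm OmB 1)) f0 g0 mulr0 addr0.
Qed.

Lemma X_sqint m f : X_ Om m f -> square_integrable mu Om f.
Proof. by move=> [/sobolev0_sobolev hf _]; exact: (sobolev_sqint oOm hf). Qed.

Lemma semi_inner_X m : semi_inner (X_ Om m) (inner Om m).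
Proof.
split.
- split; first exact: si_0 (Si m).
  by rewrite /zero_mean -(ip_cst1 Om) (ipC mu Om) (si_0r Sip (sqint_cst oOm OmB 1)).
- move=> c f g Xf Xg; split; first exact: (si_comb (Si m) c Xf.1 Xg.1).
  exact: (zero_mean_comb c (X_sqint Xf) (X_sqint Xg) Xf.2 Xg.2).
- by move=> c f g h Xf Xg Xh; exact: (si_lin (Si m) c Xf.1 Xg.1 Xh.1).
- by move=> f g Xf Xg; exact: (si_sym (Si m) Xf.1 Xg.1).
- by move=> f Xf; exact: (si_ge0 (Si m) Xf.1).
Qed.

Lemma wdiv_X m v : vsobolev0 Om m.+1 v -> X_ Om m (wdiv Om v).
Proof.
by move=> hv; split; [exact: (wdiv_sobolev0 oOm OmB hv)|exact: (wdiv_mean0 oOm OmB hv)].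
Qed.

(** The term of [hform] for the empty list is the L^2 norm. *)
Lemma inner_eq0 m f : sobolev0 Om m f ->
  inner Om m f f = 0 <-> ae_eq_on Om f (cst 0).
Proof.
move=> hf; have Sf := sobolev_sqint oOm (sobolev0_sobolev hf).
have S0 := si_0 Sip; split => [f0|f0].
  have [C C0 /(_ f hf)] := hform_le_inner oOm OmB n0 m; rewrite f0 mulr0 => hC.
  have SD := wderiv_sqint oOm OmB [::] f.
  have D0 : ip mu Om (D [::] f) (D [::] f) = 0.
    apply/eqP; rewrite eq_le (si_ge0 Sip SD) andbT.
    exact: le_trans (@le_hform R n Om m f [::] isT) hC.
  apply: ae_eq_on_trans (ip_eq0 mOm SD D0).
  exact: ae_eq_on_sym (wderivE oOm OmB (wd_nil oOm Sf)).
rewrite (inner_aer oOm OmB m Sf S0 Sf f0).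
exact: (si_0r (Si m) hf).
Qed.

Lemma vinner_eq0 m v : vsobolev0 Om m v ->
  vinner Om m v v = 0 <-> {ae mu, forall x, Om x -> v x = 0}.
Proof.
move=> hv; have p i : 0 <= inner Om m (vcomp v i) (vcomp v i) := si_ge0 (Si m) (hv i).
split=> [v0|v0].
  have H i : {ae mu, forall x, Om x -> vcomp v i x = 0}.
    apply/(inner_eq0 (hv i))/eqP; rewrite eq_le p andbT -v0.
    exact: (le_vinner oOm OmB i hv).
  have G : {ae mu, forall x, forall i, Om x -> vcomp v i x = 0} by exact: filter_forall.
  apply: filterS G => x hx Ox; apply/rowP => i.
  by rewrite mxE; exact: hx.
rewrite /vinner big1// => i _; apply/(inner_eq0 (hv i)).
by apply: filterS v0 => x hx Ox; rewrite /vcomp hx// mxE.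
Qed.

(** The difference of the two functions lies in X_m, and an element of X_m
    orthogonal to X_m is null. *)
Lemma wdiv_solves m v f : vsobolev0 Om m.+1 v -> X_ Om m f ->
  ae_eq_on Om (wdiv Om v) f <->
  forall h, X_ Om m h -> inner Om m h (wdiv Om v) = inner Om m h f.
Proof.
move=> hv Xf; have Xv := wdiv_X hv; split=> [vf h Xh|H].
  exact: (inner_aer oOm OmB m (X_sqint Xv) (X_sqint Xf) (X_sqint Xh) vf).
have SX := semi_inner_X m; have Xd := si_subB SX Xv Xf.
have /(inner_eq0 Xd.1) d0 : inner Om m (wdiv Om v - f) (wdiv Om v - f) = 0.
  by rewrite (si_Br SX Xv Xf Xd) (H _ Xd) subrr.
apply: filterS d0 => x hx Ox; apply/eqP; rewrite -subr_eq0; apply/eqP; exact: hx Ox.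
Qed.

(** It makes the dual norm a supremum over a nonempty set, hence
    nonnegative. *)
Lemma vsobolev0_nontrivial m : Om !=set0 ->
  exists2 v, vsobolev0 Om m v & ~ {ae mu, forall x, Om x -> v x = 0}.
Proof.
move=> [x0 Ox0]; have [p px pO] := open_rat_box oOm Ox0.
pose phi : 'rV[R]_n -> R := box_bump (map_mx ratr p.1) (map_mx ratr p.2) 1.
have tphi : test_function Om phi by exact: bump_test.
pose v : 'rV[R]_n -> 'rV[R]_n := fun x => const_mx (phi x).
have vi i : vcomp v i = phi by apply/funext => x; rewrite /vcomp mxE.
exists v; first by move=> i; rewrite vi; exact: (sobolev0_test oOm OmB).
move=> v0; have phi0 : ae_eq_on Om phi (cst 0).
  by rewrite -(vi (Ordinal n0)); apply: filterS v0 => x hx Ox; rewrite /vcomp hx// mxE.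
have := continuous_ae0 oOm (test_continuous tphi) phi0 Ox0.
by apply/eqP; rewrite gt_eqF// bump_gt0.
Qed.

End divergence.

Lemma bounded_sub_cube (R : realType) (n : nat) (Om : set 'rV[R]_n) :
  bounded_set Om -> exists B, Om `<=` cube B.
Proof.
move=> [M [_ MB]]; exists (M + 2) => x Ox; apply/cubeE => i.
apply: le_lt_trans (le_coord_norm x i) _.
apply: (@le_lt_trans _ _ (M + 1)); last by lra.
by apply: MB Ox; lra.
Qed.

Theorem proposition4p4 (R : realType) (n : nat) (Om : set 'rV[R]_n) (m : nat)
    (hn : (2 <= n)%N) (hOm : bounded_lipschitz_domain Om) (hm : (1 <= m)%N) :
  bogovskii_constant Om m =
  ereal_sup [set ((hnorm Om m f ^+ 2)%:E /
                  dual_norm Om m.+1 (grad_polylaplacian Om m f) ^+ 2)%E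
            | f in [set f | X_ Om m f /\ ~ ae_eq_on Om f (cst 0)]].
Proof.
have [Om0 oOm _ /bounded_sub_cube[B OmB] _] := hOm.
have n0 : (0 < n)%N by exact: ltn_trans hn.
have SX := semi_inner_X oOm OmB m.
have SV := semi_inner_vinner oOm OmB m.+1.
have dualE f : dual_norm Om m.+1 (grad_polylaplacian Om m f) =
    ereal_sup [set (`|inner Om m f (wdiv Om v)| / Num.sqrt (vinner Om m.+1 v v))%:E
      | v in [set v | vsobolev0 Om m.+1 v /\
                      ~ {ae lebesgue_rV R n, forall x, Om x -> v x = 0}]].
  rewrite /dual_norm; congr ereal_sup; apply: eq_imagel => v _.
  by rewrite /grad_polylaplacian normrN.
under [in RHS]eq_imagel do rewrite dualE.
apply: (inf_sup_duality SV (complete_vinner oOm OmB n0 (m := m.+1)) SX).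
- move=> c g h v Xg Xh hv.
  exact: (si_lin SX c Xg Xh (wdiv_X oOm OmB hv)).
- move=> c u v h hu hv Xh; have Xu := wdiv_X oOm OmB hu; have Xv := wdiv_X oOm OmB hv.
  rewrite -(si_linr SX c Xu Xv Xh).
  have Xuv := wdiv_X oOm OmB (si_comb SV c hu hv); have XX := si_comb SX c Xu Xv.
  exact: (inner_aer oOm OmB m (X_sqint oOm Xuv) (X_sqint oOm XX) (X_sqint oOm Xh)
            (wdiv_comb oOm OmB c hu hv)).
- move=> h Xh; have [K K0 hK] := wdiv_bound oOm OmB n0 m.
  have h0 := si_ge0 SX Xh; exists (inner Om m h h * K); first exact: mulr_ge0.
  move=> v hv; apply: le_trans (si_cauchy_schwarz SX Xh (wdiv_X oOm OmB hv)) _.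
  by rewrite -mulrA ler_wpM2l// hK.
- by move=> v f hv Xf; exact: (wdiv_solves oOm OmB n0).
- move=> v hv; have [P Q] := vinner_eq0 oOm OmB n0 hv; split.
    by move=> nv; apply/eqP => /P.
  by move=> /eqP nv /Q.
- move=> f [hf _]; have [P Q] := inner_eq0 oOm OmB n0 hf; split.
    by move=> nf; apply/eqP => /P.
  by move=> /eqP nf /Q.
- exact: (vsobolev0_nontrivial oOm OmB n0).
Qed.
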